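(* If $2\parallel n$ or $4\parallel n$, then the number $\nu(n)$ of isomorphism classes of regular embeddings of $K_{n,n}$ in orientable surfaces is \[\nu(n)=\sum_{\Gamma\preceq\Pi_n}\ \prod_{q\in N(\Gamma)}\Bigl(\sum_{f=1}^{e_q}\phi(q^{e_q-f})\prod_{q\to p\ \text{in}\ \Gamma}\bigl(q^{f_{q,p}}-1\bigr)\Bigr).\]
   Context: A regular embedding of $K_{n,n}$ is an embedding in a closed orientable surface whose orientation-preserving automorphism group acts transitively on arcs; isomorphism means orientation-preserving isomorphism. $\Pi_n$ is the directed graph whose vertices are the primes dividing $n$, with an arc $q\to p$ iff $q\mid p-1$. $\Gamma\preceq\Pi_n$ means $\Gamma$ is a short spanning subgraph: a subgraph of $\Pi_n$ containing all its vertices and containing no directed path of length $2$ (no $r\to q\to p$). $N(\Gamma)$ is the set of non-terminal vertices of $\Gamma$ (vertices at which no arc of $\Gamma$ ends). For a prime $q\mid n$, $q^{e_q}\parallel n$; for an arc $q\to p$, $r(q,p)$ is defined by $q^{r(q,p)}\parallel p-1$ and $f_{q,p}=\min\{f,r(q,p)\}$. $\phi$ is Euler's function; the inner product over arcs $q\to p$ of $\Gamma$ starting at $q$ is $1$ if there are none. *)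

(* Defs.v *)
From mathcomp Require Import all_boot all_fingroup.
Set Implicit Arguments. Unset Strict Implicit. Unset Printing Implicit Defensive.

(* Darts (arcs) of K_{n,n}: the edge {black i, white j} with an orientation
   b; if b = true the dart starts at black vertex i, else at white vertex j. *)
Definition dart (n : nat) : finType := ('I_n * 'I_n * bool)%type.

(* initial vertex of a dart: (colour, index); colour true = black *)
Definition dtail n (d : dart n) : bool * 'I_n :=
  (d.2, if d.2 then d.1.1 else d.1.2).

Definition drev n (d : dart n) : dart n := (d.1, ~~ d.2).

(* An embedding of K_{n,n} in a closed orientable surface, given by its
   rotation system: a permutation R of the darts which maps each dart to a
   dart with the same initial vertex and which cyclically permutes the set
   of darts at each vertex (one cycle per vertex). *)
Definition is_embedding n (R : {perm dart n}) : bool :=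
  [forall d, dtail (R d) == dtail d] &&
  [forall d, forall d', (dtail d == dtail d') ==> (d' \in porbit R d)].

Definition map_iso n (g R R' : {perm dart n}) : bool :=
  [forall d, g (drev d) == drev (g d)] && [forall d, g (R d) == R' (g d)].

Definition isomorphic n (R R' : {perm dart n}) : bool :=
  [exists g, map_iso g R R'].

Definition is_regular n (R : {perm dart n}) : bool :=
  [forall d, forall d', [exists g, map_iso g R R && (g d == d')]].

Definition reg_embeddings n : {set {perm dart n}} :=
  [set R | is_embedding R && is_regular R].

Definition nu (n : nat) : nat :=
  #|[set [set R' in reg_embeddings n | isomorphic R R'] | R in reg_embeddings n]|.

Definition Pi_arc (n q p : nat) : bool :=
  [&& q \in primes n, p \in primes n & q %| p.-1].

(* a subgraph Gamma of Pi_n (on all its vertices) is given by its arc set,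
   a set of pairs (q, p) of numbers <= n *)
Definition short_spanning n (G : {set 'I_n.+1 * 'I_n.+1}) : bool :=
  [forall a in G, Pi_arc n a.1 a.2] &&
  [forall a in G, forall b in G, (val a.2 != val b.1)].

Definition nonterminal n (G : {set 'I_n.+1 * 'I_n.+1}) (q : nat) : bool :=
  [forall a in G, val a.2 != q].

Definition rqp (q p : nat) : nat := logn q p.-1.

(* Main.v *)
Require Import Defs.
From mathcomp Require Import all_boot all_fingroup.
From mathcomp Require Import all_algebra all_solvable all_field zify ring.
Set Implicit Arguments. Unset Strict Implicit. Unset Printing Implicit Defensive.

(* The orientation-preserving automorphisms of a regular embedding that preserve the colours form
   a group G = <x><y> with <x>, <y> cyclic of order n and of trivial intersection, and some
   automorphism of G exchanges x and y. By Itô's theorem G' is abelian; counting the conjugates of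
   [x, y] under <x> then shows that <x> contains a nontrivial normal subgroup of G, so that the
   Sylow p-subgroup S for the largest prime p is normal, with complement H = <x_p'><y_p'>. Since
   G' acts trivially on S / Phi(S), either H centralises S, or S <= G' is abelian and x_p', y_p'
   act on <y_p>, <x_p> by the same scalar. By induction G acts on the cosets of <y>, identified
   with Z/n, by z |-> a z + 1 (for x) and z |-> d z (for y); here d is any residue such that for
   every prime p | n, either d = 1 mod p or d^gcd(d - 1, n) = 1 mod p^e_p, and a is determined
   by d. So nu(n) is the number of such d. Grouping them by the primes p with d <> 1 mod p (the
   heads of the arcs of Gamma) and by the exponents f_q = v_q(gcd(d - 1, n)) gives the formula. *)

(** * Geometric sums modulo n *)

(** The condition on d couples the primes: at a terminal p, d^g = 1 modulo p^e_p, where g = gcd(d -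
    1, n) involves the other primes. On the group side this is why the induction also carries the
    fact that y^g lies in [<x>] G'. On the counting side all exponents f_q of g are prescribed
    first: g is then a constant, and the Chinese remainder theorem separates the primes. A
    non-terminal q contributes the phi(q^(e_q - f_q)) residues with v_q(d - 1) = f_q, capped at e_q.
    A terminal p contributes gcd(g, p - 1) - 1 residues: the g-th roots of unity modulo p^e_p,
    except 1. As gcd(g, p - 1) is the product of the factors 1 + (q^f_{q,p} - 1), subtracting 1
    leaves the sum over nonempty sets of arcs ending at p, and this produces Gamma. The assumption
    on n enters through 8 not dividing n: an isobicyclic 2-group with n_2 at most 4 is abelian or
    satisfies one explicit set of relations with n_2 = 4, and both give slope 1 at the prime 2. *)

(** This is the k-th iterate of z |-> a z + 1 at 0, so it turns the exponent of a power of [x] into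
    the label of the coset reached. *)
Definition geo (a k : nat) : nat := \sum_(i < k) a ^ i.

Lemma geo0 a : geo a 0 = 0. Proof. exact: big_ord0. Qed.

Lemma geoSr a k : geo a k.+1 = geo a k + a ^ k.
Proof. by rewrite /geo big_ord_recr. Qed.

Lemma geoS a k : geo a k.+1 = a * geo a k + 1.
Proof.
rewrite /geo big_ord_recl addnC big_distrr; congr (_ + _).
by apply: eq_bigr => i _; rewrite expnS.
Qed.

Lemma geo1 a : geo a 1 = 1. Proof. by rewrite geoS geo0 muln0. Qed.

Lemma geo_1n k : geo 1 k = k.
Proof. by elim: k => [|k IH]; rewrite ?geo0 // geoS IH mul1n addn1. Qed.

Lemma geoD a i j : geo a (i + j) = geo a i + a ^ i * geo a j.
Proof.
elim: j => [|j IH]; first by rewrite geo0 muln0 !addn0.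
by rewrite addnS !geoSr IH mulnDr expnD addnA.
Qed.

Lemma geoM a i j : geo a (i * j) = geo a i * geo (a ^ i) j.
Proof.
elim: j => [|j IH]; first by rewrite muln0 !geo0 muln0.
by rewrite mulnS addnC geoD IH geoSr mulnDr expnM [_ * geo a i]mulnC.
Qed.

Lemma modn_eqS N a b : a = b %[mod N] -> a.+1 = b.+1 %[mod N].
Proof. by move=> E; rewrite -[a.+1]addn1 -[b.+1]addn1 -(modnDml a) E modnDml. Qed.

Lemma modn_eqM N a b a' b' :
  a = b %[mod N] -> a' = b' %[mod N] -> a * a' = b * b' %[mod N].
Proof. by move=> E E'; rewrite -modnMml -modnMmr E E' modnMml modnMmr. Qed.

Lemma modn_eqD N a b a' b' :
  a = b %[mod N] -> a' = b' %[mod N] -> a + a' = b + b' %[mod N].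
Proof. by move=> E E'; rewrite -modnDml -modnDmr E E' modnDml modnDmr. Qed.

Lemma modn_eqX N a b k : a = b %[mod N] -> a ^ k = b ^ k %[mod N].
Proof. by move=> E; rewrite -modnXm E modnXm. Qed.

Lemma modn_dvd_eq N M a b : M %| N -> a = b %[mod N] -> a = b %[mod M].
Proof. by move=> MN E; rewrite -(modn_dvdm a MN) E modn_dvdm. Qed.

Lemma geo_mod N a b k : a = b %[mod N] -> geo a k = geo b k %[mod N].
Proof.
move=> E; elim: k => [|k IH]; first by rewrite !geo0.
rewrite !geoS; apply: modn_eqD => //; exact: modn_eqM.
Qed.

Lemma geo_mod1 N a k : a = 1 %[mod N] -> geo a k = k %[mod N].
Proof. by move=> /(geo_mod k) ->; rewrite geo_1n. Qed.

Lemma expn_geo a k : 0 < a -> a ^ k = (a - 1) * geo a k + 1.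
Proof.
move=> a0; have := predn_exp a k; rewrite -!subn1 => <-.
by rewrite subnK // expn_gt0 a0.
Qed.

Lemma eqn_modP N a b : reflect (exists u, a = b + u * N \/ b = a + u * N) (a == b %[mod N]).
Proof.
apply: (iffP eqP) => [E|[u [] ->]]; last 2 first.
- by rewrite addnC modnMDl.
- by rewrite addnC modnMDl.
case: (leqP a b) => [ab|/ltnW ab].
  have /dvdnP[u Eu]: N %| b - a by rewrite -eqn_mod_dvd //; apply/eqP.
  by exists u; right; rewrite -Eu subnKC.
have /dvdnP[u Eu]: N %| a - b by rewrite -eqn_mod_dvd //; apply/eqP.
by exists u; left; rewrite -Eu subnKC.
Qed.

Lemma mod1P N a : 0 < a -> a = 1 %[mod N] -> exists u, a = 1 + u * N.
Proof.
move=> a0 /eqP; rewrite eqn_mod_dvd // => /dvdnP[u E]; exists u.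
by rewrite -E subnKC.
Qed.

(** Modulo p^2, a = 1 + c p gives the sum k + c p C(k, 2), and p divides C(p, 2) because p is odd.
    For p = 2 and a = 3 the sum is 4; hence the separate treatment of 2. *)
Lemma geo_prime_mod2 p a : prime p -> odd p -> a = 1 %[mod p] ->
  exists2 u, geo a p = p * u & u = 1 %[mod p].
Proof.
move=> pr_p odd_p a1; have p0 := prime_gt0 pr_p; have p1 := prime_gt1 pr_p.
have a0: 0 < a by case: a a1 => // /esym/eqP; rewrite mod0n modn_small.
have [c Ea] := mod1P a0 a1.
have E k : geo a k = k + c * p * 'C(k, 2) %[mod p ^ 2].
  elim: k => [|k IH]; first by rewrite geo0 bin0n muln0.
  rewrite geoS; have -> : k.+1 + c * p * 'C(k.+1, 2) = (k + c * p * 'C(k, 2)) + c * p * k + 1.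
    by rewrite binS bin1; lia.
  apply: modn_eqD => //; rewrite -modnMmr IH modnMmr Ea.
  have ->: (1 + c * p) * (k + c * p * 'C(k, 2))
      = c * c * 'C(k, 2) * p ^ 2 + (k + c * p * 'C(k, 2) + c * p * k) by rewrite -mulnn; lia.
  by rewrite modnMDl.
have /eqP := E p; rewrite bin2odd // => /eqP Ep.
have /eqn_modP[u [Eu|Eu]]: geo a p == p %[mod p ^ 2].
- apply/eqP; rewrite Ep; set h := _./2.
  have ->: p + c * p * (p * h) = c * h * p ^ 2 + p by rewrite -mulnn; lia.
  by rewrite modnMDl.
- exists (1 + u * p); first by rewrite Eu -mulnn; lia.
  by rewrite addnC modnMDl.
have gp: 0 < geo a p by case: (p) p0 => // k _; rewrite geoS addn1.
have [w Ew]: exists w, geo a p = p * w.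
  have /dvdnP[w Ew]: p %| geo a p by rewrite /dvdn (geo_mod1 _ a1) modnn.
  by exists w; rewrite Ew mulnC.
exists w => //; have /eqP : p * 1 = p * (w + u * p) by move: Eu; rewrite Ew -mulnn; lia.
by rewrite eqn_pmul2l // => /eqP ->; rewrite addnC modnMDl.
Qed.

(** By [geoM], each further factor p of the length multiplies the sum by p times a unit that is 1
    mod p. *)
Lemma geo_pexp_mul p a e k : prime p -> odd p -> a = 1 %[mod p] ->
  exists2 u, geo a (k * p ^ e) = geo a k * (p ^ e * u) & u = 1 %[mod p].
Proof.
move=> pr_p odd_p a1; have ak1 m : a ^ m = 1 %[mod p] by rewrite (modn_eqX m a1) exp1n.
elim: e => [|e [u Eu u1]]; first by exists 1; rewrite ?expn0 ?muln1.
have [w Ew w1] := geo_prime_mod2 pr_p odd_p (ak1 (k * p ^ e)).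
exists (u * w); last by rewrite (modn_eqM u1 w1).
by rewrite expnSr mulnA geoM Eu Ew; lia.
Qed.

(** If p is odd and k = m p^v with m prime to p, the sum is p^v times [geo a m] = m mod p and a
    unit, so it has the p-adic valuation of k. If a = 1 mod p^e, the sum is k modulo p^e. *)
Lemma geo_pexp_dvd p a e k : prime p -> (odd p && (a == 1 %[mod p]) || (a == 1 %[mod p ^ e])) ->
  (p ^ e %| geo a k) = (p ^ e %| k).
Proof.
move=> pr_p /orP[/andP[odd_p /eqP a1]|/eqP a1]; last by rewrite /dvdn (geo_mod1 _ a1).
have [->|k0] := posnP k; first by rewrite geo0.
have [m co Ek] := pfactor_coprime pr_p k0.
have [u Eu u1] := geo_pexp_mul (logn p k) m pr_p odd_p a1.
have cou : coprime u p by rewrite -coprime_modl u1 coprime_modl coprime1n.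
have com : coprime (geo a m) p by rewrite -coprime_modl (geo_mod1 _ a1) coprime_modl coprime_sym.
rewrite {1}Ek Eu Gauss_dvdr ?coprimeXl // 1?coprime_sym //.
rewrite Gauss_dvdl ?coprimeXl // 1?coprime_sym //.
by rewrite {2}Ek Gauss_dvdr ?coprimeXl.
Qed.

(* [a] satisfies the Hull--Dobell condition for [n]: [z |-> a z + 1] is an [n]-cycle. *)
Definition full_period n a :=
  all (fun p => odd p && (a == 1 %[mod p]) || (a == 1 %[mod p ^ logn p n])) (primes n).

Lemma dvdn_primes n m : 0 < n ->
  (n %| m) = all (fun p => p ^ logn p n %| m) (primes n).
Proof.
move=> n0; apply/idP/allP => [nm p _|H]; first exact: dvdn_trans (pfactor_dvdnn p n) nm.
apply/(dvdn_partP _ n0) => p pn; rewrite p_part; apply: H; exact: pn.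
Qed.

Lemma geo_dvd n a k : 0 < n -> full_period n a -> (n %| geo a k) = (n %| k).
Proof.
move=> n0 /allP H; rewrite !dvdn_primes //; apply: eq_in_all => p pn.
apply: geo_pexp_dvd; last exact: H.
by move: pn; rewrite mem_primes => /andP[].
Qed.



Lemma full_period_coprime n a : 0 < n -> full_period n a -> coprime a n.
Proof.
move=> n0 /allP H; apply/negPn/negP => nco.
have g1: 1 < gcdn a n by rewrite ltn_neqAle eq_sym nco gcdn_gt0 n0 orbT.
have pr_p := pdiv_prime g1; set p := pdiv _ in pr_p.
have pg : p %| gcdn a n := pdiv_dvd _.
have pa : p %| a := dvdn_trans pg (dvdn_gcdl _ _).
have pn : p %| n := dvdn_trans pg (dvdn_gcdr _ _).
have a1: a = 1 %[mod p].
  have /H/orP[/andP[_ /eqP//]|/eqP] : p \in primes n by rewrite mem_primes pr_p n0.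
  by apply: modn_dvd_eq; rewrite dvdn_exp // logn_gt0 mem_primes pr_p n0.
by move: pa; rewrite /dvdn a1 modn_small // prime_gt1.
Qed.

(** The difference of the two sums is a^i times [geo a (j - i)], and a is a unit modulo n. *)
Lemma geo_eq n a i j : 0 < n -> full_period n a ->
  (geo a i == geo a j %[mod n]) = (i == j %[mod n]).
Proof.
move=> n0 fa; have co := full_period_coprime n0 fa.
wlog ij : i j / i <= j => [H|].
  by case: (leqP i j) => [/H//|/ltnW/H E]; rewrite eq_sym E eq_sym.
rewrite (eq_sym (geo a i %% n)) (eq_sym (i %% n)) !eqn_mod_dvd //; last first.
  by rewrite -(subnKC ij) geoD leq_addr.
rewrite -{1}(subnKC ij) geoD addKn Gauss_dvdr ?geo_dvd //.
by rewrite coprime_sym coprimeXl.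
Qed.

Lemma geo_surj n a z : 0 < n -> full_period n a ->
  exists2 k, k < n & geo a k = z %[mod n].
Proof.
case: n => // n n0 fa; pose f (i : 'I_n.+1) : 'I_n.+1 := inord (geo a i %% n.+1).
have injf : injective f.
  move=> i j /(congr1 val); rewrite /f /= !inordK ?ltn_pmod // => /eqP.
  by rewrite geo_eq // !modn_small // => /eqP/val_inj.
have [k Ek] : exists k, f k = inord (z %% n.+1).
  by have [g _ gK] := injF_bij injf; exists (g (inord (z %% n.+1))); rewrite gK.
exists k => //; move/(congr1 val): Ek; by rewrite /f /= !inordK ?ltn_pmod.
Qed.

Lemma geo_mod_exp n a i j : 0 < n -> full_period n a -> i = j %[mod n] ->
  geo a i = geo a j %[mod n].
Proof. by move=> n0 fa E; apply/eqP; rewrite geo_eq //; apply/eqP. Qed.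

Lemma full_period_pexp p e a : prime p -> 
  odd p && (a == 1 %[mod p]) || (a == 1 %[mod p ^ e]) -> full_period (p ^ e) a.
Proof.
move=> pr_p H; case: e H => [|e] H; first by [].
by rewrite /full_period primesX // primes_prime //= pfactorK // H.
Qed.

(** * Isobicyclic groups *)

Section IsobicyclicGroups.
Import GroupScope.

Lemma der1_sub_of_commg (gT : finGroupType) (G N : {group gT}) (x y : gT) :
  <[x]> * <[y]> = G -> N <| G -> [~ x, y] \in N -> G^`(1) \subset N.
Proof.
move=> defG /andP[sNG nNG] cN.
have [xG yG]: x \in G /\ y \in G.
  by rewrite -defG -{1}(mulg1 x) -{2}(mul1g y) !mem_mulg ?group1 ?cycle_id.
rewrite der1_min // -defG quotientMl ?cycle_subG ?(subsetP nNG) //.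
rewrite !quotient_cycle ?(subsetP nNG) // abelianM !cycle_abelian /=.
rewrite cycle_subG /= cent_cycle; apply/cent1P/commute_sym/commgP.
by rewrite -morphR ?(subsetP nNG) //=; apply/eqP/coset_id.
Qed.

(* Itô's theorem: conjugating [a, b] by a1 * b1 and by b1 * a1 gives the same result. *)
Lemma ito_der1 (gT : finGroupType) (A B G : {group gT}) :
  abelian A -> abelian B -> A * B = G -> abelian G^`(1).
Proof.
move=> abA abB defG.
have defG' : B * A = G by rewrite -defG; apply/esym/comm_group_setP; rewrite defG groupP.
have sAG: A \subset G by rewrite -defG mulG_subl.
have sBG: B \subset G by rewrite -defG mulG_subr.
have nG : [~: A, B] <| G.
  by have := commg_normal A B; rewrite comm_joingE ?defG // /commute defG defG'.
(* G' lies in the normal subgroup [A, B], since A and B commute modulo it. *)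
suff: abelian [~: A, B].
  apply: abelianS; rewrite der1_min ?normal_norm //.
  have nR := normal_norm nG.
  rewrite -defG quotientMl ?(subset_trans sAG) // abelianM !quotient_abelian //=.
  by rewrite quotient_cents2r // commGC.
rewrite abelian_gen; apply/centsP => _ /imset2P[a b aA bB ->] _ /imset2P[a1' b1' a1A b1B ->].
(* With inverses, [a1^-1, b1^-1] is (a1 b1)(b1 a1)^-1, a quotient of two elements that conjugate
   [a, b] alike. *)
have {a1A b1B} [a1 [b1 [-> -> a1A b1B]]]: exists a1 b1, [/\ a1' = a1^-1, b1' = b1^-1, a1 \in A & b1 \in B].
  by exists a1'^-1, b1'^-1; rewrite !invgK !groupV.
have cA u v : u \in A -> v \in A -> u ^ v = u.
  by move=> uA vA; apply/conjg_fixP/commgP; apply: (centsP abA).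
have cB u v : u \in B -> v \in B -> u ^ v = u.
  by move=> uA vA; apply/conjg_fixP/commgP; apply: (centsP abB).
(* Elements of A commute with a2, so [u, b^a1] = [u, b2] for u in A; likewise with A and B
   exchanged. *)
have [a2 b2 a2A b2B Eb]: imset2_spec mulg (mem A) (fun _ => mem B) (b ^ a1).
  by apply/imset2P; rewrite -[imset2 _ _ _]/(A * B) defG groupJ ?(subsetP sAG a1) ?(subsetP sBG b).
have [b3 a3 b3B a3A Ea]: imset2_spec mulg (mem B) (fun _ => mem A) (a ^ b1).
  by apply/imset2P; rewrite -[imset2 _ _ _]/(B * A) defG' groupJ ?(subsetP sAG a) ?(subsetP sBG b1).
have R1 u : u \in A -> [~ u, b ^ a1] = [~ u, b2].
  by move=> uA; rewrite Eb !commgEl conjgM (cA u).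
have R2 v : v \in B -> [~ a ^ b1, v] = [~ a3, v].
  move=> vB; rewrite Ea !commgEr conjgM (cB v^-1) ?groupV //.
have E1 : [~ a, b] ^ (a1 * b1) = [~ a3, b2].
  by rewrite conjgM conjRg (cA a) // R1 // conjRg (cB b2) // R2.
have E2 : [~ a, b] ^ (b1 * a1) = [~ a3, b2].
  by rewrite conjgM conjRg (cB b) // R2 // conjRg (cA a3) // R1.
apply/commgP/conjg_fixP.
have ->: [~ a1^-1, b1^-1] = (a1 * b1) * (b1 * a1)^-1.
  by rewrite commgEl /conjg !invgK invMg !mulgA.
by rewrite conjgM E1 -E2 conjgK.
Qed.

(** The swap is asked for as a morphism only; [isob_endo] shows that it is onto G and involutive. *)
Definition isobicyclic (gT : finGroupType) (G : {group gT}) (x y : gT) (n : nat) :=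
  [/\ <[x]> * <[y]> = G, #[x] = n, #[y] = n, <[x]> :&: <[y]> = 1
    & exists f : {morphism G >-> gT}, f x = y /\ f y = x].

Section Isobicyclic.
Variables (gT : finGroupType) (G : {group gT}) (x y : gT) (n : nat).
Hypothesis isoG : isobicyclic G x y n.

Lemma isob_mem : x \in G /\ y \in G.
Proof.
by case: isoG => <- *; rewrite -{1}(mulg1 x) -{2}(mul1g y) !mem_mulg ?group1 ?cycle_id.
Qed.

Lemma isob_mulC : <[y]> * <[x]> = G.
Proof.
case: isoG => defG *; rewrite -defG; apply/esym/comm_group_setP; rewrite defG.
exact: groupP.
Qed.

Lemma isob_card : #|G| = (n * n)%N.
Proof.
case: isoG => defG ox oy tixy _.
by have := mul_cardG <[x]> <[y]>; rewrite tixy cards1 muln1 defG -!orderE ox oy.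
Qed.

Lemma isob_n_gt0 : 0 < n.
Proof. by case: isoG => _ <- *; apply: order_gt0. Qed.

Lemma isob_der1_abelian : abelian G^`(1).
Proof.
case: isoG => defG *.
exact: (ito_der1 (cycle_abelian x) (cycle_abelian y) defG).
Qed.

Lemma isob_solvable : solvable G.
Proof.
rewrite (series_sol (der_normal 1 G)) (abelian_sol isob_der1_abelian) /=.
exact: abelian_sol (der_abelian 0 G).
Qed.

Lemma isob_swap : isobicyclic G y x n.
Proof.
have xyG := isob_mulC; case: isoG => defG ox oy tixy [f [fx fy]].
by split; rewrite ?(setIC <[y]>) //; exists f.
Qed.

Lemma isob_decomp g : g \in G -> exists i j, g = x ^+ i * y ^+ j.
Proof.
case: isoG => <- _ _ _ _ /mulsgP[_ _ /cycleP[i ->] /cycleP[j ->] ->].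
by exists i, j.
Qed.

Lemma isob_endo (f : {morphism G >-> gT}) : f x = y -> f y = x ->
  (f @* G = G) /\ {in G, involutive f}.
Proof.
have [xG yG] := isob_mem; case: isoG => defG _ _ _ _ fx fy.
split.
  suff: f @* (<[x]> * <[y]>) = G by rewrite defG.
  rewrite morphimMl ?cycle_subG //= !morphim_cycle // fx fy.
  exact: isob_mulC.
move=> g /isob_decomp[i [j ->]].
by rewrite !(morphM, morphX) ?groupM ?groupX ?fx ?fy //= fx.
Qed.

Lemma isob_normal_swap k : <[x ^+ k]> <| G -> <[y ^+ k]> <| G.
Proof.
have [xG yG] := isob_mem; case: isoG => _ _ _ _ [f [fx fy]] nK.
have [fG _] := isob_endo fx fy.
have := morphim_normal f nK; rewrite morphim_cycle ?groupX //= fG morphX //.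
by rewrite fx.
Qed.
End Isobicyclic.

(** A subgroup of prime order of the cyclic group K is characteristic in K, hence normal in G. *)
Lemma normal_prime_sub_cycle (gT : finGroupType) (G K : {group gT}) (x : gT) :
  K <| G -> K \subset <[x]> -> K :!=: 1 ->
  exists p, [/\ prime p, p %| #[x] & <[x ^+ (#[x] %/ p)]> <| G].
Proof.
move=> nK sK ntK; have cycK := cyclicS sK (cycle_cyclic x).
have pr_p : prime (pdiv #|K|) by rewrite pdiv_prime // cardG_gt1.
set p := pdiv #|K| in pr_p *.
have pK : p %| #|K| := pdiv_dvd _.
have px : p %| #[x] := dvdn_trans pK (cardSg sK).
exists p; split=> //; apply: char_normal_trans nK.
rewrite sub_cyclic_char // -(cardSg_cyclic (cycle_cyclic x)) ?cycleX //.
by rewrite -orderE orderXdiv ?dvdn_div // divnA // mulKn.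
Qed.

(** * A nontrivial normal subgroup inside a cyclic factor *)

Section Core.
Variables (gT : finGroupType) (G : {group gT}) (x y : gT) (n : nat).
Hypothesis isoG : isobicyclic G x y n.

Let abG' : abelian G^`(1) := isob_der1_abelian isoG.

(* G acts on its abelian derived group through the abelian group G / G^`(1). *)
Lemma cent1_der1_comm z : z \in G -> commute z [~ x, y] -> z \in 'C(G^`(1)).
Proof.
move=> zG czc; have [xG yG] := isob_mem isoG; case: isoG => defG _ _ _ _.
pose C := [group of 'C_(G^`(1))[z]].
have nG' : G \subset 'N(G^`(1)) := normal_norm (der_normal 1 G).
have nC : C <| G.
  rewrite /normal subIset ?der_sub //=; apply/subsetP=> g gG.
  rewrite inE; apply/subsetP=> _ /imsetP[u /setIP[uG' /cent1P czu] ->].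
  rewrite inE memJ_norm ?(subsetP nG') // uG' /=.
  apply/cent1P; rewrite /commute -[z](conjgKV g) -!conjMg; congr (_ ^ g).
  have -> : z ^ g^-1 = z * [~ z, g^-1] by rewrite commgEl mulKVg.
  have cu: commute u [~ z, g^-1].
    by apply: (centsP abG') uG' _ _; rewrite mem_commg ?groupV.
  by apply: commuteM.
have: G^`(1) \subset C.
  apply: der1_sub_of_commg defG nC _; rewrite inE mem_commg //=.
  exact/cent1P.
move/subsetP=> sG'C; apply/centP => u /sG'C /setIP[_ /cent1P]; exact.
Qed.

(* Otherwise [x, y] has n distinct nontrivial conjugates under <x>, all in the derived group,
   whose order is at most n because it meets <x> trivially. *)
Lemma isob_core_nontrivial : 1 < n ->
  exists p, [/\ prime p, p %| n & <[x ^+ (n %/ p)]> <| G].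
Proof.
move=> n_gt1; have [xG yG] := isob_mem isoG.
have cG := isob_card isoG.
have [defG ox oy tixy [f [fx fy]]] := isoG.
have [fG ff] := isob_endo isoG fx fy.
have sXG : <[x]> \subset G by rewrite cycle_subG.
have [ab|nab] := boolP (abelian G).
  have := @normal_prime_sub_cycle _ G <[x]>%G x _ (subxx _).
  rewrite ox; apply; last by rewrite -cardG_gt1 -orderE ox.
  by rewrite /normal sXG sub_abelian_norm.
have [triv|nt] := eqVneq (gcore <[x]> G) 1; last first.
  have := @normal_prime_sub_cycle _ G (gcore_group <[x]> G) x _ (gcore_sub _ _) nt.
  by rewrite ox; apply; apply: gcore_normal.
have coreX (K : {group gT}) : K <| G -> K \subset <[x]> -> K :=: 1.
  move=> nK sK; apply/trivgP; rewrite -triv; apply: gcore_max sK _; exact: normal_norm nK.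
(* If x^i y^j centralises x, so does y^j; then [<y^j>] is normal in G, by the swap so is [<x^j>],
   which is therefore trivial. *)
have CX : 'C_G(<[x]>) \subset <[x]>.
  apply/subsetP=> g /setIP[/(isob_decomp isoG)[i [j ->]] cg].
  suff: y ^+ j = 1 by move=> ->; rewrite mulg1 mem_cycle.
  have cyj : y ^+ j \in 'C(<[x]>).
    by move: cg; rewrite groupMl // (subsetP (cycle_abelian x)) ?mem_cycle.
  have nyj : <[y ^+ j]> <| G.
    rewrite /normal cycle_subG groupX //= -defG mul_subG //.
      by rewrite cents_norm // centsC cycle_subG.
    by rewrite cents_norm // centsC cycle_subG (subsetP (cycle_abelian y)) ?mem_cycle.
  have := isob_normal_swap (isob_swap isoG) nyj.
  move/(coreX <[x ^+ j]>%G) => /(_ (cycleX _ _)) /= x1.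
  have: f (x ^+ j) = f 1 by congr (f _); apply/eqP; rewrite -cycle_eq1 x1.
  by rewrite morph1 morphX // fx.
have nXG' : G^`(1) <*> <[x]> <| G.
  by rewrite sub_der1_normal ?joing_subl // join_subG der_sub.
(* This centre is normal in G and lies in C_G(x), hence in [<x>], whose core is trivial. *)
have ZX : 'Z(G^`(1) <*> <[x]>) = 1.
  apply: (coreX [group of 'Z(G^`(1) <*> <[x]>)]).
    exact: char_normal_trans (center_char _) nXG'.
  apply: subset_trans CX; apply/subsetP => u /setIP[uN cu].
  by rewrite inE (subsetP (normal_sub nXG')) //= (subsetP (centS _) u cu) // joing_subr.
have CXG' z : z \in <[x]> -> z \in 'C(G^`(1)) -> z = 1.
  move=> zX zC; apply/set1gP; rewrite -ZX inE mem_gen ?inE ?zX ?orbT //=.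
  by rewrite /= centY inE zC (subsetP (cycle_abelian x)).
have tiXG' : G^`(1) :&: <[x]> = 1.
  apply/trivgP/subsetP=> z /setIP[zG' zX]; apply/set1P/(CXG' _ zX).
  exact: (subsetP abG').
have le1 : #|G^`(1)| <= n.
  have := mul_cardG G^`(1) <[x]>; rewrite tiXG' cards1 muln1 -orderE ox => E.
  rewrite -(leq_pmul2r (isob_n_gt0 isoG)) E -cG subset_leq_card //.
  by rewrite mul_subG ?der_sub.
set c := [~ x, y].
have cG' : c \in G^`(1) by rewrite mem_commg.
have c1 : c != 1.
  apply: contra nab => c1; rewrite -defG abelianM !cycle_abelian cents_cycle //.
  by apply/commute_sym/commgP.
(* If c^z1 = c^z2, then z1 z2^-1 centralises c, hence all of G'; being in [<x>], it belongs to the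
   trivial centre above. *)
have injc : {in <[x]> &, injective (fun z => c ^ z)}.
  move=> z1 z2 z1X z2X E; apply/eqP; rewrite eq_mulgV1; apply/eqP/CXG'.
    by rewrite groupM ?groupV.
  apply: cent1_der1_comm; first by rewrite (subsetP sXG) ?groupM ?groupV.
  by apply/commute_sym/commgP/conjg_fixP; rewrite conjgM E conjgK.
have: #|[set c ^ z | z in <[x]>]| <= #|G^`(1) :\ 1|.
  apply: subset_leq_card; apply/subsetP=> _ /imsetP[z zX ->].
  rewrite !inE conjg_eq1 c1 /= memJ_norm //.
  by rewrite (subsetP (normal_norm (der_normal 1 G))) // (subsetP sXG).
rewrite card_in_imset // -orderE ox => le2.
by move: le1; rewrite (cardsD1 1) group1 add1n leqNgt ltnS le2.
Qed.
End Core.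

(** * Isobicyclic quotients *)

Section Quotient.
Variables (gT : finGroupType) (G : {group gT}) (x y : gT) (n k : nat).
Hypotheses (isoG : isobicyclic G x y n) (kn : k %| n) (nP : <[x ^+ k]> <| G).

(** Joining the mirror image [<y^k>] makes the subgroup stable under the swap, so that the quotient
    is isobicyclic again. *)
Definition isob_ker : {group gT} := [group of <[x ^+ k]> <*> <[y ^+ k]>].

Let nP' : <[y ^+ k]> <| G := isob_normal_swap isoG nP.

Lemma isob_ker_normal : isob_ker <| G.
Proof. exact: normalY. Qed.

Lemma isob_kerE : isob_ker = <[x ^+ k]> * <[y ^+ k]> :> {set gT}.
Proof.
rewrite /= norm_joinEl // (subset_trans _ (normal_norm nP')) //.
exact: normal_sub.
Qed.

Lemma isob_ker_cent : <[y ^+ k]> \subset 'C(<[x ^+ k]>).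
Proof.
case: isoG => _ _ _ tixy _.
apply/commG1P/trivgP; rewrite -tixy subsetI; apply/andP; split.
  apply: subset_trans (cycleX x k); rewrite commg_subr.
  exact: subset_trans (normal_sub nP') (normal_norm nP).
apply: subset_trans (cycleX y k); rewrite commg_subl.
exact: subset_trans (normal_sub nP) (normal_norm nP').
Qed.

Lemma isob_quotient :
  isobicyclic (G / isob_ker)%G (coset isob_ker x) (coset isob_ker y) k.
Proof.
have [xG yG] := isob_mem isoG; have cG := isob_card isoG.
have n_gt0 := isob_n_gt0 isoG; have k_gt0 := dvdn_gt0 n_gt0 kn.
have [defG ox oy tixy [f [fx fy]]] := isoG.
have [fG ff] := isob_endo isoG fx fy.
have nZ := isob_ker_normal; have nZG := normal_norm nZ.
have xN : x \in 'N(isob_ker) by apply: (subsetP nZG).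
have yN : y \in 'N(isob_ker) by apply: (subsetP nZG).
have defQ : <[coset isob_ker x]> * <[coset isob_ker y]> = (G / isob_ker)%G.
  by rewrite -!quotient_cycle // -quotientMl ?cycle_subG // defG.
(* By the modular law [<u>] meets the kernel in [<u^k>], because [<v^k>] meets [<u>] trivially. *)
have ord u v : #[u] = n -> #[v] = n -> <[u]> :&: <[v]> = 1 ->
    isob_ker = <[u ^+ k]> * <[v ^+ k]> :> {set gT} -> u \in G -> #[coset isob_ker u] = k.
  move=> ou ov tiuv EZ uG; have uN : u \in 'N(isob_ker) by apply: (subsetP nZG).
  rewrite orderE -quotient_cycle // card_quotient ?cycle_subG // -indexgI.
  rewrite EZ setIC -group_modl ?cycleX //.
  have ->: <[v ^+ k]> :&: <[u]> = 1.
    by apply/trivgP; rewrite -tiuv (setIC <[u]>) setSI // cycleX.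
  by rewrite mulg1 -divgS ?cycleX // -!orderE orderXdiv ?ou // divnA // mulKn.
have EZ := isob_kerE.
have EZ' : isob_ker = <[y ^+ k]> * <[x ^+ k]> :> {set gT}.
  by rewrite EZ; apply/normC/cents_norm; rewrite centsC isob_ker_cent.
have oQx := ord x y ox oy tixy EZ xG.
have oQy := ord y x oy ox (etrans (setIC _ _) tixy) EZ' yG.
split=> //.
  (* The kernel has order (n / k)^2, so the quotient has order k^2, the product of the orders of its
     two cyclic factors. *)
  have := mul_cardG <[coset isob_ker x]> <[coset isob_ker y]>.
  rewrite -!orderE oQx oQy defQ /= card_quotient // -divgS ?normal_sub // cG.
  have cZ : #|isob_ker| = ((n %/ k) * (n %/ k))%N.
    rewrite EZ; have := mul_cardG <[x ^+ k]> <[y ^+ k]>.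
    have -> : <[x ^+ k]> :&: <[y ^+ k]> = 1.
      by apply/trivgP; rewrite -tixy setISS // cycleX.
    by rewrite cards1 muln1 -!orderE !orderXdiv ?ox ?oy.
  rewrite cZ -{1 2}(divnK kn) -mulnA (mulnCA k) mulnA mulKn; last first.
    by rewrite muln_gt0 divn_gt0 // dvdn_leq.
  rewrite -{1}[(k * k)%N]muln1 => /eqP; rewrite eqn_pmul2l ?muln_gt0 ?k_gt0 //.
  by move=> /eqP c1; apply/eqP; rewrite trivg_card1 /= -c1.
have fZ : f @* isob_ker = isob_ker.
  rewrite {1}EZ morphimMl ?cycle_subG ?groupX //= !morphim_cycle ?groupX //.
  by rewrite !morphX // fx fy -EZ'.
have sGf : G \subset f @*^-1 'N(isob_ker).
  apply/subsetP=> g gG; rewrite inE gG inE (subsetP nZG) //.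
  by have: f g \in f @* G by [apply: mem_morphim]; rewrite fG.
(* The swap descends to the quotient because it maps the kernel onto itself. *)
pose g := restrm sGf (coset_morphism isob_ker \o f).
have sK : 'ker (restrm nZG (coset_morphism isob_ker)) \subset 'ker g.
  apply/subsetP=> z; rewrite !ker_restrm => /setIP[zG zK].
  rewrite inE zG /= ker_comp inE zG inE ker_coset /=.
  rewrite ker_coset in zK.
  by have: f z \in f @* isob_ker by [apply: mem_morphim]; rewrite fZ.
have [h hE]: exists h : {morphism (G / isob_ker)%G >-> coset_of isob_ker},
    forall z, z \in G -> h (coset isob_ker z) = coset isob_ker (f z).
  pose q := restrm nZG (coset_morphism isob_ker).
  have qG : q @* G = G / isob_ker by rewrite morphim_restrm setIid.
  have sD : G / isob_ker \subset q @* G by rewrite qG.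
  exists (restrm_morphism sD (factm_morphism sK (subxx G))) => z zG.
  exact: (factmE sK (subxx G) zG).
by exists h; rewrite !hE // fx fy.
Qed.
End Quotient.

(** * Normality of the Sylow subgroup for the largest prime *)

(** The automorphism group of [<u>] has order r - 1 < p, so the p-group S has trivial image in
    it. *)
Lemma pgroup_cent_prime_cycle (gT : finGroupType) (p r : nat) (S : {group gT}) (u : gT) :
  prime p -> p.-group S -> S \subset 'N(<[u]>) -> prime r -> #[u] = r -> r <= p ->
  S \subset 'C(<[u]>).
Proof.
move=> pr_p pS nS pr_r ou rp; rewrite -ker_conj_aut -sub_morphim_pre //.
have: coprime #|conj_aut <[u]> @* S| #|Aut <[u]>|.
  apply: (@pnat_coprime p); first exact: morphim_pgroup.
  rewrite card_Aut_cycle ou totient_prime // /pnat -subn1 subn_gt0 prime_gt1 //=.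
  apply/allP=> q; rewrite mem_primes => /and3P[_ r1 /dvdn_leq]; rewrite r1 => /(_ isT) le.
  rewrite !inE; apply: contraTneq le => ->; rewrite -ltnNge.
  by apply: leq_trans rp; rewrite subn1 prednK ?prime_gt0.
move=> co; apply/trivgP/card1_trivg/eqP; rewrite -dvdn1.
have : #|conj_aut <[u]> @* S| %| gcdn #|conj_aut <[u]> @* S| #|Aut <[u]>|.
  by rewrite dvdn_gcd dvdnn cardSg // Aut_conj_aut.
by rewrite (eqP co).
Qed.

(** Induction through the quotient by Z = [<x^(n/r)>] [<y^(n/r)>], an r-group. If r = p, then Z lies
    in O_p(G). Otherwise r < p by maximality of p, so a Sylow p-subgroup S centralises Z; it is then
    characteristic in Z S, which is normal because its image in G / Z is. *)
Lemma isob_Sylow_normal n : forall (gT : finGroupType) (G : {group gT}) x y p,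
  isobicyclic G x y n -> prime p -> (forall r, prime r -> r %| n -> r <= p) ->
  p.-Sylow(G) 'O_p(G).
Proof.
have [N] := ubnP n; elim: N n => // N IH n /ltnSE le_n gT G x y p isoG pr_p maxp.
have [n1|n1] := leqP n 1.
  have /card1_trivg G1 : #|G| = 1%N.
    by rewrite (isob_card isoG); have := isob_n_gt0 isoG; case: n n1 {maxp le_n isoG}; last case.
  have O1 : 'O_p(G) = 1 by apply/trivgP/(subset_trans (pcore_sub _ _)); rewrite G1.
  by rewrite O1 G1 pHallE subxx !cards1 part_pnat_id.
have [r [pr_r rn nP]] := isob_core_nontrivial isoG n1.
have n_gt0 := isob_n_gt0 isoG.
have kn : n %/ r %| n by rewrite dvdn_div.
have isoQ := isob_quotient isoG kn nP.
have nZ := isob_ker_normal isoG nP; have EZ := isob_kerE isoG nP.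
set Z := isob_ker x y (n %/ r) in isoQ nZ EZ.
have oxk (u : gT) : #[u] = n -> #[u ^+ (n %/ r)] = r.
  by move=> ou; rewrite orderXdiv ou // divnA // mulKn.
have [_ ox oy _ _] := isoG; have {}oxk := (oxk x ox, oxk y oy).
have rZ : r.-group Z.
  by rewrite EZ pgroupM /pgroup -!orderE !oxk pnat_id.
have sylQ : p.-Sylow(G / Z) 'O_p(G / Z).
  apply: (IH (n %/ r) _ _ _ (coset Z x) (coset Z y)) => //.
    by apply: leq_trans le_n; rewrite ltn_Pdiv // prime_gt1.
  by move=> q pr_q qn; apply: maxp => //; apply: dvdn_trans qn kn.
have [Er|ne_rp] := eqVneq r p.
  rewrite Er in rZ; have sZO: Z \subset 'O_p(G) by rewrite pcore_max.
  have nZO: Z <| 'O_p(G) := normalS sZO (pcore_sub _ _) nZ.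
  by rewrite pquotient_pcore // pquotient_pHall in sylQ.
have [S sylS] := Sylow_exists p G.
have [sSG pS _] := and3P sylS.
have nZS := subset_trans sSG (normal_norm nZ).
have ESQ : S / Z = 'O_p(G / Z) by apply: (eq_Hall_pcore sylQ); apply: quotient_pHall.
have nZSG : Z * S <| G.
  rewrite -quotientK // -[gval G](quotientGK nZ) cosetpre_normal ESQ.
  exact: pcore_normal.
have rp : r <= p by apply: maxp.
have cSP u : #[u] = r -> <[u]> <| G -> S \subset 'C(<[u]>).
  move=> ou nu; apply: (pgroup_cent_prime_cycle pr_p pS _ pr_r ou rp).
  exact: subset_trans sSG (normal_norm nu).
have cSZ : S \subset 'C(Z).
  rewrite EZ centM subsetI !cSP ?oxk //.
  exact (isob_normal_swap isoG nP).
rewrite -norm_joinEr // in nZSG.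
have nSZS : S <| Z <*> S.
  by rewrite /normal joing_subr join_subG normG cents_norm // centsC.
have sylS' : p.-Sylow(Z <*> S) S by apply: pHall_subl sylS; rewrite ?joing_subr ?normal_sub.
have nSG : S <| G.
  apply: char_normal_trans nZSG.
  by rewrite /= -{1}(normal_Hall_pcore sylS' nSZS) pcore_char.
by rewrite (normal_Hall_pcore sylS nSG).
Qed.

(** * Isobicyclic p-groups *)

Lemma pgroup_normal_prime_central (gT : finGroupType) (p : nat) (S : {group gT}) (u : gT) :
  prime p -> p.-group S -> <[u]> <| S -> #[u] = p -> u \in 'Z(S).
Proof.
move=> pr_p pS nu ou; rewrite inE -cycle_subG (normal_sub nu) -cycle_subG centsC.
exact (pgroup_cent_prime_cycle pr_p pS (normal_norm nu) pr_p ou (leqnn p)).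
Qed.

(* If h^y = h^m z with z central of order dividing p then (y h)^k picks up z^(k choose 2). *)
Lemma expg_mul_twisted (gT : finGroupType) (p m k : nat) (y h z : gT) :
  m = 1 %[mod p] -> z ^+ p = 1 -> commute z y -> commute z h -> h ^ y = h ^+ m * z ->
  (y * h) ^+ k = y ^+ k * h ^+ geo m k * z ^+ 'C(k, 2).
Proof.
move=> m1 zp czy czh hy; elim: k => [|k IH]; first by rewrite geo0 !mulg1.
have zk : z ^+ geo m k = z ^+ k by rewrite -(expg_mod _ zp) (geo_mod1 _ m1) expg_mod.
have czX u i : commute z u -> commute (z ^+ i) u by move=> c; apply/commute_sym/commuteX/commute_sym.
rewrite expgSr IH -!mulgA (czX _ _ (commuteM czy czh)).
rewrite (mulgA (h ^+ _)) (mulgA (h ^+ _)) (conjgC (h ^+ _)) conjXg hy.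
have cmz : commute (h ^+ m) z by apply/commute_sym/commuteX.
rewrite expgMn // zk -expgM !mulgA -expgSr -!mulgA; congr (_ * _).
rewrite geoS expgD expg1 binS bin1 addnC expgD !mulgA; congr (_ * _).
by rewrite -!mulgA czX.
Qed.

(* Modulo Z = <x^N><y^N> with N = p^(e-1), induction gives h^x = h^m z with z in Z. The swap inverts
   both h and z, so z is a power of y^-N x^N, which is itself a power of h^N. *)
Lemma isob_odd_pgroup e : forall (gT : finGroupType) (S : {group gT}) (x y : gT) (p : nat),
  isobicyclic S x y (p ^ e) -> prime p -> odd p ->
  exists m, [/\ m = 1 %[mod p], #[y^-1 * x] = (p ^ e)%N
             & (y^-1 * x) ^ x = (y^-1 * x) ^+ m].
Proof.
elim: e => [|e IH] gT S x y p isoS pr_p odd_p.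
  have [_ /eqP + /eqP + _ _] := isoS; rewrite !order_eq1 => /eqP -> /eqP ->.
  by exists 1%N; rewrite invg1 mul1g order1 conj1g expg1.
have [xS yS] := isob_mem isoS; have [defS ox oy tixy [f [fx fy]]] := isoS.
have [fG ff] := isob_endo isoS fx fy.
have p1 := prime_gt1 pr_p; have p0 := ltnW p1.
have pS : p.-group S by rewrite /pgroup (isob_card isoS) pnatM pnatX pnat_id.
set N := (p ^ e)%N.
have nP : <[x ^+ N]> <| S.
  have pe1 : 1 < p ^ e.+1 by rewrite -(expn0 p) ltn_exp2l.
  have [r [pr_r rn]] := isob_core_nontrivial isoS pe1.
  move: rn; rewrite Euclid_dvdX // => /andP[]; rewrite dvdn_prime2 // => /eqP -> _.
  by rewrite expnSr mulnK.
have oN (u : gT) : #[u] = (p ^ e.+1)%N -> #[u ^+ N] = p.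
  by move=> ou; rewrite orderXdiv ou ?dvdn_exp2l // expnS mulnK // expn_gt0 p0.
have [oxN oyN] := (oN x ox, oN y oy).
have zx : x ^+ N \in 'Z(S) := pgroup_normal_prime_central pr_p pS nP oxN.
have zy : y ^+ N \in 'Z(S).
  exact: (pgroup_normal_prime_central pr_p pS (isob_normal_swap isoS nP) oyN).
have cZ u v : u \in 'Z(S) -> v \in S -> commute u v by move=> /setIP[_ /centP]; apply.
have kn : N %| p ^ e.+1 by rewrite dvdn_exp2l.
have isoQ := isob_quotient isoS kn nP.
have nZ := isob_ker_normal isoS nP; have EZ := isob_kerE isoS nP.
set Z := isob_ker x y N in isoQ nZ EZ.
have ZZ : Z \subset 'Z(S) by rewrite EZ mul_subG // cycle_subG.
have Zdec z : z \in Z -> exists i j, z = x ^+ N ^+ i * y ^+ N ^+ j.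
  by rewrite -[z \in Z]/(z \in gval Z) EZ => /mulsgP[_ _ /cycleP[i ->] /cycleP[j ->] ->]; exists i, j.
have xNp : x ^+ N ^+ p = 1 by rewrite -oxN expg_order.
have yNp : y ^+ N ^+ p = 1 by rewrite -oyN expg_order.
have Zp z : z \in Z -> z ^+ p = 1.
  case/Zdec=> i [j ->]; rewrite expgMn; last by apply/commuteX2/cZ => //; apply: groupX.
  by rewrite (expgAC (x ^+ N)) (expgAC (y ^+ N)) xNp yNp !expg1n mulg1.
set h := y^-1 * x; have hS : h \in S by rewrite groupM ?groupV.
have xE : x = y * h by rewrite mulKVg.
have [m [m1 oh hm]] := IH _ _ _ _ _ isoQ pr_p odd_p.
have nZS := subsetP (normal_norm nZ).
have Eh : (coset Z y)^-1 * coset Z x = coset Z h by rewrite morphM ?groupV ?morphV ?nZS.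
rewrite Eh in oh hm.
have h1 k : x ^+ k != 1 -> y ^+ k != x ^+ k.
  move=> ne1; apply: contraNneq ne1 => E; apply/eqP/set1gP; rewrite -tixy inE mem_cycle.
  by rewrite -E mem_cycle.
have xN1 : x ^+ N != 1 by rewrite -order_gt1 oxN.
(* When n = p, the elements x and y are themselves central, and m = 1. *)
have [e0|e0] := posnP e.
  exists 1%N; have [xZ yZ] : x \in 'Z(S) /\ y \in 'Z(S).
    by move: zx zy; rewrite /N e0 expg1.
  split=> //; last by rewrite expg1; apply/conjg_fixP/commgP/commute_sym/cZ.
  rewrite e0 expn1; apply: nt_prime_order => //.
    apply: Zp; rewrite -[_ \in Z]/(_ \in gval Z) EZ.
    rewrite /N e0 expn0 !expg1 /h -(cZ x _ xZ (groupVr yS)).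
    by rewrite mem_mulg ?groupV ?cycle_id.
  apply: contra (h1 1%N _); last by move: xN1; rewrite /N e0.
  by rewrite /h -eq_invg_mul invgK !expg1 eq_sym.
pose z := h ^- m * h ^ x.
have zZ : z \in Z.
  have hN : h \in 'N(Z) by apply: nZS.
  have xN : x \in 'N(Z) by apply: nZS.
  apply: coset_idr; first by rewrite groupM ?groupV ?groupX ?groupJ.
  by rewrite morphM ?groupV ?groupX ?groupJ // morphV ?groupX // morphX // morphJ // hm mulVg.
have hxE : h ^ x = h ^+ m * z by rewrite /z mulKVg.
have zS := subsetP (center_sub S) z (subsetP ZZ z zZ).
have cz u : u \in S -> commute z u by apply: cZ; apply: (subsetP ZZ).
(* Since x = y h and h commutes with h^m z, the elements x and y conjugate h alike. *)
have hyE : h ^ y = h ^+ m * z.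
  apply: (@conjg_inj _ h); rewrite -conjgM -xE hxE; apply/esym/conjg_fixP/commgP.
  by apply/commute_sym/commuteM; [apply: commuteX | apply/commute_sym/cz].
have fh : f h = h^-1 by rewrite morphM ?groupV // morphV // fx fy /h invMg invgK.
have h1' : y ^- N * x ^+ N != 1 by rewrite -eq_invg_mul invgK h1.
clearbody h z; clear Eh.
have fz : f z = z^-1.
  have := congr1 f hyE.
  rewrite morphJ // morphM ?groupX // morphX // fh fy conjVg hxE invMg expgVn.
  have c : commute z^-1 (h ^- m) by apply/commuteV/commuteX/commute_sym/commuteV/commute_sym/cz.
  by rewrite c => /mulgI.
pose t := y ^- N * x ^+ N.
have cxy i j : commute (x ^+ N ^+ i) (y ^+ N ^+ j).
  by apply: cZ; rewrite groupX // groupX.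
(* With z = x^(N i) y^(N j), the relation z f(z) = 1 reads (x^N y^N)^(i + j) = 1. As the cyclic
   factors meet trivially, y^(N (i + j)) = 1, and j may be replaced by -i. *)
have [i zt] : exists i, z = t ^+ i.
  have [i [j Ez]] := Zdec z zZ; exists i.
  have xyij : (x ^+ N * y ^+ N) ^+ (i + j) = 1.
    have: z * f z = 1 by rewrite fz mulgV.
    rewrite {1 2}Ez morphM ?groupX // !morphX ?groupX // fx fy => <-.
    have c := cxy 1%N 1%N; rewrite !expg1 in c.
    rewrite expgMn // (expgD (x ^+ N)) -!mulgA; congr (_ * _).
    by rewrite (cxy j (i + j)%N) mulgA -expgD addnC.
  have yij : y ^+ N ^+ (i + j) = 1.
    apply/set1gP; rewrite -tixy inE andbC -expgM mem_cycle /=.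
    move: xyij; rewrite expgMn; last by have := cxy 1%N 1%N; rewrite !expg1.
    by move/(canRL (mulKg _)); rewrite mulg1 -!expgM => ->; rewrite groupV mem_cycle.
  rewrite /t expgMn; last by apply/commute_sym/commuteV; have := cxy 1%N 1%N; rewrite !expg1.
  rewrite expgVn Ez -(commuteV (cxy i i)).
  congr (_ * _); apply: (mulIg (y ^+ N ^+ i)); rewrite mulVg -expgD addnC //.
(* N is odd and divisible by p, so p divides C(N, 2). *)
have binp : z ^+ 'C(N, 2) = 1.
  have oN2 : odd N by rewrite oddX odd_p orbT.
  rewrite bin2odd // /N -(prednK e0) expnS -mulnA expgM.
  by rewrite Zp ?expg1n.
have [u Eu _] := geo_pexp_mul e 1 pr_p odd_p m1; rewrite geo1 !mul1n -/N in Eu.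
have tE : t = h ^+ (N * u).
  rewrite /t xE (expg_mul_twisted N m1 (Zp z zZ) (cz y yS) (cz h hS) hyE).
  by rewrite binp mulg1 Eu mulKg.
have tp : t ^+ p = 1.
  rewrite /t expgMn; last by apply/commute_sym/commuteV; have := cxy 1%N 1%N; rewrite !expg1.
  by rewrite expgVn yNp xNp invg1 mulg1.
(* z = t^i = h^(N u i) is absorbed in the exponent, which stays 1 mod p because p divides N. *)
exists (m + N * u * i)%N; split.
- by rewrite /N -(prednK e0) expnS -!mulnA addnC [(p * _)%N]mulnC modnMDl.
(* h has order N modulo Z; its power h^N lies in Z and is not 1, since otherwise t = h^(N u) would
   be 1. *)
- rewrite expnSr; apply: orderXpfactor => //.
  apply: nt_prime_order => //.
    apply: Zp; have hN : h \in 'N(Z) by apply: nZS.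
    apply: coset_idr; rewrite ?groupX // morphX //; apply/eqP.
    by rewrite -order_dvdn oh.
  by apply: contraNneq h1' => E; rewrite -/t tE expgM E expg1n.
by rewrite hxE expgD zt tE -expgM.
Qed.

(* With N = p^e_p: the first alternative says that p is a non-terminal vertex, the second that
   p is terminal (or p = 2, where the two kinds of vertices need no distinction). *)
Definition affine_at (p N g a d : nat) : bool :=
  [|| [&& odd p, d == 1 %[mod p] & a == d %[mod N]]
    | [&& (p == 2) || (d != 1 %[mod p]), a == 1 %[mod N] & d ^ g == 1 %[mod N]]]%N.

Definition affine_data (n a d : nat) : bool :=
  all (fun p => affine_at p (p ^ logn p n) (gcdn (d - 1) n) a d) (primes n).

(** Label the coset [<y>] x^i by [geo a i]. Right multiplication by x then sends z to a z + 1; the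
    condition says that y sends z to d z. *)
Definition affine_action (gT : finGroupType) (x y : gT) (n a d : nat) :=
  forall i, exists j i', x ^+ i * y = y ^+ j * x ^+ i'
                      /\ geo a i' = (d * geo a i)%N %[mod n].

Lemma affine_data_full_period n a d : affine_data n a d -> full_period n a.
Proof.
move=> /allP H; apply/allP => p pn; case/orP: (H p pn) => [/and3P[-> /eqP d1 /eqP ad]|].
  rewrite (@modn_dvd_eq _ p _ _ _ ad) ?d1 ?eqxx // dvdn_exp //.
  by rewrite logn_gt0.
by case/and3P=> _ -> _; rewrite orbT.
Qed.

Lemma affine_data_pexp p e a d : prime p ->
  affine_at p (p ^ e) (gcdn (d - 1) (p ^ e)) a d -> affine_data (p ^ e) a d.
Proof.
move=> pr_p H; case: e H => [|e] H; first by [].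
by rewrite /affine_data primesX // primes_prime //= pfactorK // H.
Qed.

(** Replacing g by a multiple preserves d^g = 1, so a local solution survives the passage from gcd(d
    - 1, n_p) to gcd(d - 1, n). *)
Lemma affine_at_mono p N M g g' a a' d d' : p %| N -> M %| N -> p %| M -> g %| g' ->
  a = a' %[mod N] -> d = d' %[mod N] -> affine_at p N g a d -> affine_at p M g' a' d'.
Proof.
move=> pN MN pM /dvdnP[k ->] /(modn_dvd_eq MN) Ea Ed.
have Edp := modn_dvd_eq pN Ed; have {}Ed := modn_dvd_eq MN Ed.
rewrite /affine_at Edp => /orP[/and3P[-> -> /eqP /(modn_dvd_eq MN) ad]|/and3P[-> /eqP a1 /eqP dg]].
  by rewrite -Ea -Ed ad eqxx.
rewrite -Ea (modn_dvd_eq MN a1) -(modn_eqX _ Ed) mulnC expnM (modn_eqX k (modn_dvd_eq MN dg)).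
by rewrite exp1n !eqxx orbT.
Qed.

Lemma gcdn_mul_coprime m n1 n2 : coprime n1 n2 ->
  gcdn m (n1 * n2) = (gcdn m n1 * gcdn m n2)%N.
Proof.
move=> co; apply/eqP; rewrite eqn_dvd; apply/andP; split.
  rewrite muln_gcdr !muln_gcdl !dvdn_gcd dvdn_gcdr.
  by rewrite dvdn_mulr ?dvdn_gcdl // dvdn_mull ?dvdn_gcdl // dvdn_mulr ?dvdn_gcdl.
rewrite Gauss_dvd; last first.
  by rewrite (coprime_dvdl (dvdn_gcdr m n1)) // (coprime_dvdr (dvdn_gcdr m n2)).
by rewrite !dvdn_gcd !dvdn_gcdl /= dvdn_mulr ?dvdn_gcdr // dvdn_mull ?dvdn_gcdr.
Qed.

Lemma groupX_gcd (gT : finGroupType) (K : {group gT}) (h : gT) m n :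
  h ^+ m \in K -> h ^+ n \in K -> h ^+ gcdn m n \in K.
Proof.
have [->|m0] := posnP m; first by rewrite gcd0n.
move=> hm hn; have [u _ /dvdnP[v E]] := Bezoutl n m0.
rewrite -(groupMr _ (groupX u hn)) -expgM -expgD [(n * u)%N]mulnC E mulnC expgM.
exact: groupX.
Qed.

(** Here a = d = m. By x^k = y^k h^(geo m k), the coset of x^k is that of the power of h with
    exponent its label, and h has order p^e. Conjugation by y multiplies this exponent by m, and x =
    y h then adds 1. *)
Lemma isob_pgroup_odd p e (gT : finGroupType) (S : {group gT}) (x y : gT) :
  prime p -> odd p -> isobicyclic S x y (p ^ e) ->
  exists a d, [/\ 0 < d, affine_data (p ^ e) a d, affine_action x y (p ^ e) a d
    & y ^+ gcdn (d - 1) (p ^ e) \in <[x]> * S^`(1)].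
Proof.
move=> pr_p odd_p isoS; have [xS yS] := isob_mem isoS.
have [m [m1 oh hx]] := isob_odd_pgroup isoS pr_p odd_p.
have n0 := isob_n_gt0 isoS.
set h := y^-1 * x in oh hx; have xE : x = y * h by rewrite mulKVg.
have hS : h \in S by rewrite groupM ?groupV.
have m0 : 0 < m by case: m m1 {hx} => // /esym/eqP; rewrite mod0n modn_small // prime_gt1.
clearbody h.
have hy : h ^ y = h ^+ m.
  by apply: (@conjg_inj _ h); rewrite -conjgM -xE hx; apply/esym/conjg_fixP/commgP/commute_sym/commuteX.
have fp : full_period (p ^ e) m by apply: full_period_pexp; rewrite // odd_p m1 eqxx.
have xk k : x ^+ k = y ^+ k * h ^+ geo m k.
  have := @expg_mul_twisted _ p m k y h 1 m1 (expg1n _ _) (commute_sym (commute1 _)) (commute_sym (commute1 _)).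
  by rewrite mulg1 -xE expg1n mulg1; apply.
exists m, m; split=> //.
- by apply: affine_data_pexp; rewrite // /affine_at odd_p m1 !eqxx.
- move=> i; have [i' _ Ei'] := geo_surj (m * geo m i) n0 fp.
  have [j Ej] : exists j, y ^+ i.+1 * y ^- i' = y ^+ j.
    by apply/cycleP; rewrite groupM ?groupV ?mem_cycle.
  exists j, i'; split=> //; rewrite -Ej [x ^+ i']xk mulgA mulgKV xk.
  rewrite -mulgA (conjgC (h ^+ _)) conjXg hy mulgA -expgSr -expgM; congr (_ * _).
  by apply/eqP; rewrite eq_expg_mod_order oh Ei'.
set g := gcdn _ _.
(* h^(m - 1) = [h, x] and h^(p^e) = 1 put h^g in S'. Now y^g is x^g times the inverse of h^(geo m
   g), and g divides [geo m g] because m = 1 mod g. *)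
have hg : h ^+ g \in S^`(1).
  apply: groupX_gcd; last by rewrite -oh expg_order.
  suff ->: h ^+ (m - 1) = [~ h, x] by rewrite mem_commg.
  by rewrite commgEl hx -{2}(subnKC m0) expgD expg1 mulKg.
have -> : y ^+ g = x ^+ g * (h ^+ geo m g)^-1 by rewrite xk mulgK.
rewrite mem_mulg ?mem_cycle // groupV.
have /dvdnP[u ->] : g %| geo m g.
  rewrite /dvdn (@geo_mod1 g m g) ?modnn //; apply/eqP.
  by rewrite eqn_mod_dvd // dvdn_gcdl.
by rewrite mulnC expgM groupX.
Qed.

Lemma isob_abelian_affine n (gT : finGroupType) (S : {group gT}) (x y : gT) :
  isobicyclic S x y n -> commute x y -> affine_action x y n 1 1
  /\ y ^+ gcdn (1 - 1) n \in <[x]> * S^`(1).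
Proof.
move=> isoS cxy; have [_ _ oy _ _] := isoS; split.
  move=> i; exists 1%N, i; rewrite mul1n; split=> //.
  by rewrite expg1; apply/commute_sym/commuteX/commute_sym.
by rewrite subnn gcd0n -oy expg_order -[1]mulg1 mem_mulg ?group1.
Qed.

(** Modulo [<x^2>] [<y^2>] the group has order 4, so [x, y] = x^(2 i) y^(2 j). The swap inverts this
    commutator, which forces i = j mod 2, and i is odd since x and y do not commute. *)
Lemma isob_4 (gT : finGroupType) (S : {group gT}) (x y : gT) :
  isobicyclic S x y 4 -> ~ commute x y ->
  [/\ x * y = y ^+ 3 * x ^+ 3, [~ x, y] = x ^+ 2 * y ^+ 2 & commute (x ^+ 2) y].
Proof.
move=> isoS ncxy; have [xS yS] := isob_mem isoS; have [defS ox oy tixy [f [fx fy]]] := isoS.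
have [r [pr_r rn nP]] := isob_core_nontrivial isoS isT.
have Er : r = 2.
  have: r \in primes 4 by rewrite mem_primes pr_r.
  by rewrite (_ : primes 4 = [:: 2%N]) // inE => /eqP.
rewrite {r pr_r rn}Er [_ %/ _]/= in nP.
have pS : 2.-group S by rewrite /pgroup (isob_card isoS).
have o2 (u : gT) : #[u] = 4 -> #[u ^+ 2] = 2 by move=> ou; rewrite orderXdiv ou.
have zx : x ^+ 2 \in 'Z(S) by apply: (@pgroup_normal_prime_central _ 2); rewrite // o2.
have zy : y ^+ 2 \in 'Z(S).
  apply: (@pgroup_normal_prime_central _ 2); rewrite ?o2 //.
  exact (isob_normal_swap isoS nP).
have cZ u v : u \in 'Z(S) -> v \in S -> commute u v by move=> /setIP[_ /centP]; apply.
have isoQ := isob_quotient isoS (isT : 2 %| 4) nP.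
have nZ := isob_ker_normal isoS nP; have EZ := isob_kerE isoS nP.
set Z := isob_ker x y 2 in isoQ nZ EZ.
have abQ : abelian (S / Z) by rewrite (@card_p2group_abelian _ 2) // (isob_card isoQ).
have : [~ x, y] \in Z by apply: (subsetP (der1_min (normal_norm nZ) abQ)); rewrite mem_commg.
rewrite -[_ \in Z]/(_ \in gval Z) EZ => /mulsgP[_ _ /cycleP[i ->] /cycleP[j ->] Ec].
have x22 : x ^+ 2 ^+ 2 = 1 by apply/eqP; rewrite -expgM -order_dvdn ox.
have y22 : y ^+ 2 ^+ 2 = 1 by apply/eqP; rewrite -expgM -order_dvdn oy.
have E1 : (x ^+ 2) ^+ (i + j) * (y ^+ 2) ^+ (i + j) = 1.
  have: [~ x, y] * f [~ x, y] = 1 by rewrite morphR // fx fy -invg_comm mulVg.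
  rewrite Ec morphM ?groupX // !morphX ?groupX // fx fy => <-.
  rewrite (expgD (x ^+ 2)) -!mulgA; congr (_ * _).
  have c : commute (x ^+ 2 ^+ j) (y ^+ 2 ^+ (i + j)) by apply: cZ; rewrite groupX // groupX.
  by rewrite c mulgA -expgD addnC.
have E2 : (x ^+ 2) ^+ (i + j) = 1.
  apply/set1gP; rewrite -tixy inE -expgM mem_cycle /=.
  by move: E1 => /(canRL (mulgK _)); rewrite mul1g -!expgM => ->; rewrite groupV mem_cycle.
have : 2 %| i + j by rewrite -(o2 x ox) order_dvdn E2.
rewrite dvdn2 oddD negb_add => /eqP oij.
have Ec' : [~ x, y] = x ^+ 2 ^+ odd i * y ^+ 2 ^+ odd i.
  by rewrite Ec -(expg_mod i x22) -(expg_mod j y22) !modn2 oij.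
case: (odd i) Ec' => Ec'; last by case: ncxy; apply/commgP; rewrite Ec' mulg1.
split=> //; last exact: cZ.
rewrite commgC Ec' !expg1 -mulgA (mulgA x) -expgS.
by rewrite -(cZ _ _ zy (groupX 3 xS)) mulgA -expgS.
Qed.

Lemma isob_pgroup p e (gT : finGroupType) (S : {group gT}) (x y : gT) :
  prime p -> (p = 2 -> e <= 2) -> isobicyclic S x y (p ^ e) ->
  exists a d, [/\ 0 < d, affine_data (p ^ e) a d, affine_action x y (p ^ e) a d
    & y ^+ gcdn (d - 1) (p ^ e) \in <[x]> * S^`(1)].
Proof.
move=> pr_p; have [-> /(_ erefl) e2 isoS|odd_p _] := even_prime pr_p; last first.
  exact: isob_pgroup_odd.
have data1 : affine_data (2 ^ e) 1 1 by apply: affine_data_pexp; rewrite // /affine_at exp1n !eqxx.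
have [cxy|ncxy] := boolP ([~ x, y] == 1).
  have [aff yg] := isob_abelian_affine isoS (elimT commgP cxy).
  by exists 1%N, 1%N.
have [xS yS] := isob_mem isoS.
have [e2'|ne2] := eqVneq e 2; last first.
  case/negP: ncxy; apply/commgP.
  suff abS : abelian S by apply: (centsP abS).
  case: e e2 ne2 isoS {data1} => [|[|[|e]]] // _ _ isoS; have := isob_card isoS.
    by move/card1_trivg => ->; apply: abelian1.
  by move=> cS; rewrite (@card_p2group_abelian _ 2).
rewrite {e}e2' in isoS e2 data1 *.
have [E Ec cx2] := isob_4 isoS (fun c => negP ncxy (introT commgP c)).
have [_ ox oy _ _] := isoS.
(* y fixes the even labels modulo 4 and adds 2 to the odd ones, which is multiplication by 3. *)
exists 1%N, 3; split=> //.
- move=> i; rewrite -(odd_double_half i); set k := i./2.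
  have cxk : commute (x ^+ k.*2) y.
    by rewrite -mul2n expgM; apply/commute_sym/commuteX/commute_sym.
  case: (odd i) => /=.
    exists 3, (3 + k.*2)%N; split.
      by rewrite add1n expgSr -mulgA E mulgA (commuteX 3 cxk) -mulgA -expgD addnC.
    rewrite !geo_1n mulnDr muln1; apply/eqP; rewrite eqn_modDl -!mul2n.
    rewrite (_ : 3 * (2 * k) = k * 4 + 2 * k)%N ?modnMDl //.
    by lia.
  exists 1%N, k.*2; split; first by rewrite expg1 add0n.
  rewrite !geo_1n -!mul2n.
  rewrite (_ : 3 * (2 * k) = k * 4 + 2 * k)%N ?modnMDl //.
  by lia.
have -> : y ^+ gcdn (3 - 1) (2 ^ 2) = x ^- 2 * [~ x, y] by rewrite Ec mulKg.
by rewrite mem_mulg ?mem_commg ?groupV ?mem_cycle.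
Qed.

(** * Hall subgroups and the action on a normal Sylow subgroup *)

(** By Hall's theorem x_pi lies in H0^a and y_pi in H0^b. Write a^-1 b = u v with u in [<x>], v in
    [<y>]: then H0^(a u) = H0^(b v^-1) contains both, since u centralises x and v centralises y.
    Orders show that it is the product of the two cyclic groups. *)
Lemma isob_Hall (pi : nat_pred) (gT : finGroupType) (G : {group gT}) (x y : gT) n :
  isobicyclic G x y n -> exists H : {group gT},
    pi.-Hall(G) H /\ isobicyclic H x.`_pi y.`_pi n`_pi.
Proof.
move=> isoG; have [xG yG] := isob_mem isoG; have [defG ox oy tixy [f [fx fy]]] := isoG.
have solG := isob_solvable isoG.
have [H0 hallH0] := Hall_exists pi solG.
have xpG : x.`_pi \in G by rewrite groupX.
have ypG : y.`_pi \in G by rewrite groupX.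
have pig (u : gT) : pi.-group <[u.`_pi]> by rewrite /pgroup -orderE; apply: p_elt_constt.
have [a aG sxa] := Hall_subJ solG hallH0 (etrans (cycle_subG _ _) xpG) (pig x).
have [b bG syb] := Hall_subJ solG hallH0 (etrans (cycle_subG _ _) ypG) (pig y).
have [u [v [uX vY Euv]]] : exists u v, [/\ u \in <[x]>, v \in <[y]> & a^-1 * b = u * v].
  have : a^-1 * b \in G by rewrite groupM ?groupV.
  by rewrite -defG => /mulsgP[u v uX vY E]; exists u, v.
have uG : u \in G by apply: subsetP uX; rewrite cycle_subG.
pose H := (H0 :^ (a * u))%G.
have hallH : pi.-Hall(G) H by rewrite pHallJ // groupM.
have cycleJ (w z : gT) : w \in <[z]> -> <[z.`_pi]> :^ w = <[z.`_pi]>.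
  by move=> wz; apply/normP/(subsetP (cent_sub _)); rewrite cent_cycle; apply/cent1P;
     apply: (centsP (cycle_abelian z)); rewrite ?mem_cycle.
have sxH : <[x.`_pi]> \subset H by rewrite /= conjsgM -(cycleJ u x uX) conjSg.
have syH : <[y.`_pi]> \subset H.
  rewrite /= (_ : a * u = b * v^-1) ?conjsgM; last by apply: (canRL (mulgK v)); rewrite -mulgA -Euv mulKVg.
  by rewrite -(cycleJ v^-1 y) ?groupV // conjSg.
exists H; split=> //.
have oxp : #[x.`_pi] = (n`_pi)%N by rewrite order_constt ox.
have oyp : #[y.`_pi] = (n`_pi)%N by rewrite order_constt oy.
have ti : <[x.`_pi]> :&: <[y.`_pi]> = 1.
  by apply/trivgP; rewrite -tixy setISS // cycleX.
split=> //.
  apply/eqP; rewrite eqEcard mul_subG //= (card_Hall hallH) (isob_card isoG).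
  have := mul_cardG <[x.`_pi]> <[y.`_pi]>; rewrite ti cards1 muln1 -!orderE oxp oyp => <-.
  by rewrite partnM ?(isob_n_gt0 isoG).
exists (restrm_morphism (pHall_sub hallH) f).
by rewrite /= /restrm !morph_constt // fx fy.
Qed.

(** Fixed points lift under coprime action, so C_S(A) covers S / Phi(S), and a subgroup covering the
    Frattini quotient is S. *)
Lemma coprime_cent_mod_Phi (gT : finGroupType) (p : nat) (S A : {group gT}) :
  p.-group S -> p^'.-group A -> A \subset 'N(S) ->
  S / 'Phi(S) \subset 'C(A / 'Phi(S)) -> A \subset 'C(S).
Proof.
move=> pS p'A nSA cSA; have sPhi := Phi_sub S.
have nPhiA : A \subset 'N('Phi(S)) := subset_trans nSA (char_norms (Phi_char S)).
have E : 'C_S(A) / 'Phi(S) = S / 'Phi(S).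
  rewrite coprime_quotient_cent ?(pnat_coprime pS p'A) ?(pgroup_sol pS) //.
  exact/setIidPl.
have nPhiS := normal_norm (Phi_normal S).
have sCS : 'C_S(A) \subset S by rewrite subsetIl.
have ES : 'Phi(S) * 'C_S(A) = S.
  by rewrite -quotientK ?(subset_trans sCS) // E quotientK // mulSGid.
rewrite centsC -{1}(@Phi_nongen _ S 'C_S(A)); first by rewrite gen_subG subsetIr.
by rewrite norm_joinEr // (subset_trans sCS).
Qed.

Section Dichotomy.
Variables (gT : finGroupType) (G S H : {group gT}) (x y : gT) (n p : nat).
Hypotheses (isoG : isobicyclic G x y n) (pr_p : prime p) (pn : p %| n).
Hypotheses (sylS : p.-Sylow(G) S) (nSG : S <| G).
Variables xp yp x' y' : gT.
Hypotheses (xpE : xp = x.`_p) (ypE : yp = y.`_p) (x'E : x' = x.`_p^') (y'E : y' = y.`_p^').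
Hypothesis isoS : isobicyclic S xp yp n`_p.
Hypothesis isoH : isobicyclic H x' y' n`_p^'.

Let pS : p.-group S. Proof. exact: pHall_pgroup sylS. Qed.
Let xG : x \in G. Proof. by case: (isob_mem isoG). Qed.
Let yG : y \in G. Proof. by case: (isob_mem isoG). Qed.
Let x'G : x' \in G. Proof. by rewrite x'E groupX. Qed.
Let y'G : y' \in G. Proof. by rewrite y'E groupX. Qed.
Let xpS : xp \in S. Proof. by case: (isob_mem isoS). Qed.
Let ypS : yp \in S. Proof. by case: (isob_mem isoS). Qed.
Let nS g : g \in G -> g \in 'N(S). Proof. exact: (subsetP (normal_norm nSG)). Qed.
Let nPhi : 'Phi(S) <| G. Proof. exact: char_normal_trans (Phi_char S) nSG. Qed.
Let nF g : g \in G -> g \in 'N('Phi(S)). Proof. exact: (subsetP (normal_norm nPhi)). Qed.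
Let sSG : S \subset G := pHall_sub sylS.
Let SG s : s \in S -> s \in G. Proof. exact: (subsetP sSG). Qed.
Let np1 : 1 < (n`_p)%N.
Proof.
rewrite p_part -(expn0 p) ltn_exp2l ?prime_gt1 // logn_gt0 mem_primes pr_p pn.
by rewrite (isob_n_gt0 isoG).
Qed.

Let abQ : p.-abelem (S / 'Phi(S)) := Phi_quotient_abelem pS.

(** G' is abelian. Its p-part lies in S and acts trivially on the abelian group S / Phi(S); its
    p'-part is normal in G and meets S trivially, hence centralises S. *)
Lemma der1_acts_trivially_mod_Phi s g :
  s \in S -> g \in G^`(1) -> [~ s, g] \in 'Phi(S).
Proof.
move=> sS; have abG' := isob_der1_abelian isoG.
have /dprodP[_ defG' _ _] := nilpotent_pcoreC p (abelian_nil abG').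
rewrite -defG' => /mulsgP[a b aA bB ->].
have nA : 'O_p(G^`(1)) <| G := char_normal_trans (pcore_char _ _) (der_normal 1 G).
have nB : 'O_p^'(G^`(1)) <| G := char_normal_trans (pcore_char _ _) (der_normal 1 G).
have aS : a \in S.
  apply: subsetP aA; rewrite (sub_normal_Hall sylS nSG) ?pcore_pgroup //.
  exact: normal_sub nA.
have bG : b \in G := subsetP (normal_sub nB) b bB.
have tiSB : S :&: 'O_p^'(G^`(1)) = 1 by apply: coprime_TIg; apply: pnat_coprime pS (pcore_pgroup _ _).
have sb : [~ s, b] = 1.
  apply/set1gP; rewrite -tiSB inE; apply/andP; split.
    by rewrite commgEl groupM ?groupV // memJ_norm ?nS.
  by rewrite commgEr groupM // memJ_norm ?groupV // (subsetP (normal_norm nB)) // SG.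
rewrite commgMJ sb mul1g memJ_norm ?nF //.
have sder: S^`(1) \subset 'Phi(S).
  by rewrite der1_min ?normal_norm ?Phi_normal // (abelem_abelian abQ).
by apply: (subsetP sder); rewrite mem_commg.
Qed.

Let oQ u : u \in S -> coset 'Phi(S) u ^+ p = 1.
Proof. by move=> uS; have /(abelemP pr_p)[_] := abQ; apply; apply: mem_quotient. Qed.

Let cQ u v : u \in S -> v \in S -> commute (coset 'Phi(S) u) (coset 'Phi(S) v).
Proof.
by move=> uS vS; apply: (centsP (abelem_abelian abQ)); apply: mem_quotient.
Qed.

(** Otherwise S / Phi(S), hence S, is cyclic, and xp, yp of equal order generate the same subgroup,
    against the trivial intersection. *)
Let q_indep i : coset 'Phi(S) xp ^+ i \in <[coset 'Phi(S) yp]> -> p %| i.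
Proof.
move=> qi; apply: contraLR np1 => npi; rewrite -leqNgt.
have [defS ox oy tixy _] := isoS.
have qx : coset 'Phi(S) xp \in <[coset 'Phi(S) yp]>.
  have co : coprime p i by rewrite prime_coprime.
  have [u _ /dvdnP[v E]] := Bezoutl i (prime_gt0 pr_p).
  rewrite -(expg1 (coset _ xp)) -(eqP co).
  apply: (@groupX_gcd _ _ _ p i) => //; rewrite oQ ?group1 //.
have cyQ : cyclic (S / 'Phi(S)).
  apply/cyclicP; exists (coset 'Phi(S) yp).
  rewrite -[X in X / _]defS quotientMl ?cycle_subG ?nF ?SG //.
  by rewrite !quotient_cycle ?nF ?SG //; apply/mulSGid; rewrite cycle_subG.
have cyS := Phi_quotient_cyclic cyQ.
have Exy : <[xp]> = <[yp]>.
  by apply/eqP; rewrite (eq_subG_cyclic cyS) ?cycle_subG // -!orderE ox oy.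
by move: tixy; rewrite Exy setIid => /eqP; rewrite cycle_eq1 -order_eq1 oy => /eqP ->.
Qed.

(* Write xp^y' = xp^al yp^be, hence yp^x' = yp^al xp^be by the swap. As [y', x'] acts trivially on
   S / Phi(S), be^2 = 0 mod p; the two cases are al = 1 and al <> 1 mod p. *)
Lemma isob_Sylow_dichotomy : H \subset 'C(S) \/
  S \subset G^`(1) /\ exists l, [/\ 0 < l, l != 1 %[mod p], xp ^ y' = xp ^+ l & yp ^ x' = yp ^+ l].
Proof.
have [defG ox oy tixy [f [fx fy]]] := isoG.
have [defS oxp oyp tixyp _] := isoS.
have fxp : f xp = yp by rewrite xpE ypE morph_constt // fx.
have fyp : f yp = xp by rewrite xpE ypE morph_constt // fy.
have fx' : f x' = y' by rewrite x'E y'E morph_constt // fx.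
have fy' : f y' = x' by rewrite x'E y'E morph_constt // fy.
have cxx : xp ^ x' = xp by rewrite xpE x'E; apply/conjg_fixP/commgP/commuteX2.
have cyy : yp ^ y' = yp by rewrite ypE y'E; apply/conjg_fixP/commgP/commuteX2.
(* Adding n_p to the exponent makes al positive, so that al - 1 is a genuine difference. *)
have [al [be [al0 Exy]]] : exists al be, 0 < al /\ xp ^ y' = xp ^+ al * yp ^+ be.
  have : xp ^ y' \in S by rewrite memJ_norm // nS.
  case/(isob_decomp isoS)=> i [j ->]; exists (i + n`_p)%N, j; split.
    by rewrite addn_gt0 orbC (ltnW np1).
  by rewrite expgD -oxp expg_order mulg1.
have Eyx : yp ^ x' = yp ^+ al * xp ^+ be.
  have := congr1 f Exy; have [xpG ypG] := (SG xpS, SG ypS).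
  have fX i : f (xp ^+ i) = yp ^+ i by rewrite morphX // fxp.
  have fY i : f (yp ^+ i) = xp ^+ i by rewrite morphX // fyp.
  by rewrite morphJ // morphM ?groupX // fX fY fxp fy'.
pose phi := [~ xp ^ y', [~ y', x']].
have phiP : phi \in 'Phi(S).
  by rewrite der1_acts_trivially_mod_Phi ?mem_commg ?memJ_norm ?nS.
(* Two evaluations of xp^(y' x'): directly, and as xp^(x' y' [y', x']), where x' fixes xp. *)
have Ephi : (yp ^+ al * xp ^+ be) ^+ be = yp ^+ be * phi.
  have E : xp ^ (y' * x') = xp ^ y' * phi.
    by rewrite (commgC y' x') (conjgM xp (x' * y')) (conjgM xp x') cxx /phi (commgEl (xp ^ y')) mulKVg.
  by move: E; rewrite conjgM {1 2}Exy conjMg (conjXg xp) (conjXg yp) cxx Eyx -mulgA => /mulgI.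
set qx := coset 'Phi(S) xp; set qy := coset 'Phi(S) yp.
have [xpF ypF] : xp \in 'N('Phi(S)) /\ yp \in 'N('Phi(S)) by rewrite !nF ?SG.
have pbe : p %| be.
  have : qx ^+ (be * be) \in <[qy]>.
    have E : (qy ^+ al * qx ^+ be) ^+ be = qy ^+ be.
      have E1 : coset 'Phi(S) (yp ^+ be * phi) = qy ^+ be.
        have phiF : phi \in 'N('Phi(S)) by apply: (subsetP (normG _)).
        have ypbF : yp ^+ be \in 'N('Phi(S)) by apply: groupX.
        by rewrite (morphM _ ypbF phiF) (morphX _ _ ypF) /= (coset_id phiP) mulg1.
      by rewrite -E1 -Ephi morphX ?groupM ?groupX // morphM ?groupX // !morphX.
    rewrite expgMn in E; last exact/commuteX2/cQ.
    move/(canRL (mulKg _)): E; rewrite -!expgM => ->.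
    by rewrite groupM ?groupV ?mem_cycle.
  by move/q_indep; rewrite Euclid_dvdM // orbb.
have qybe : qy ^+ be = 1 by have /dvdnP[k ->] := pbe; rewrite mulnC expgM oQ // expg1n.
have qxbe : qx ^+ be = 1 by have /dvdnP[k ->] := pbe; rewrite mulnC expgM oQ // expg1n.
have qxy' : coset 'Phi(S) (xp ^ y') = qx ^+ al.
  by rewrite Exy morphM ?groupX // !morphX // -/qx -/qy qybe mulg1.
have qyx' : coset 'Phi(S) (yp ^ x') = qy ^+ al.
  by rewrite Eyx morphM ?groupX // !morphX // -/qx -/qy qxbe mulg1.
have p'y : p^'.-group <[y']> by rewrite y'E /pgroup -orderE; apply: p_elt_constt.
have p'x : p^'.-group <[x']> by rewrite x'E /pgroup -orderE; apply: p_elt_constt.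
have cent z : z \in G -> p^'.-group <[z]> -> coset 'Phi(S) (xp ^ z) = qx ->
    coset 'Phi(S) (yp ^ z) = qy -> z \in 'C(S).
  move=> zG p'z ex ey; rewrite -cycle_subG.
  have zF := nF zG.
  apply: (coprime_cent_mod_Phi pS p'z); first by rewrite cycle_subG nS.
  rewrite quotient_cycle // centsC cycle_subG.
  rewrite -[X in X / _]defS quotientMl ?cycle_subG // !quotient_cycle //= centM !cent_cycle inE.
  by apply/andP; split; apply/cent1P/commute_sym/commgP/conjg_fixP; rewrite -morphJ.
case: (boolP (al == 1 %[mod p])) => [/eqP al1|al1].
  left; have [defH _ _ _ _] := isoH.
  have qal z : z \in S -> coset 'Phi(S) z ^+ al = coset 'Phi(S) z.
    by move=> zS; rewrite -(expg_mod _ (oQ zS)) al1 expg_mod ?oQ.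
  rewrite -defH mul_subG // cycle_subG; apply: cent => //.
  - by rewrite cxx.
  - by rewrite qyx' qal.
  - by rewrite qxy' qal.
  by rewrite cyy.
right.
have nG' : G^`(1) <| G := der_normal 1 G.
have [al' Eal] : exists al', al = al'.+1 by case: al al0 {Exy Eyx Ephi qxy' qyx' al1} => // k; exists k.
have nal' : ~~ (p %| al').
  by apply: contra al1 => pal; rewrite Eal -addn1 eqn_mod_dvd ?addnK // leq_addl.
(* Modulo Phi(S), s^(al - 1) = [s, t] lies in G', and al - 1 is prime to p, so s lies there too. *)
have derQ s t : s \in S -> t \in G -> coset 'Phi(S) (s ^ t) = coset 'Phi(S) s ^+ al ->
    coset 'Phi(S) s \in (G^`(1) :&: S) / 'Phi(S).
  move=> sS tG E; have stS : s ^ t \in S by rewrite memJ_norm ?nS.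
  have co : coprime p al' by rewrite prime_coprime.
  have [u _ /dvdnP[v Ev]] := Bezoutl al' (prime_gt0 pr_p).
  have -> : coset 'Phi(S) s = coset 'Phi(S) s ^+ gcdn p al' by rewrite (eqP co) expg1.
  apply: groupX_gcd; first by rewrite oQ ?group1.
  have -> : coset 'Phi(S) s ^+ al' = coset 'Phi(S) [~ s, t].
    rewrite commgEl morphM ?groupV ?nF ?SG // morphV ?nF ?SG //.
    by rewrite /= E Eal expgS mulKg.
  apply: mem_quotient; rewrite inE mem_commg ?(SG sS) //=.
  by rewrite commgEl (groupM _ stS) ?groupV.
have sSG' : S \subset G^`(1).
  have sSD : S / 'Phi(S) \subset (G^`(1) :&: S) / 'Phi(S).
    rewrite -[X in X / _ \subset _]defS quotientMl ?cycle_subG //.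
    rewrite !quotient_cycle // mul_subG // cycle_subG /=.
      exact: derQ xpS y'G qxy'.
    exact: derQ ypS x'G qyx'.
  have nPhiS := normal_norm (Phi_normal S).
  have sDS : G^`(1) :&: S \subset S by apply: subsetIr.
  rewrite -{1}(@Phi_nongen _ S (G^`(1) :&: S)); first by rewrite gen_subG subsetIl.
  rewrite norm_joinEr ?(subset_trans sDS) //; apply/eqP; rewrite eqEsubset mul_subG ?Phi_sub //=.
  by rewrite -quotientSK.
split=> //.
have abG' := isob_der1_abelian isoG.
have abS : abelian S := abelianS sSG' abG'.
(* S now lies in the abelian group G', so phi vanishes and yp^(al be) xp^(be^2) = yp^be holds
   exactly. Trivial intersection gives xp^(be^2) = 1; then n_p divides (al - 1) be, hence be. *)
have phi1 : phi = 1.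
  apply/eqP/commgP; apply: (centsP abG'); last by rewrite mem_commg.
  by apply: (subsetP sSG'); rewrite memJ_norm ?nS.
move: Ephi; rewrite phi1 mulg1 expgMn; last by apply: (centsP abS); rewrite groupX.
rewrite -!expgM => E.
have xbe : xp ^+ (be * be) = 1.
  apply/set1gP; rewrite -tixyp inE mem_cycle /=.
  by move/(canRL (mulKg _)): E => ->; rewrite groupM ?groupV ?mem_cycle.
have nbe : n`_p %| be.
  have : yp ^+ (al' * be) == 1.
    by rewrite -(can_eq (mulKg (yp ^+ be))) mulg1 -expgD -mulSn -Eal -E xbe mulg1.
  by rewrite -order_dvdn oyp Gauss_dvdr // p_part coprimeXl // prime_coprime.
have [xb yb] : xp ^+ be = 1 /\ yp ^+ be = 1.
  by split; apply/eqP; rewrite -order_dvdn ?oxp ?oyp.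
by exists al; rewrite Exy Eyx xb yb !mulg1.
Qed.
End Dichotomy.

(** * Gluing the affine actions on coprime parts *)

Lemma gcdn_sub1_mod n d d1 : 0 < d -> 0 < d1 -> d = d1 %[mod n] ->
  gcdn (d - 1) n = gcdn (d1 - 1) n.
Proof.
move=> d0 d10 E; rewrite -(gcdn_modl (d - 1)) -(gcdn_modl (d1 - 1)); congr (gcdn _ _).
by apply/eqP; rewrite -(eqn_modDr 1) !subnK //; apply/eqP.
Qed.

Lemma affine_data_mul n1 n2 a d : coprime n1 n2 -> 0 < n1 -> 0 < n2 ->
  all (fun p => affine_at p (p ^ logn p n1) (gcdn (d - 1) (n1 * n2)) a d) (primes n1) ->
  all (fun p => affine_at p (p ^ logn p n2) (gcdn (d - 1) (n1 * n2)) a d) (primes n2) ->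
  affine_data (n1 * n2) a d.
Proof.
move=> co n10 n20 /allP H1 /allP H2; apply/allP=> p.
have nd m1 m2 : coprime m1 m2 -> p \in primes m1 -> logn p m2 = 0.
  move=> com pm1; apply/eqP; rewrite -leqn0 leqNgt logn_gt0.
  apply: contraL com => pm2; rewrite coprime_has_primes; last 2 first.
  - by move: pm1; rewrite mem_primes => /and3P[].
  - by move: pm2; rewrite mem_primes => /and3P[].
  by rewrite negbK; apply/hasP; exists p.
rewrite primesM // => /orP[p1|p2]; rewrite lognM //.
  by rewrite (nd n1 n2) // addn0 H1.
by rewrite (nd n2 n1) 1?coprime_sym // add0n H2.
Qed.

Lemma affine_data_transfer n1 N a d a1 d1 : 0 < d -> 0 < d1 -> n1 %| N ->
  a = a1 %[mod n1] -> d = d1 %[mod n1] -> affine_data n1 a1 d1 ->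
  all (fun p => affine_at p (p ^ logn p n1) (gcdn (d - 1) N) a d) (primes n1).
Proof.
move=> d0 d10 n1N Ea Ed /allP H; apply/allP=> p pn; move: (H p pn).
have pl : p %| p ^ logn p n1 by rewrite dvdn_exp // logn_gt0.
have ln : p ^ logn p n1 %| n1 by apply: pfactor_dvdnn.
apply: affine_at_mono => //; try exact: (modn_dvd_eq ln).
by rewrite -(gcdn_sub1_mod d0 d10 Ed) dvdn_gcd dvdn_gcdl (dvdn_trans (dvdn_gcdr _ _)).
Qed.

(** One Chinese remainder index serves both for the exponents of x1 x2 and for their labels. *)
Lemma affine_index_crt (gT : finGroupType) (x1 x2 : gT) n1 n2 a d a1 d1 a2 d2 i i1 i2 :
  commute x1 x2 -> x1 ^+ n1 = 1 -> x2 ^+ n2 = 1 -> coprime n1 n2 -> 0 < n1 -> 0 < n2 ->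
  full_period n1 a1 -> full_period n2 a2 ->
  a = a1 %[mod n1] -> a = a2 %[mod n2] -> d = d1 %[mod n1] -> d = d2 %[mod n2] ->
  geo a1 i1 = (d1 * geo a1 i)%N %[mod n1] -> geo a2 i2 = (d2 * geo a2 i)%N %[mod n2] ->
  exists i', x1 ^+ i1 * x2 ^+ i2 = (x1 * x2) ^+ i' /\ geo a i' = (d * geo a i)%N %[mod n1 * n2].
Proof.
move=> cx o1 o2 co n10 n20 f1 f2 Ea1 Ea2 Ed1 Ed2 E1 E2.
have M1 := chinese_modl co i1 i2; have M2 := chinese_modr co i1 i2.
exists (chinese n1 n2 i1 i2); split.
  by rewrite expgMn // -(expg_mod _ o1) -(expg_mod _ o2) -M1 -M2 !expg_mod.
apply/eqP; rewrite chinese_remainder //; apply/andP; split; apply/eqP.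
  rewrite (geo_mod _ Ea1) (geo_mod_exp n10 f1 M1) E1; apply/esym/modn_eqM => //.
  exact: geo_mod.
rewrite (geo_mod _ Ea2) (geo_mod_exp n20 f2 M2) E2; apply/esym/modn_eqM => //.
exact: geo_mod.
Qed.

(** The last conclusion feeds the induction: when H acts on S by a scalar l, it places y'^g in a
    group that fixes xp, whence l^g = 1, the requirement on a terminal prime. *)
Lemma isob_affine n : forall (gT : finGroupType) (G : {group gT}) (x y : gT),
  ~~ (8 %| n) -> isobicyclic G x y n ->
  exists a d, [/\ 0 < d, affine_data n a d, affine_action x y n a d
    & y ^+ gcdn (d - 1) n \in <[x]> <*> G^`(1)].
Proof.
have [N] := ubnP n; elim: N n => // N IH n /ltnSE le_n gT G x y n8 isoG.
have n0 := isob_n_gt0 isoG.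
have [n1|n1] := leqP n 1.
  have {n1 le_n n8}n1 : n = 1%N by apply/eqP; rewrite eqn_leq n1.
  exists 1%N, 1%N; split=> //; first by rewrite n1.
    have [_ /eqP + /eqP + _ _] := isoG; rewrite n1 !order_eq1 => /eqP -> /eqP ->.
    by move=> i; exists 0, i; rewrite mul1n !expg1n mul1g.
  by have [_ _ oy _ _] := isoG; rewrite subnn gcd0n -oy expg_order group1.
pose p := max_pdiv n; have pr_p : prime p := max_pdiv_prime n1.
have pn : p %| n := max_pdiv_dvd n.
have sylO : p.-Sylow(G) 'O_p(G).
  apply: (isob_Sylow_normal isoG pr_p) => r pr_r rn.
  by apply: max_pdiv_max; rewrite mem_primes pr_r n0.
have [S [sylS isoS]] := isob_Hall p isoG.
have [H [hallH isoH]] := isob_Hall p^' isoG.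
have nSG : S <| G by rewrite (eq_Hall_pcore sylO sylS) pcore_normal.
have [xE yE] : x = x.`_p * x.`_p^' /\ y = y.`_p * y.`_p^' by rewrite !consttC.
have dich := isob_Sylow_dichotomy isoG pr_p pn sylS nSG erefl erefl erefl erefl isoS isoH.
have nE : n = (n`_p * n`_p^')%N by rewrite partnC.
have co : coprime n`_p n`_p^' by apply: coprime_partC.
have p_gt1 : 1 < n`_p.
  by rewrite p_part -(expn0 p) ltn_exp2l ?prime_gt1 // logn_gt0 mem_primes pr_p n0.
have [a2 [d2 [d20 dat2 act2 y2]]] : exists a d, [/\ 0 < d, affine_data n`_p^' a d,
    affine_action x.`_p^' y.`_p^' n`_p^' a d
    & y.`_p^' ^+ gcdn (d - 1) n`_p^' \in <[x.`_p^']> <*> H^`(1)].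
  apply: IH isoH.
    by apply: leq_trans le_n; rewrite [X in _ < X]nE -[X in X < _]mul1n ltn_mul2r p_gt1 part_gt0.
  by apply: contra n8 => /dvdn_trans; apply; apply: dvdn_part.
set xp := x.`_p in xE isoS dich; set yp := y.`_p in yE isoS dich.
set x' := x.`_p^' in xE isoH dich y2 act2; set y' := y.`_p^' in yE isoH dich y2 act2.
have cxx : commute xp x' by apply: commuteX2.
have cyy : commute yp y' by apply: commuteX2.
have [xpX x'X] : xp \in <[x]> /\ x' \in <[x]> by rewrite !mem_cycle.
have [ypY y'Y] : yp \in <[y]> /\ y' \in <[y]> by rewrite !mem_cycle.
have [[xpG x'G] [ypG y'G]]: (xp \in G /\ x' \in G) /\ (yp \in G /\ y' \in G).
  by have [xG yG] := isob_mem isoG; rewrite !groupX.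
clearbody xp yp x' y'.
have [defS oxp oyp tixyp _] := isoS; have [defH ox' oy' _ _] := isoH.
have [n1_gt0 n2_gt0] : 0 < n`_p /\ 0 < n`_p^' by rewrite !part_gt0.
have f2 := affine_data_full_period dat2.
have sHG := pHall_sub hallH; have sSG := pHall_sub sylS.
have sH'K : H^`(1) \subset <[x]> <*> G^`(1) by rewrite sub_gen // subsetU // dergS ?orbT.
have sS'K : S^`(1) \subset <[x]> <*> G^`(1) by rewrite sub_gen // subsetU // dergS ?orbT.
have sXK : <[x]> \subset <[x]> <*> G^`(1) by apply: joing_subl.
have y2K : y' ^+ gcdn (d2 - 1) n`_p^' \in <[x]> <*> G^`(1).
  by apply: subsetP y2; rewrite join_subG sH'K cycle_subG (subsetP sXK).
have xp1 : xp ^+ n`_p = 1 by rewrite -oxp expg_order.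
have x'1 : x' ^+ n`_p^' = 1 by rewrite -ox' expg_order.
have yj j1 j2 : exists j, yp ^+ j1 * y' ^+ j2 = y ^+ j.
  by apply/cycleP; rewrite groupM // groupX.
(* Reduction to the modulus n_p: a solution a1, d1 there is glued to a2, d2 from the induction. *)
have assemble a1 d1 : 0 < d1 -> full_period n`_p a1 ->
    affine_at p n`_p (gcdn (d1 - 1) n`_p * gcdn (d2 - 1) n`_p^') a1 d1 ->
    yp ^+ gcdn (d1 - 1) n`_p \in <[x]> <*> G^`(1) ->
    (forall i, exists j1 i1 j2 i2, [/\ x ^+ i * y = yp ^+ j1 * y' ^+ j2 * (xp ^+ i1 * x' ^+ i2),
       geo a1 i1 = (d1 * geo a1 i)%N %[mod n`_p] & geo a2 i2 = (d2 * geo a2 i)%N %[mod n`_p^']]) ->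
    exists a d, [/\ 0 < d, affine_data n a d, affine_action x y n a d
      & y ^+ gcdn (d - 1) n \in <[x]> <*> G^`(1)].
  move=> d10 f1 dat1 y1 act.
  (* Adding n keeps both residues and makes d positive, so that the truncated d - 1 is the true
     difference. *)
  pose a := chinese n`_p n`_p^' a1 a2; pose d := (chinese n`_p n`_p^' d1 d2 + n)%N.
  have d0 : 0 < d by rewrite addn_gt0 n0 orbT.
  have Ea1 : a = a1 %[mod n`_p] := chinese_modl co a1 a2.
  have Ea2 : a = a2 %[mod n`_p^'] := chinese_modr co a1 a2.
  have Ed1 : d = d1 %[mod n`_p].
    by rewrite /d [X in (_ + X)%N]nE mulnC addnC modnMDl chinese_modl.
  have Ed2 : d = d2 %[mod n`_p^'].
    by rewrite /d [X in (_ + X)%N]nE addnC modnMDl chinese_modr.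
  have gE : gcdn (d - 1) n = (gcdn (d1 - 1) n`_p * gcdn (d2 - 1) n`_p^')%N.
    by rewrite [X in gcdn _ X]nE gcdn_mul_coprime // (gcdn_sub1_mod d0 d10 Ed1) (gcdn_sub1_mod d0 d20 Ed2).
  exists a, d; split=> //.
  - rewrite [X in affine_data X]nE; apply: affine_data_mul => //; rewrite -nE; last first.
      by apply: affine_data_transfer dat2; rewrite // dvdn_part.
    have ln0 : 0 < logn p n by rewrite logn_gt0 mem_primes pr_p n0.
    apply/allP=> q; rewrite p_part primesX // primes_prime // inE => /eqP ->; rewrite pfactorK // -p_part.
    have pl : p %| n`_p by rewrite p_part dvdn_exp.
    by rewrite gE; apply: affine_at_mono dat1.
  - move=> i; have [j1 [i1 [j2 [i2 [E E1 E2]]]]] := act i.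
    have [j Ej] := yj j1 j2.
    have [i' [Ei' Eg]] := affine_index_crt cxx xp1 x'1 co n1_gt0 n2_gt0 f1 f2 Ea1 Ea2 Ed1 Ed2 E1 E2.
    by exists j, i'; rewrite -nE in Eg; rewrite E Ej Ei' -xE.
  rewrite {1}yE gE expgMn // (expgM yp) (mulnC (gcdn (d1 - 1) _)) (expgM y').
  by rewrite groupM // groupX.
have sK u : u \in S^`(1) -> u \in <[x]> <*> G^`(1) by apply: (subsetP sS'K).
have ln0 : 0 < logn p n by rewrite logn_gt0 mem_primes pr_p n0.
have pl : p %| n`_p by rewrite p_part dvdn_exp.
case: dich => [cHS|[sSG' [l [l0 l1 xl yl]]]].
  have cSH u v : u \in S -> v \in H -> commute v u by move=> uS vH; apply: (centsP cHS).
  have [xpS ypS] := isob_mem isoS; have [x'H y'H] := isob_mem isoH.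
  have le2 : p = 2 -> logn p n <= 2.
    move=> p2; rewrite leqNgt; apply: contra n8 => l3.
    by rewrite -[8]/(2 ^ 3)%N pfactor_dvdn // -[X in logn X]p2.
  have isoS' : isobicyclic S xp yp (p ^ logn p n) by rewrite -p_part.
  have [a1 [d1 [d10 dat1 act1 y1]]] := isob_pgroup pr_p le2 isoS'.
  rewrite -p_part in dat1 act1 y1.
  apply: (assemble a1 d1) => //.
  - exact: affine_data_full_period dat1.
  - move/allP: dat1 => /(_ p); rewrite {1}p_part primesX // primes_prime // inE eqxx => /(_ isT).
      rewrite {1}p_part pfactorK // -p_part; apply: affine_at_mono => //.
      exact: dvdn_mulr.
  - case/mulsgP: y1 => u v /cycleP[k ->] /sK vK ->; rewrite groupM // groupX //.
      exact: (subsetP sXK).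
  move=> i; have [j1 [i1 [E1 G1]]] := act1 i; have [j2 [i2 [E2 G2]]] := act2 i.
  exists j1, i1, j2, i2; split=> //.
  rewrite {1}xE {1}yE expgMn // -mulgA (mulgA (x' ^+ i)) (cSH yp (x' ^+ i)) ?groupX //.
    rewrite -mulgA E2 mulgA E1 -!mulgA; congr (_ * _); rewrite !mulgA; congr (_ * _).
    by apply/commute_sym/cSH; rewrite groupX.
have abG' := isob_der1_abelian isoG.
have abS : abelian S := abelianS sSG' abG'.
have [xpS ypS] := isob_mem isoS.
have xlk k : xp ^ (y' ^+ k) = xp ^+ (l ^ k).
  elim: k => [|k IHk]; first by rewrite conjg1 expg1.
  by rewrite expgSr conjgM IHk conjXg xl -expgM -expnS.
(* All of [<x'>] H' fixes xp: x' commutes with xp, and H' lies in the abelian group G', which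
   contains S. *)
have lg : l ^ gcdn (d2 - 1) n`_p^' == 1 %[mod n`_p].
  rewrite -oxp -eq_expg_mod_order -xlk expg1.
  have : y' ^+ gcdn (d2 - 1) n`_p^' \in 'C[xp].
    apply: subsetP y2; rewrite join_subG cycle_subG; apply/andP; split.
      exact/cent1P/commute_sym.
    rewrite sub_cent1; apply: (subsetP (centS (dergS 1 sHG))).
    by apply: (subsetP abG'); apply: (subsetP sSG').
  by move/cent1P => c; apply/eqP/conjg_fixP/commgP.
(* With slope 1 the label of xp^i is i, and y' multiplies it by l. *)
apply: (assemble 1%N l) => //.
- by apply/allP=> q _; rewrite !eqxx orbT.
- apply/orP; right; rewrite l1 orbT eqxx /= mulnC expnM.
  by rewrite (modn_eqX _ (elimT eqP lg)) exp1n.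
- apply: (subsetP (joing_subr _ _)); apply: (subsetP sSG'); exact: groupX.
move=> i; have [j2 [i2 [E2 G2]]] := act2 i.
have nx' : x' \in 'N(<[yp]>) by rewrite inE -cycleJ yl cycleX.
(* x' acts on [<yp>] by some exponent, which disappears in the coset of [<y>]. *)
have [m Em] : exists m, yp ^ (x' ^- i) = yp ^+ m.
  by apply/cycleP; rewrite memJ_norm ?cycle_id // groupV groupX.
exists m, (l * i)%N, j2, i2; split=> //; last by rewrite !geo_1n.
have c1 : commute (xp ^+ i) yp by apply: (centsP abS); rewrite ?groupX.
have E3 : x' ^+ i * yp = yp ^+ m * x' ^+ i by rewrite -Em conjgE invgK mulgA mulgKV.
rewrite {1}xE {1}yE expgMn // -(commuteX2 i i (commute_sym cxx)) -mulgA (mulgA (xp ^+ i)) c1.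
rewrite -mulgA (conjgC (xp ^+ i)) conjXg xl -expgM !mulgA E3 -(mulgA _ _ y') E2.
rewrite -!mulgA; congr (_ * (_ * _)).
by apply: commuteX2; apply: commute_sym.
Qed.

End IsobicyclicGroups.

(** * Multipliers *)

Definition affine_mult (n d : nat) : bool :=
  all (fun p => (d == 1 %[mod p]) || (d ^ gcdn (d - 1) n == 1 %[mod p ^ logn p n])) (primes n).

(** The primes at which the slope is d. Leaving out 2 makes the slope at 2 equal to 1 even when d =
    1 mod 2. *)
Definition mult_pred (d : nat) : nat_pred := [pred p | odd p && (d == 1 %[mod p])].
Local Notation affB n d := (n`_(mult_pred d)).
Local Notation affA n d := (n`_(mult_pred d)^').

(* x acts on the cosets of <y> by z |-> a z + 1 with a = affine_slope, y by z |-> d z, and the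
   rotation at the vertex i permutes its neighbours by z |-> a z + affine_shift i. *)
Definition affine_slope (n d : nat) : nat := chinese (affA n d) (affB n d) 1 d.

Definition affine_shift (n d i : nat) : nat :=
  chinese (affA n d) (affB n d) (d ^ i) (1 + (d - 1) * i).

Lemma modn_primes n u v : 0 < n ->
  (forall p, p \in primes n -> u = v %[mod p ^ logn p n]) -> u = v %[mod n].
Proof.
move=> n0 H; wlog uv : u v H / v <= u => [W|].
  case: (leqP v u) => [|/ltnW vu]; first exact: W.
  by apply/esym/W => // p pn; rewrite H.
apply/eqP; rewrite eqn_mod_dvd // dvdn_primes //; apply/allP=> p pn.
by rewrite -eqn_mod_dvd // H.
Qed.

Section AffineMult.
Variables (n d : nat).
Hypotheses (n_gt0 : 0 < n) (n8 : ~~ (8 %| n)) (d_gt0 : 0 < d) (dP : affine_mult n d).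

Let A := affA n d.
Let B := affB n d.
Let g := gcdn (d - 1) n.
Let a := affine_slope n d.

Lemma affAB : (A * B)%N = n. Proof. by rewrite mulnC partnC. Qed.
Lemma affAB_coprime : coprime A B. Proof. by rewrite coprime_sym coprime_partC. Qed.

Lemma slopeA : a = 1 %[mod A]. Proof. exact: (chinese_modl affAB_coprime). Qed.
Lemma slopeB : a = d %[mod B]. Proof. exact: (chinese_modr affAB_coprime). Qed.

(** Only p = 2 with d odd needs an argument: g is then even, d^2 = 1 mod 4, and 8 does not divide
    n. *)
Lemma affine_mult_at p : p \in primes n ->
  if p \in mult_pred d then true else d ^ g == 1 %[mod p ^ logn p n].
Proof.
move=> pn; have /orP[d1|//] := allP dP p pn; last by case: ifP.
have pr_p : prime p by move: pn; rewrite mem_primes => /andP[].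
rewrite inE /= d1 andbT; case: ifPn => // evp.
have p2 : p = 2 by have [->|] := even_prime pr_p; [|move=> o; rewrite o in evp].
have le2 : logn 2 n <= 2.
  by rewrite leqNgt; apply: contra n8 => l3; rewrite -[8]/(2 ^ 3) pfactor_dvdn.
rewrite p2 in d1 pn *; have [u Eu] := mod1P d_gt0 (elimT eqP d1).
have : 2 %| g by rewrite dvdn_gcd Eu addKn dvdn_mull //=; move: pn; rewrite mem_primes => /and3P[].
case/dvdnP=> v ->; rewrite mulnC expnM.
have d4 : d ^ 2 = 1 %[mod 2 ^ 2].
  have -> : d ^ 2 = (u + u * u) * 2 ^ 2 + 1 by rewrite Eu; lia.
  by rewrite modnMDl.
have := modn_eqX v d4; rewrite exp1n => E; apply/eqP.
by apply: modn_dvd_eq E; rewrite dvdn_exp2l.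
Qed.

Lemma pfactor_part (pi : nat_pred) p m : prime p -> p \in pi -> 0 < m ->
  logn p m`_pi = logn p m.
Proof.
move=> pr_p ppi m0; apply/eqP; rewrite -(eqn_exp2l _ _ (prime_gt1 pr_p)) -!p_part partn_part //.
by move=> q; rewrite inE => /eqP ->.
Qed.

Lemma logn_partA p : p \in primes n -> p \notin mult_pred d -> logn p A = logn p n.
Proof.
move=> pn pd; apply: pfactor_part => //.
by move: pn; rewrite mem_primes => /andP[].
Qed.

Lemma modA_primes u v : (forall p, p \in primes n -> p \notin mult_pred d ->
  u = v %[mod p ^ logn p n]) -> u = v %[mod A].
Proof.
move=> H; apply: modn_primes; rewrite ?part_gt0 // => p.
rewrite primes_part mem_filter inE /= => /andP[pd pn].
by rewrite logn_partA // H.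
Qed.

Lemma expA : d ^ g = 1 %[mod A].
Proof. by apply: modA_primes => p pn pd; have := affine_mult_at pn; rewrite (negPf pd) => /eqP. Qed.

Lemma slope_data : affine_data n a d.
Proof.
apply/allP=> p pn; have := affine_mult_at pn.
have pr_p : prime p by move: pn; rewrite mem_primes => /andP[].
case: ifPn => [pd _|pd dg].
  have : p ^ logn p n %| B.
    by rewrite pfactor_dvdn ?part_gt0 // pfactor_part.
  move/modn_dvd_eq => /(_ _ _ slopeB) Ea; move: pd; rewrite /affine_at inE /= => /andP[-> ->].
  by rewrite Ea eqxx.
have : p ^ logn p n %| A by rewrite pfactor_dvdn ?part_gt0 // logn_partA.
move/modn_dvd_eq => /(_ _ _ slopeA) Ea; rewrite /affine_at Ea dg eqxx !andbT.
move: pd; rewrite inE /= negb_and; case/orP=> [evp|->]; last by rewrite !orbT.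
by have [->|o] := even_prime pr_p; [rewrite orbT | rewrite o in evp].
Qed.

Lemma modB_prime p : p \in primes B -> d = 1 %[mod p].
Proof. by rewrite primes_part mem_filter inE /= => /andP[/andP[_ /eqP]]. Qed.

Lemma expA_mod i j : i = j %[mod g] -> d ^ i = d ^ j %[mod A].
Proof.
move=> E; wlog ij : i j E / i <= j => [W|].
  by case: (leqP i j) => [|/ltnW ji]; [exact: W | apply/esym/W].
have /dvdnP[k Ek] : g %| j - i by rewrite -eqn_mod_dvd //; apply/eqP.
have Ekg : d ^ (k * g) = 1 %[mod A].
  by rewrite mulnC expnM; have := modn_eqX k expA; rewrite exp1n.
by rewrite -(subnKC ij) Ek expnD -[in LHS](muln1 (d ^ i)); apply/modn_eqM.
Qed.

Let g_dvd : g %| n. Proof. exact: dvdn_gcdr. Qed.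

Lemma d_mod_g : d = 1 %[mod g].
Proof. by apply/eqP; rewrite eqn_mod_dvd // dvdn_gcdl. Qed.

Lemma slope_mod_g : a = 1 %[mod g].
Proof.
have gE : g = gcdn (d - 1) A * gcdn (d - 1) B by rewrite -gcdn_mul_coprime ?affAB // affAB_coprime.
have co : coprime (gcdn (d - 1) A) (gcdn (d - 1) B).
  by rewrite (coprime_dvdl (dvdn_gcdr _ _)) // (coprime_dvdr (dvdn_gcdr _ _)) // affAB_coprime.
apply/eqP; rewrite gE chinese_remainder //; apply/andP; split; apply/eqP.
  by apply: modn_dvd_eq slopeA; apply: dvdn_gcdr.
rewrite (modn_dvd_eq (dvdn_gcdr _ _) slopeB); apply/eqP.
by rewrite eqn_mod_dvd // dvdn_gcdl.
Qed.

Let shiftA i : affine_shift n d i = d ^ i %[mod A].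
Proof. exact: (chinese_modl affAB_coprime). Qed.
Let shiftB i : affine_shift n d i = 1 + (d - 1) * i %[mod B].
Proof. exact: (chinese_modr affAB_coprime). Qed.

Let modAB u v : u = v %[mod A] -> u = v %[mod B] -> u = v %[mod n].
Proof.
move=> EA EB; rewrite -affAB; apply/eqP.
by rewrite chinese_remainder ?affAB_coprime // EA EB !eqxx.
Qed.

Let An : A %| n. Proof. exact: dvdn_part. Qed.
Let Bn : B %| n. Proof. exact: dvdn_part. Qed.

Lemma shift_mod i j : i = j %[mod n] -> affine_shift n d i = affine_shift n d j %[mod n].
Proof.
move=> E; apply: modAB; rewrite ?shiftA ?shiftB.
  by apply: expA_mod; apply: modn_dvd_eq E.
by apply: modn_eqD => //; apply: modn_eqM => //; apply: modn_dvd_eq E.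
Qed.

Lemma shift0 : affine_shift n d 0 = 1 %[mod n].
Proof. by apply: modAB; rewrite ?shiftA ?shiftB // muln0. Qed.

Lemma shift1 : affine_shift n d 1 = d %[mod n].
Proof. by apply: modAB; rewrite ?shiftA ?shiftB // muln1 subnKC. Qed.

(** Where a = 1, [shift_succ] reads c(i + 1) = d c(i) and dictates c(i) = d^i; [shift_mul] then
    needs d^(d i) = d^i, which holds because d^g = 1 and d = 1 mod g. Where a = d, the function 1 +
    (d - 1) i satisfies both identities. *)
Lemma shift_mul i : affine_shift n d (d * i) + a = a * affine_shift n d i + 1 %[mod n].
Proof.
apply: modAB.
  apply: modn_eqD; last exact: slopeA.
  rewrite shiftA -[RHS]modnMml slopeA modnMml mul1n shiftA; apply: expA_mod.
  by rewrite -modnMml d_mod_g modnMml mul1n.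
apply: etrans (modn_eqD (shiftB _) slopeB) _.
apply: etrans (esym (modn_eqD (modn_eqM slopeB (shiftB i)) (erefl _))).
congr (_ %% _); have -> : d = (d - 1).+1 by rewrite subn1 prednK.
by move: (d - 1) => e; rewrite subn1 /=; lia.
Qed.

Lemma shift_succ i : affine_shift n d (a * i + 1) = d * affine_shift n d i %[mod n].
Proof.
apply: modAB.
  rewrite shiftA (modn_eqM (erefl (d %% A)) (shiftA i)) -expnS; apply: expA_mod.
  by rewrite addn1; apply: modn_eqS; rewrite -modnMml slope_mod_g modnMml mul1n.
rewrite shiftB (modn_eqM (erefl (d %% B)) (shiftB i)).
apply: (@etrans _ _ ((1 + (d - 1) * (d * i + 1)) %% B)).
  by apply: modn_eqD => //; apply: modn_eqM => //; apply: modn_eqD => //; apply: modn_eqM => //; apply: slopeB.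
congr (_ %% _); have -> : d = (d - 1).+1 by rewrite subn1 prednK.
by move: (d - 1) => e; rewrite subn1 /=; lia.
Qed.

Lemma coprimeA : coprime d A.
Proof.
have g0 : 0 < g by rewrite gcdn_gt0 n_gt0 orbT.
have : coprime (d ^ g) A by rewrite -coprime_modl expA coprime_modl coprime1n.
by rewrite coprime_pexpl.
Qed.

Lemma coprimeB e : (forall p, p \in primes B -> e = 1 %[mod p]) -> coprime e B.
Proof.
move=> H; apply/negPn/negP => nco.
have B0 : 0 < B := part_gt0 _ _.
have g1: 1 < gcdn e B by rewrite ltn_neqAle eq_sym nco gcdn_gt0 B0 orbT.
have pr_p := pdiv_prime g1; set p := pdiv _ in pr_p.
have pg : p %| gcdn e B := pdiv_dvd _.
have pB : p \in primes B by rewrite mem_primes pr_p B0 (dvdn_trans pg (dvdn_gcdr _ _)).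
have : p %| e := dvdn_trans pg (dvdn_gcdl _ _).
by rewrite /dvdn H // modn_small // prime_gt1.
Qed.

Lemma mult_coprime : coprime d n.
Proof. by rewrite -affAB coprimeMr coprimeA coprimeB // => p /modB_prime. Qed.

Lemma shift_coprime i : coprime (affine_shift n d i) n.
Proof.
suff : coprime (affine_shift n d i) (A * B) by rewrite affAB.
rewrite coprimeMr; apply/andP; split.
  by rewrite -coprime_modl shiftA coprime_modl coprimeXl // coprimeA.
apply: coprimeB => p pB.
have pdB : p %| B by move: pB; rewrite mem_primes => /and3P[].
rewrite (modn_dvd_eq pdB (shiftB i)) -modnDmr (_ : (d - 1) * i %% p = 0) //.
apply/eqP; rewrite -/(dvdn _ _) dvdn_mulr // -eqn_mod_dvd //.
by apply/eqP; apply: modB_prime.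
Qed.

(** For odd p the residue of d modulo p decides which alternative of [affine_at] applies; p = 2
    allows only the second. *)
Lemma slope_unique a' : affine_data n a' d -> a' = a %[mod n].
Proof.
move=> /allP H; have /allP H' := slope_data.
apply: modn_primes => // p pn; move: (H p pn) (H' p pn); rewrite /affine_at -/a.
have [->|odd_p] : p = 2 \/ odd p by apply: even_prime; move: pn; rewrite mem_primes => /andP[].
  by move=> /and3P[_ /eqP -> _] /and3P[_ /eqP -> _].
have -> : (p == 2) = false by apply: contraTF odd_p => /eqP ->.
rewrite odd_p; case: (d == 1 %[mod p]) => /=; first by rewrite !orbF => /eqP -> /eqP ->.
by move=> /andP[/eqP -> _] /andP[/eqP -> _].
Qed.

End AffineMult.

Lemma affine_data_mult n a d : affine_data n a d -> affine_mult n d.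
Proof.
move=> /allP H; apply/allP => p pn; case/orP: (H p pn) => [/and3P[_ -> _] //|/and3P[_ _ ->]].
by rewrite orbT.
Qed.

Lemma affine_mult_mod n d d' : 0 < d -> 0 < d' -> d = d' %[mod n] ->
  affine_mult n d -> affine_mult n d'.
Proof.
move=> d0 d0' E /allP H; apply/allP => p pn; have := H p pn.
have pln : p ^ logn p n %| n := pfactor_dvdnn p n.
have ppl : p %| p ^ logn p n by rewrite dvdn_exp // logn_gt0.
have Ep := modn_dvd_eq pln E.
rewrite (gcdn_sub1_mod d0 d0' E) (modn_dvd_eq ppl Ep).
by rewrite (modn_eqX (gcdn (d' - 1) n) Ep).
Qed.

Lemma affine_data_mod n a d d' : 0 < d -> 0 < d' -> d = d' %[mod n] ->
  affine_data n a d -> affine_data n a d'.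
Proof.
move=> d0 d0' E /allP H; apply/allP => p pn; move: (H p pn).
have pln : p ^ logn p n %| n := pfactor_dvdnn p n.
have ppl : p %| p ^ logn p n by rewrite dvdn_exp // logn_gt0.
rewrite (gcdn_sub1_mod d0 d0' E); apply: affine_at_mono => //.
exact: modn_dvd_eq E.
Qed.

Lemma expn_diff p d d' k : d <= d' -> d = 1 %[mod p] -> d' = 1 %[mod p] ->
  exists2 v, d' ^ k = d ^ k + (d' - d) * v & v = k %[mod p].
Proof.
move=> le d1 d1'; elim: k => [|k [v E Ev]]; first by exists 0; rewrite ?muln0.
exists (d' * v + d ^ k); first by rewrite !expnS E -{1 4}(subnKC le); lia.
rewrite -[k.+1]addn1; apply: modn_eqD; last by rewrite (modn_eqX k d1) exp1n.
by rewrite (modn_eqM d1' Ev) mul1n.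
Qed.

(** C(k, 2) is the derivative at 1 of the polynomial [geo _ k]. *)
Lemma geo_diff p d d' k : d <= d' -> d = 1 %[mod p] -> d' = 1 %[mod p] ->
  exists2 w, geo d' k = geo d k + (d' - d) * w & w = 'C(k, 2) %[mod p].
Proof.
move=> le d1 d1'; elim: k => [|k [w E Ew]]; first by exists 0; rewrite ?muln0 ?geo0.
have [v Ev Evk] := expn_diff k le d1 d1'.
exists (w + v); first by rewrite !geoSr E Ev; lia.
by rewrite binS bin1; apply: modn_eqD.
Qed.

(* geo d' k - geo d k = (d' - d) w with w = k (k - 1) / 2 = 0 mod p. *)
Lemma geo_fixpoint_inj p e k d d' : prime p -> odd p -> k = 1 %[mod p] ->
  d = 1 %[mod p] -> d' = 1 %[mod p] ->
  geo d k = d %[mod p ^ e] -> geo d' k = d' %[mod p ^ e] -> d = d' %[mod p ^ e].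
Proof.
move=> pr_p odd_p k1; wlog le : d d' / d <= d' => [W|] d1 d1' E E'.
  by case: (leqP d d') => [|/ltnW] le; [exact: W | apply/esym/W].
have [w Ew Ewk] := geo_diff k le d1 d1'.
have pw : p %| w.
  rewrite /dvdn Ewk -/(dvdn _ _).
  have co : coprime p 2.
    by rewrite prime_coprime // dvdn_prime2 //; apply: contraTneq odd_p => ->.
  rewrite -(Gauss_dvdr _ co) -mul_bin_diag bin1.
  case: k k1 {E E' Ew Ewk} => // k k1; rewrite dvdn_mull //=.
  by move/eqP: k1; rewrite eqn_mod_dvd // subn1.
have Dw : (d' - d) * w = d' - d %[mod p ^ e].
  apply/eqP; rewrite -(eqn_modDl d) subnKC // -E' Ew; apply/eqP.
  by apply: modn_eqD.
(* Iteration multiplies d' - d by w^e, which is 0 mod p^e. *)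
have Dwt t : (d' - d) * w ^ t = d' - d %[mod p ^ e].
  elim: t => [|t IH]; first by rewrite muln1.
  by rewrite expnS mulnCA mulnC -[LHS]modnMml IH modnMml.
apply/esym/eqP; rewrite eqn_mod_dvd // /dvdn -(Dwt e); apply/eqP.
have /dvdnP[u ->] := pw.
by rewrite expnMn mulnA modnMl.
Qed.

(** The position k is an isomorphism invariant by [affine_rot_iso_shift], so this separates the
    classes. Where a = 1, k itself is d; where a = d, [geo_fixpoint_inj] applies. *)
Lemma affine_data_inj n a d a' d' k : 0 < n -> affine_data n a d -> affine_data n a' d' ->
  geo a k = d %[mod n] -> geo a' k = d' %[mod n] -> d = d' %[mod n].
Proof.
move=> n0 H H' E E'; apply: modn_primes => // p pn.
have pr_p : prime p by move: pn; rewrite mem_primes => /andP[].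
have pln : p ^ logn p n %| n := pfactor_dvdnn p n.
have ppl : p %| p ^ logn p n by rewrite dvdn_exp // logn_gt0.
have {}E := modn_dvd_eq pln E; have {}E' := modn_dvd_eq pln E'.
(* The slope is 1 mod p, so k = d mod p: d and d' fall under the same alternative at p. *)
have modp a1 d1 : affine_data n a1 d1 -> geo a1 k = d1 %[mod p ^ logn p n] -> k = d1 %[mod p].
  move=> /affine_data_full_period/allP/(_ p pn) f1 E1; rewrite -(modn_dvd_eq ppl E1).
  apply/esym/geo_mod1; case/orP: f1 => [/andP[_ /eqP]//|/eqP]; exact: modn_dvd_eq.
have kd := modp _ _ H E; have kd' := modp _ _ H' E'.
move: (allP H p pn) (allP H' p pn); rewrite /affine_at -kd -kd'.
have [p2|odd_p] : p = 2 \/ odd p by apply: even_prime.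
  rewrite p2 in E E' *; move=> /and3P[_ /eqP a1 _] /and3P[_ /eqP a1' _].
  by rewrite -E -E' !geo_mod1.
have -> : (p == 2) = false by apply: contraTF odd_p => /eqP ->.
rewrite odd_p; case: eqP => k1 /=; rewrite ?orbF.
  move=> /eqP ad /eqP ad'; apply: (@geo_fixpoint_inj p _ k) => //; rewrite -?kd -?kd' //.
    by rewrite -(geo_mod k ad).
  by rewrite -(geo_mod k ad').
by move=> /andP[/eqP a1 _] /andP[/eqP a1' _]; rewrite -E -E' !geo_mod1.
Qed.

(** * Rotation systems from affine maps *)

Section AffineRotations.
Import GRing.Theory.
Local Open Scope ring_scope.

Lemma map_isoP n (g R R' : {perm dart n}) :
  reflect ((forall e, g (drev e) = drev (g e)) /\ (forall e, g (R e) = R' (g e))) (map_iso g R R').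
Proof.
apply: (iffP andP) => [[/forallP H1 /forallP H2]|[H1 H2]].
  by split=> e; apply/eqP.
by split; apply/forallP => e; rewrite ?H1 ?H2.
Qed.

Lemma map_iso1 n (R : {perm dart n}) : map_iso 1%g R R.
Proof. by apply/map_isoP; split=> e; rewrite !perm1. Qed.

Lemma map_isoM n (g h R R' R'' : {perm dart n}) :
  map_iso g R R' -> map_iso h R' R'' -> map_iso (g * h)%g R R''.
Proof.
move=> /map_isoP[g1 g2] /map_isoP[h1 h2]; apply/map_isoP; split=> e; rewrite !permM.
  by rewrite g1 h1.
by rewrite g2 h2.
Qed.

Lemma map_isoV n (g R R' : {perm dart n}) : map_iso g R R' -> map_iso g^-1%g R' R.
Proof.
move=> /map_isoP[g1 g2]; apply/map_isoP; split=> e; apply: (@perm_inj _ g).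
  by rewrite g1 !permKV.
by rewrite g2 !permKV.
Qed.

Lemma isomorphic_refl n (R : {perm dart n}) : isomorphic R R.
Proof. by apply/existsP; exists 1%g; apply: map_iso1. Qed.

Lemma isomorphic_sym n (R R' : {perm dart n}) : isomorphic R R' -> isomorphic R' R.
Proof. by case/existsP=> g /map_isoV gi; apply/existsP; exists g^-1%g. Qed.

Lemma isomorphic_trans n (R R' R'' : {perm dart n}) :
  isomorphic R R' -> isomorphic R' R'' -> isomorphic R R''.
Proof.
case/existsP=> g gi /existsP[h hi]; apply/existsP; exists (g * h)%g.
exact: map_isoM gi hi.
Qed.

Lemma map_iso_iter n (g R R' : {perm dart n}) k e : map_iso g R R' ->
  g ((R ^+ k)%g e) = (R' ^+ k)%g (g e).
Proof.
move=> /map_isoP[_ gR]; elim: k => [|k IH]; first by rewrite !expg0 !perm1.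
by rewrite !expgSr !permM gR IH.
Qed.

Section AffineRotation.
Variable m : nat.
Local Notation Z := 'I_m.+2.
Variables (a d : Z) (c : Z -> Z).
Hypotheses (ua : a \is a GRing.unit) (ud : d \is a GRing.unit).
Hypothesis uc : forall i, c i \is a GRing.unit.
(** [c_mul] and [c_succ] say that (i, j) |-> (d i, a j + 1) commutes with the rotation at black and
    at white vertices, respectively. *)
Hypothesis c_mul : forall i, c (d * i) + a = a * c i + 1.
Hypothesis c_succ : forall i, c (a * i + 1) = d * c i.

Definition gsum k : Z := \sum_(i < k) a ^+ i.

Lemma gsumS k : gsum k.+1 = a * gsum k + 1.
Proof.
rewrite /gsum big_ord_recl expr0 addrC mulr_sumr; congr (_ + _).
by apply: eq_bigr => i _; rewrite exprS.
Qed.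

Hypothesis gsum_surj : forall z, exists k, gsum k = z.

Definition affine_rot_fun (e : dart m.+2) : dart m.+2 :=
  if e.2 then ((e.1.1, a * e.1.2 + c e.1.1), e.2) else ((a * e.1.1 + c e.1.2, e.1.2), e.2).

Lemma dart_eqP (i j i' j' : Z) b b' :
  (i, j, b) = (i', j', b') :> dart m.+2 -> [/\ i = i', j = j' & b = b'].
Proof. by move=> E; split; [exact: (congr1 (fun e => e.1.1) E)|exact: (congr1 (fun e => e.1.2) E)|exact: (congr1 snd E)]. Qed.

Lemma affine_rot_inj : injective affine_rot_fun.
Proof.
move=> [[i j] b] [[i' j'] b']; rewrite /affine_rot_fun /=.
case: b; case: b' => //= /dart_eqP[].
  by move=> -> /addIr /(mulrI ua) ->.
by move=> + Ej; rewrite Ej => /addIr /(mulrI ua) ->.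
Qed.

Definition affine_rot : {perm dart m.+2} := perm affine_rot_inj.

Lemma affine_rot_black i j : affine_rot (i, j, true) = (i, a * j + c i, true).
Proof. by rewrite permE. Qed.
Lemma affine_rot_white i j : affine_rot (i, j, false) = (a * i + c j, j, false).
Proof. by rewrite permE. Qed.

Lemma affine_rot_black_iter i k : (affine_rot ^+ k)%g (i, 0, true) = (i, gsum k * c i, true).
Proof.
elim: k => [|k IH]; first by rewrite expg0 perm1 /gsum big_ord0 mul0r.
by rewrite expgSr permM IH affine_rot_black gsumS mulrDl mulrA mul1r.
Qed.

Lemma affine_rot_white_iter j k : (affine_rot ^+ k)%g (0, j, false) = (gsum k * c j, j, false).
Proof.
elim: k => [|k IH]; first by rewrite expg0 perm1 /gsum big_ord0 mul0r.
by rewrite expgSr permM IH affine_rot_white gsumS mulrDl mulrA mul1r.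
Qed.

(** From neighbour 0 the rotation at i reaches gsum k times the unit c(i), hence every neighbour. *)
Lemma affine_rot_embedding : is_embedding affine_rot.
Proof.
have orbB i j : (i, j, true) \in porbit affine_rot (i, 0, true).
  have [k Ek] := gsum_surj (j / c i).
  apply/porbitP; exists k; by rewrite affine_rot_black_iter Ek divrK.
have orbW i j : (i, j, false) \in porbit affine_rot (0, j, false).
  have [k Ek] := gsum_surj (i / c j).
  apply/porbitP; exists k; by rewrite affine_rot_white_iter Ek divrK.
apply/andP; split; apply/forallP => -[[i j] b].
  by rewrite permE /affine_rot_fun /dtail; case: b.
apply/forallP => -[[i' j'] b']; apply/implyP; rewrite /dtail /= => /eqP[<- {b'}].
case: b => <- {}.
  by rewrite -eq_porbit_mem; apply/eqP; rewrite (eqP (etrans (eq_porbit_mem _ _ _) (orbB i j)))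
   (eqP (etrans (eq_porbit_mem _ _ _) (orbB i j'))).
by rewrite -eq_porbit_mem; apply/eqP; rewrite (eqP (etrans (eq_porbit_mem _ _ _) (orbW i j)))
   (eqP (etrans (eq_porbit_mem _ _ _) (orbW i' j))).
Qed.

Lemma rot_aut_inj : injective (fun e : dart m.+2 => (d * e.1.1, a * e.1.2 + 1, e.2) : dart m.+2).
Proof.
by move=> [[i j] b] [[i' j'] b'] /dart_eqP[] /= /(mulrI ud) -> /addIr /(mulrI ua) -> ->.
Qed.

Lemma rot_aut'_inj : injective (fun e : dart m.+2 => (a * e.1.1 + 1, d * e.1.2, e.2) : dart m.+2).
Proof.
by move=> [[i j] b] [[i' j'] b'] /dart_eqP[] /= /addIr /(mulrI ua) -> /(mulrI ud) -> ->.
Qed.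

Lemma dart_swap_inj : injective (fun e : dart m.+2 => (e.1.2, e.1.1, ~~ e.2) : dart m.+2).
Proof. by move=> [[i j] b] [[i' j'] b'] /dart_eqP[] /= -> -> /negb_inj ->. Qed.

Let X := perm rot_aut_inj.
Let Y := perm rot_aut'_inj.
Let T := perm dart_swap_inj.

Lemma rot_aut_iso : map_iso X affine_rot affine_rot.
Proof.
apply/map_isoP; split=> -[[i j] b]; rewrite !permE //=.
rewrite /affine_rot_fun /=; case: b => /=; congr (_, _, _).
  have -> : c (d * i) = a * c i + 1 - a by rewrite -c_mul addrK.
  by ring.
by rewrite c_succ; ring.
Qed.

Lemma rot_aut'_iso : map_iso Y affine_rot affine_rot.
Proof.
apply/map_isoP; split=> -[[i j] b]; rewrite !permE //=.
rewrite /affine_rot_fun /=; case: b => /=; congr (_, _, _).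
  by rewrite c_succ; ring.
have -> : c (d * j) = a * c j + 1 - a by rewrite -c_mul addrK.
by ring.
Qed.

Lemma dart_swap_iso : map_iso T affine_rot affine_rot.
Proof.
apply/map_isoP; split=> -[[i j] b]; rewrite !permE //=.
by rewrite /affine_rot_fun /=; case: b.
Qed.

Lemma affine_rot_regular : is_regular affine_rot.
Proof.
have Xk i j b k : (X ^+ k)%g (i, j, b) = (d ^+ k * i, a ^+ k * j + gsum k, b).
  elim: k => [|k IH]; first by rewrite expg0 perm1 /gsum big_ord0 !mul1r addr0.
  by rewrite expgSr permM IH permE /= gsumS !exprS mulrDr !mulrA addrA.
have Yk i j b k : (Y ^+ k)%g (i, j, b) = (a ^+ k * i + gsum k, d ^+ k * j, b).
  elim: k => [|k IH]; first by rewrite expg0 perm1 /gsum big_ord0 !mul1r addr0.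
  by rewrite expgSr permM IH permE /= gsumS !exprS mulrDr !mulrA addrA.
have isoX k g : map_iso g affine_rot affine_rot -> map_iso (g ^+ k)%g affine_rot affine_rot.
  move=> gi; elim: k => [|k IH]; first exact: map_iso1.
  by rewrite expgS; apply: map_isoM IH.
have base i j : exists2 g, map_iso g affine_rot affine_rot & g (0, 0, true) = (i, j, true).
  have [k Ek] := gsum_surj i; have [l El] := gsum_surj (j / d ^+ k).
  (* X^l takes (0, 0) to (0, gsum l), and Y^k takes this to (gsum k, d^k gsum l). *)
  exists (X ^+ l * Y ^+ k)%g.
    by apply: map_isoM; apply: isoX; [apply: rot_aut_iso | apply: rot_aut'_iso].
  by rewrite permM Xk !mulr0 add0r Yk mulr0 add0r Ek El mulrC divrK ?unitrX.
have trans e : exists2 g, map_iso g affine_rot affine_rot & g (0, 0, true) = e.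
  case: e => [[i j] []]; first exact: base.
  have [g gi Eg] := base j i; exists (g * T)%g; first exact: map_isoM gi dart_swap_iso.
  by rewrite permM Eg permE.
apply/forallP=> e; apply/forallP=> e'; apply/existsP.
have [g gi Eg] := trans e; have [h hi Eh] := trans e'.
exists (g^-1 * h)%g; rewrite (map_isoM (map_isoV gi) hi) /=.
by rewrite permM -Eg permK Eh.
Qed.
End AffineRotation.

Lemma embedding_tail n (R : {perm dart n}) e e' : is_embedding R ->
  (dtail e == dtail e') = (e' \in porbit R e).
Proof.
case/andP=> /forallP H1 /forallP H2; apply/idP/idP => [E|/porbitP[k ->]].
  exact: (implyP (forallP (H2 e) e')).
elim: k => [|k IH]; first by rewrite expg0 perm1.
by rewrite expgSr permM (eqP (H1 _)).
Qed.

Lemma map_iso_tail n (g R R' : {perm dart n}) e e' :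
  is_embedding R -> is_embedding R' -> map_iso g R R' ->
  dtail e = dtail e' -> dtail (g e) = dtail (g e').
Proof.
move=> eR eR' gi /eqP; rewrite (embedding_tail _ _ eR) => /porbitP[k ->].
apply/eqP; rewrite (embedding_tail _ _ eR'); apply/porbitP; exists k.
exact: map_iso_iter gi.
Qed.

(** By regularity the isomorphism may fix the base dart. It then sends gsum a k to gsum a' k among
    the neighbours of both ends, in particular 1 to 1. The rotation at black vertex 1 takes white 0
    to white c(1), so the position k of c(1) around black vertex 0 is preserved. *)
Lemma affine_rot_iso_shift m (a a' : 'I_m.+2) (c c' : 'I_m.+2 -> 'I_m.+2)
    (ua : a \is a GRing.unit) (ua' : a' \is a GRing.unit) :
  c 0 = 1 -> c' 0 = 1 -> (forall z, exists k, gsum a k = z) ->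
  is_embedding (affine_rot c ua) -> is_embedding (affine_rot c' ua') ->
  is_regular (affine_rot c' ua') ->
  isomorphic (affine_rot c ua) (affine_rot c' ua') ->
  exists k, gsum a k = c 1 /\ gsum a' k = c' 1.
Proof.
move=> c0 c0' surj; set R := affine_rot c ua; set R' := affine_rot c' ua' => eR eR' regR'.
case/existsP=> h hi.
have /existsP[h' /andP[h'i /eqP h'0]] := forallP (forallP regR' (h (0, 0, true))) (0, 0, true).
pose g := (h * h')%g; have gi : map_iso g R R' := map_isoM hi h'i.
have g0 : g (0, 0, true) = (0, 0, true) by rewrite permM.
have [grev gR] := map_isoP _ _ _ gi.
have grevE i j i' j' b : g (i, j, b) = (i', j', b) -> g (i, j, ~~ b) = (i', j', ~~ b).
  by move=> E; have := grev (i, j, b); rewrite E.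
have gB k : g (0, gsum a k, true) = (0, gsum a' k, true).
  have := map_iso_iter k (0, 0, true) gi.
  by rewrite g0 !affine_rot_black_iter c0 c0' !mulr1.
have gW k : g (gsum a k, 0, false) = (gsum a' k, 0, false).
  have := map_iso_iter k (0, 0, false) gi.
  by rewrite (grevE _ _ _ _ _ g0) !affine_rot_white_iter c0 c0' !mulr1.
have gsum1 (b : 'I_m.+2) : gsum b 1 = 1 by rewrite /gsum big_ord1 expr0.
have := grevE _ _ _ _ _ (gW 1%N); rewrite !gsum1 /= => g10.
have := gR (1, 0, true); rewrite g10 !affine_rot_black !mulr0 !add0r => /grevE /= g1c.
have [k Ek] := surj (c 1); exists k; split=> //.
have := grevE _ _ _ _ _ (gB k); rewrite Ek /= => g0c.
have := @map_iso_tail _ g R R' (1, c 1, false) (0, c 1, false) eR eR' gi erefl.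
by rewrite g1c g0c /dtail /=; move/(congr1 snd) => /= ->.
Qed.

Lemma natZp_eq m k l : (k%:R == l%:R :> 'I_m.+2) = (k == l %[mod m.+2]).
Proof. by rewrite !Zp_nat -val_eqE. Qed.

Lemma natZp_valE m (z : 'I_m.+2) : (val z)%:R = z.
Proof. by rewrite Zp_nat valZpK. Qed.

Lemma natZp_unit m k : coprime k m.+2 -> (k%:R : 'I_m.+2) \is a GRing.unit.
Proof. by move=> co; rewrite (@unitZpE m.+2) // coprime_sym. Qed.

Lemma gsum_geo m a k : gsum (a%:R : 'I_m.+2) k = (geo a k)%:R.
Proof. by rewrite /gsum /geo natr_sum; apply: eq_bigr => i _; rewrite natrX. Qed.

Lemma gsum_geo_surj m a (z : 'I_m.+2) : full_period m.+2 a -> exists k, gsum a%:R k = z.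
Proof.
move=> fa; have [k _ E] := geo_surj z (ltn0Sn _) fa; exists k.
by rewrite gsum_geo -[RHS]natZp_valE; apply/eqP; rewrite natZp_eq E.
Qed.

Lemma affine_mult_gt0 n d : (1 < n)%N -> affine_mult n d -> (0 < d)%N.
Proof.
move=> n1 /allP H; case: d H => // H; have pr_p := pdiv_prime n1.
have pn : pdiv n \in primes n by rewrite mem_primes pr_p pdiv_dvd (ltnW n1).
have p1 := prime_gt1 pr_p.
have := H _ pn; rewrite gcd0n exp0n ?(ltnW n1) // !mod0n !modn_small //.
by rewrite -{1}(expn0 (pdiv n)) ltn_exp2l // logn_gt0.
Qed.

Section MultRot.
Variable m : nat.
Local Notation n := (m.+2).
Hypothesis n8 : ~~ (8 %| n)%N.

Definition slopeZ (d : 'I_n) : 'I_n := (affine_slope n d)%:R.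
Definition shiftZ (d : 'I_n) (i : 'I_n) : 'I_n := (affine_shift n d i)%:R.

(** The case distinction supplies the unit proof that [affine_rot] requires; [slopeZ_unit] provides
    it for every multiplier. *)
Definition mult_rot (d : 'I_n) : {perm dart n} :=
  if (slopeZ d \is a GRing.unit) =P true is ReflectT ua then affine_rot (shiftZ d) ua else 1%g.

Variable d : 'I_n.
Hypothesis dP : affine_mult n d.

Let d0 : (0 < d)%N. Proof. exact: affine_mult_gt0 dP. Qed.
Let n0 : (0 < n)%N. Proof. by []. Qed.
Let dat : affine_data n (affine_slope n d) d. Proof. exact: slope_data. Qed.
Let fp : full_period n (affine_slope n d) := affine_data_full_period dat.

Lemma slopeZ_unit : slopeZ d \is a GRing.unit.
Proof. by apply: natZp_unit; apply: full_period_coprime. Qed.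

Lemma mult_rotE : exists ua, mult_rot d = affine_rot (a := slopeZ d) (shiftZ d) ua.
Proof. by rewrite /mult_rot; case: eqP => [ua|[]]; [exists ua | exact: slopeZ_unit]. Qed.

Lemma multZ_unit : d \is a GRing.unit.
Proof. by rewrite -[d]natZp_valE; apply: natZp_unit; apply: (mult_coprime n0 n8 d0 dP). Qed.

Lemma shiftZ_unit i : shiftZ d i \is a GRing.unit.
Proof. by apply: natZp_unit; apply: (shift_coprime n0 n8 d0 dP). Qed.

Lemma shiftZ_nat i : shiftZ d i%:R = (affine_shift n d i)%:R.
Proof.
apply/eqP; rewrite natZp_eq; apply/eqP; apply: (shift_mod n0 n8 d0 dP).
by rewrite Zp_nat /= modn_mod.
Qed.

Lemma shiftZ0 : shiftZ d 0 = 1.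
Proof. by apply/eqP; rewrite -[1]/(1%:R) natZp_eq; apply/eqP; apply: shift0. Qed.

Lemma shiftZ1 : shiftZ d 1 = d.
Proof.
by rewrite -{2}[d]natZp_valE; apply/eqP; rewrite natZp_eq; apply/eqP; apply: shift1.
Qed.

Lemma shiftZ_mul i : shiftZ d (d * i) + slopeZ d = slopeZ d * shiftZ d i + 1.
Proof.
rewrite -{1}[i]natZp_valE -{2}[d]natZp_valE -natrM shiftZ_nat -natrM -natrD -[X in _ + X]/(1%:R) -natrD.
by apply/eqP; rewrite natZp_eq; apply/eqP; apply: (shift_mul n0 n8 d0 dP).
Qed.

Lemma shiftZ_succ i : shiftZ d (slopeZ d * i + 1) = d * shiftZ d i.
Proof.
rewrite -{1}[i]natZp_valE -{3}[d]natZp_valE -[X in _ + X]/(1%:R) -!natrM -natrD shiftZ_nat.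
by apply/eqP; rewrite natZp_eq; apply/eqP; apply: (shift_succ n0 n8 d0 dP).
Qed.

Lemma slopeZ_surj z : exists k, gsum (slopeZ d) k = z.
Proof. exact: gsum_geo_surj fp. Qed.

Lemma mult_rot_reg : mult_rot d \in reg_embeddings n.
Proof.
have [ua ->] := mult_rotE; rewrite inE; apply/andP; split.
  exact: affine_rot_embedding shiftZ_unit slopeZ_surj.
exact: affine_rot_regular multZ_unit shiftZ_mul shiftZ_succ slopeZ_surj.
Qed.
End MultRot.

Lemma mult_rot_inj m (d d' : 'I_m.+2) : ~~ (8 %| m.+2)%N ->
  affine_mult m.+2 d -> affine_mult m.+2 d' ->
  isomorphic (mult_rot d) (mult_rot d') -> d = d'.
Proof.
move=> n8 dP dP'; have := mult_rot_reg n8 dP'; have := mult_rot_reg n8 dP.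
have [ua ->] := mult_rotE n8 dP; have [ua' ->] := mult_rotE n8 dP'.
rewrite !inE => /andP[e1 _] /andP[e2 r2].
move=> /(affine_rot_iso_shift (shiftZ0 d) (shiftZ0 d') (slopeZ_surj n8 dP) e1 e2 r2).
case=> k []; rewrite !shiftZ1 // !gsum_geo.
rewrite -{2}[d]natZp_valE -{2}[d']natZp_valE => /eqP + /eqP; rewrite !natZp_eq => /eqP E /eqP E'.
have d0 := affine_mult_gt0 (isT : (1 < m.+2)%N) dP.
have d0' := affine_mult_gt0 (isT : (1 < m.+2)%N) dP'.
have E2 := affine_data_inj (ltn0Sn _) (slope_data (ltn0Sn _) n8 d0 dP) (slope_data (ltn0Sn _) n8 d0' dP') E E'.
by apply: ord_inj; rewrite -(modn_small (ltn_ord d)) E2 modn_small.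
Qed.

End AffineRotations.

(** * Classification of the regular embeddings *)

Section RegularAutomorphisms.
Import GroupScope.

(** Connectedness of K_{n,n}: two edges are linked by moving first the white end, then the black
    one. *)
Lemma dart_connected n (P : dart n -> Prop) :
  (forall e e', dtail e = dtail e' -> P e -> P e') -> (forall e, P e -> P (drev e)) ->
  forall e e', P e -> P e'.
Proof.
move=> Pt Pr.
have step i j i' j' : P (i, j, true) -> P (i', j', true).
  move=> H; have H1 : P (i, j', true) by apply: Pt H.
  have H2 : P (i', j', false) by apply: (Pt (i, j', false)) => //; apply: (Pr _ H1).
  exact: (Pr _ H2).
move=> [[i j] b] [[i' j'] b'] H.
have Ht : P (i, j, true) by case: b H => // /Pr.
by have := step _ _ i' j' Ht; case: b' => // /Pr.
Qed.

Section RegularEmbedding.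
Variables (m : nat) (R : {perm dart m.+1}).
Local Notation n := (m.+1).
Hypotheses (eR : is_embedding R) (rR : is_regular R).

Let d0 : dart n := (ord0, ord0, true).
Let d1 : dart n := (ord0, ord0, false).

Lemma aut_free g e : map_iso g R R -> g e = e -> g = 1.
Proof.
move=> gi ge; apply/permP=> e'; rewrite perm1.
move: e e' ge; apply: dart_connected => [e e' /eqP|e ge]; last first.
  by have /map_isoP[-> _] := gi; rewrite ge.
rewrite (embedding_tail _ _ eR) => /porbitP[k ->] ge.
by rewrite (map_iso_iter k e gi) ge.
Qed.

Lemma aut_ex e e' : exists2 g, map_iso g R R & g e = e'.
Proof.
by have /existsP[g /andP[gi /eqP E]] := forallP (forallP rR e) e'; exists g.
Qed.

Lemma aut_eq g h e : map_iso g R R -> map_iso h R R -> g e = h e -> g = h.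
Proof.
move=> gi hi E; apply/eqP; rewrite eq_mulgV1; apply/eqP.
apply: (@aut_free _ e); first exact: map_isoM gi (map_isoV hi).
by rewrite permM E permK.
Qed.

Lemma aut_colour g e : map_iso g R R -> (g d0).2 -> (g e).2 = e.2.
Proof.
move=> gi g0; apply/eqP.
suff H e1 e2 : (g e1).2 == e1.2 -> (g e2).2 == e2.2 by apply: (H d0); rewrite g0.
move: e1 e2; apply: dart_connected => [e1 e2 E|e1].
  have [E1 _] : (e1.2 = e2.2) /\ True by split=> //; exact: (congr1 fst E).
  have := congr1 fst (map_iso_tail eR eR gi E); rewrite /dtail /= => ->.
  by rewrite E1.
by have /map_isoP[-> _] := gi; rewrite /drev /= => /eqP ->.
Qed.

(** By connectedness an automorphism keeps or exchanges all colours at once, so the base dart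
    decides. *)
Definition colour_auts := [set g : {perm dart n} | map_iso g R R && (g d0).2].

Lemma colour_autsP g : reflect (map_iso g R R /\ (g d0).2) (g \in colour_auts).
Proof. by rewrite inE; apply: andP. Qed.

Lemma colour_auts_group_set : group_set colour_auts.
Proof.
apply/group_setP; split=> [|g h /colour_autsP[gi g0] /colour_autsP[hi h0]].
  by apply/colour_autsP; rewrite perm1; split; [apply: map_iso1|].
apply/colour_autsP; split; first exact: map_isoM gi hi.
by rewrite permM (aut_colour _ hi h0).
Qed.
Canonical colour_auts_group := Group colour_auts_group_set.

Lemma colour_auts_colour g e : g \in colour_auts -> (g e).2 = e.2.
Proof. by case/colour_autsP => gi; apply: aut_colour. Qed.

Lemma colour_auts_in g e : map_iso g R R -> (g e).2 = e.2 -> g \in colour_auts.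
Proof.
move=> gi ge.
apply/colour_autsP; split=> //; apply/negPn/negP => g0.
suff H e1 e2 : (g e1).2 == ~~ e1.2 -> (g e2).2 == ~~ e2.2.
  by have := H d0 e; rewrite (negPf g0) ge => /(_ isT); case: (e.2).
move: e1 e2; apply: dart_connected => [e1 e2 E|e1].
  have [E1 _] : (e1.2 = e2.2) /\ True by split=> //; exact: (congr1 fst E).
  have := congr1 fst (map_iso_tail eR eR gi E); rewrite /dtail /= => ->.
  by rewrite E1.
by have /map_isoP[-> _] := gi; rewrite /drev /= => /eqP ->.
Qed.

Lemma card_colour_auts : #|colour_auts| = (n * n)%N.
Proof.
have inj : {in colour_auts &, injective (fun g : {perm dart n} => (g d0).1)}.
  move=> g h gG hG E; have /colour_autsP[gi g0] := gG; have /colour_autsP[hi h0] := hG.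
  apply: (@aut_eq g h d0) => //; move: E g0 h0.
  by case: (g d0) => p b; case: (h d0) => p' b' /= -> -> ->.
rewrite -(card_in_imset inj) (_ : [set _ | _ in _] = [set: 'I_n * 'I_n]).
  by rewrite cardsT card_prod card_ord.
apply/setP=> p; rewrite inE; apply/imsetP.
have [g gi Eg] := aut_ex d0 (p, true); exists g; last by rewrite Eg.
by apply/colour_autsP; rewrite Eg.
Qed.

Lemma aut_rot_iter x e k : map_iso x R R -> x e = R e -> (x ^+ k) e = (R ^+ k) e.
Proof.
move=> xi xe; elim: k => [|k IH]; first by rewrite !expg0 !perm1.
by rewrite expgSr expgS !permM IH (map_iso_iter k e xi) xe.
Qed.

(** The powers of x carry e once through the n darts at its tail, and the image of e determines an
    automorphism. *)
Lemma order_rot_aut x e : map_iso x R R -> x e = R e -> #[x] = n.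
Proof.
move=> xi xe; rewrite orderE.
have xXi k : map_iso (x ^+ k) R R.
  by elim: k => [|k IH]; [apply: map_iso1 | rewrite expgS; apply: map_isoM xi IH].
have inj : {in <[x]> &, injective (fun g : {perm dart n} => g e)}.
  by move=> _ _ /cycleP[i ->] /cycleP[j ->] E; apply: (@aut_eq _ _ e).
rewrite -(card_in_imset inj).
have -> : [set (fun g : {perm dart n} => g e) g | g in <[x]>] = [set e' | dtail e' == dtail e].
  apply/setP=> e'; rewrite inE eq_sym (embedding_tail _ _ eR); apply/imsetP/porbitP.
    by case=> _ /cycleP[k ->] ->; exists k; rewrite aut_rot_iter.
  by case=> k ->; exists (x ^+ k); rewrite ?mem_cycle // aut_rot_iter.
have inj' : injective (fun j : 'I_n => (if e.2 then (e.1.1, j, true) else (j, e.1.2, false)) : dart n).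
  move=> j j'; case: (e.2) => E; first exact: (congr1 (fun u : dart n => u.1.2) E).
  exact: (congr1 (fun u : dart n => u.1.1) E).
rewrite -[RHS]card_ord -(card_imset _ inj'); apply: eq_card => -[[i' j'] b'].
case: e {inj inj' xe} => [[i j] b]; rewrite inE /dtail /=; apply/eqP/imsetP; last first.
  by case=> k _ E; have := congr1 (@dtail n) E; rewrite {1}/dtail /= => ->; case: (b).
by case=> ->; case: b => /= ->; [exists j' | exists i'].
Qed.

(** x and y turn the map about the black and the white end of the base edge, and t reverses that
    edge, so conjugation by t is the swap. An element of [<x>] and [<y>] fixes both ends, hence the
    edge, since the graph is simple. *)
Lemma regular_isobicyclic : exists x y t : {perm dart n},
  [/\ map_iso x R R, map_iso y R R, map_iso t R R, x d0 = R d0 & y d1 = R d1] /\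
  [/\ isobicyclic colour_auts_group x y n, x ^ t = y, y ^ t = x & t d0 = d1].
Proof.
have [x xi xE] := aut_ex d0 (R d0); have [y yi yE] := aut_ex d1 (R d1).
have [t ti tE] := aut_ex d0 d1; exists x, y, t.
have tE' : t d1 = d0.
  by have /map_isoP[tr _] := ti; have := tr d0; rewrite tE.
have tR e : t (R e) = R (t e) by have /map_isoP[_ ->] := ti.
have ti' := map_isoV ti.
have tVE : t^-1 d1 = d0 by rewrite -tE permK.
have tVE' : t^-1 d0 = d1 by rewrite -tE' permK.
have cji g : map_iso g R R -> map_iso (g ^ t) R R.
  by move=> gi; rewrite conjgE; apply: map_isoM ti' (map_isoM gi ti).
have xt : x ^ t = y.
  by apply: (@aut_eq _ _ d1) => //; [exact: cji | rewrite conjgE !permM tVE xE tR tE yE].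
have yt : y ^ t = x.
  by apply: (@aut_eq _ _ d0) => //; [exact: cji | rewrite conjgE !permM tVE' yE tR tE' xE].
have Rtail e : dtail (R e) = dtail e.
  by case/andP: eR => /forallP H _; apply/eqP.
have R2 e : (R e).2 = e.2 by exact: (congr1 fst (Rtail e)).
have xG : x \in colour_auts by apply: (@colour_auts_in x d0) => //; rewrite xE R2.
have yG : y \in colour_auts by apply: (@colour_auts_in y d1) => //; rewrite yE R2.
have ox := order_rot_aut xi xE; have oy := order_rot_aut yi yE.
have ti1 : <[x]> :&: <[y]> = 1.
  apply/trivgP/subsetP=> g /setIP[/cycleP[i gx] /cycleP[j gy]].
  have gG : g \in colour_auts_group by rewrite gx groupX.
  have /colour_autsP[gi _] := gG.
  have tX k : dtail ((R ^+ k) d0) = dtail d0.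
    by apply/esym/eqP; rewrite (embedding_tail _ _ eR) mem_porbit.
  have tY k : dtail ((R ^+ k) d1) = dtail d1.
    by apply/esym/eqP; rewrite (embedding_tail _ _ eR) mem_porbit.
  have g0 : dtail (g d0) = dtail d0 by rewrite gx aut_rot_iter.
  have g1 : dtail (g d1) = dtail d1 by rewrite gy aut_rot_iter.
  have gr : g d1 = drev (g d0) by have /map_isoP[<- _] := gi.
  rewrite inE; apply/eqP/(@aut_free g d0) => //.
  move: g1 g0; rewrite gr; case: (g d0) => [[i' j'] b'] /=.
  by rewrite /dtail /=; case: b' => //= -[-> ] [->].
have GE : <[x]> * <[y]> = colour_auts_group.
  apply/eqP; rewrite eqEcard mul_subG ?cycle_subG //= card_colour_auts.
  by have := mul_cardG <[x]> <[y]>; rewrite ti1 cards1 muln1 -!orderE ox oy => <-.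
split=> //; split=> //; split=> //.
by exists (conjgm_morphism colour_auts_group t); split; rewrite /= conjgmE.
Qed.
End RegularEmbedding.

End RegularAutomorphisms.

Section Classification.
Import GRing.Theory.
Local Open Scope ring_scope.

Section Classify.
Variables (m : nat) (R : {perm dart m.+2}).
Local Notation n := (m.+2).
Hypotheses (eR : is_embedding R) (rR : is_regular R).

Local Notation G := (colour_auts_group eR).
Let d0 : dart n := (0, 0, true).
Let d1 : dart n := (0, 0, false).

Variables (x y t : {perm dart n}).
Hypotheses (xi : map_iso x R R) (yi : map_iso y R R) (xE : x d0 = R d0) (yE : y d1 = R d1).
Hypotheses (isoG : isobicyclic G x y n) (xt : (x ^ t)%g = y) (yt : (y ^ t)%g = x).
Variables (A D : 'I_n) (c : 'I_n -> 'I_n).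
Hypotheses (uA : A \is a GRing.unit) (c0 : c 0 = 1).
Hypotheses (c_mul : forall i, c (D * i) + A = A * c i + 1).
Hypothesis c_succ : forall i, c (A * i + 1) = D * c i.
Hypothesis gsum_surj : forall z, exists k, gsum A k = z.
Hypothesis gsum_eq : forall k l, gsum A k = gsum A l <-> k = l %[mod n].
Hypothesis act : forall i, exists j i', (x ^+ i * y)%g = (y ^+ j * x ^+ i')%g /\ gsum A i' = D * gsum A i.

Let act' i : exists j i', (y ^+ i * x)%g = (x ^+ j * y ^+ i')%g /\ gsum A i' = D * gsum A i.
Proof.
have [j [i' [E Ei]]] := act i; exists j, i'; split=> //.
by have := congr1 (conjg^~ t) E; rewrite !conjMg !conjXg xt yt.
Qed.

Let xG : x \in G. Proof. by case: (isob_mem isoG). Qed.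
Let yG : y \in G. Proof. by case: (isob_mem isoG). Qed.

Let w (g : {perm dart n}) := (g d1).1.2.
Let b (g : {perm dart n}) := (g d0).1.1.

Let iG g : g \in G -> map_iso g R R. Proof. by case/colour_autsP. Qed.

Let gd0 g : g \in G -> g d0 = (b g, w g, true).
Proof.
move=> gG; have g2 := colour_auts_colour eR d0 gG; have /map_isoP[gr _] := iG gG.
have := gr d0; rewrite /w /b -[drev d0]/d1 => ->; move: g2.
by case: (g d0) => [[i j] b'] /= ->.
Qed.

Let gd1 g : g \in G -> g d1 = (b g, w g, false).
Proof.
by move=> gG; have /map_isoP[gr _] := iG gG; have := gr d0; rewrite gd0.
Qed.

Let w_cong u v g : u \in G -> v \in G -> g \in G -> w u = w v -> w (u * g)%g = w (v * g)%g.
Proof.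
move=> uG vG gG E; have := @map_iso_tail _ g R R (u d1) (v d1) eR eR (iG gG).
by rewrite -!permM !gd1 ?groupM // /dtail /= E => /(_ erefl) /(congr1 snd).
Qed.

Let b_cong u v g : u \in G -> v \in G -> g \in G -> b u = b v -> b (u * g)%g = b (v * g)%g.
Proof.
move=> uG vG gG E; have := @map_iso_tail _ g R R (u d0) (v d0) eR eR (iG gG).
by rewrite -!permM !gd0 ?groupM // /dtail /= E => /(_ erefl) /(congr1 snd).
Qed.

Let w_y j g : g \in G -> w (y ^+ j * g)%g = w g.
Proof.
move=> gG; rewrite -[in RHS](mul1g g); apply: w_cong; rewrite ?groupX ?group1 //.
have : dtail ((y ^+ j)%g d1) = dtail d1.
  by rewrite (@aut_rot_iter _ R _ d1 j yi yE); apply/esym/eqP; rewrite (embedding_tail _ _ eR) mem_porbit.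
by rewrite gd1 ?groupX // /dtail /w /= perm1 => -[].
Qed.

Let b_x j g : g \in G -> b (x ^+ j * g)%g = b g.
Proof.
move=> gG; rewrite -[in RHS](mul1g g); apply: b_cong; rewrite ?groupX ?group1 //.
have : dtail ((x ^+ j)%g d0) = dtail d0.
  by rewrite (@aut_rot_iter _ R _ d0 j xi xE); apply/esym/eqP; rewrite (embedding_tail _ _ eR) mem_porbit.
by rewrite gd0 ?groupX // /dtail /b /= perm1 => -[].
Qed.

Let w_inj i j : w (x ^+ i)%g = w (x ^+ j)%g -> gsum A i = gsum A j.
Proof.
move=> E; have [_ ox _ tixy _] := isoG.
have : dtail ((x ^+ i)%g d1) == dtail ((x ^+ j)%g d1).
  by rewrite !gd1 ?groupX // /dtail /= E.
rewrite (embedding_tail _ _ eR) => /porbitP[s].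
rewrite -(map_iso_iter s d1 (iG (groupX i xG))) -(@aut_rot_iter _ R _ d1 s yi yE) -permM => Es.
have /(canRL (mulgK _)) ys : (y ^+ s * x ^+ i)%g = (x ^+ j)%g.
  by apply: (@aut_eq _ _ eR _ _ d1) => //; apply: iG; rewrite ?groupM ?groupX.
have ys1 : (y ^+ s)%g = 1%g.
  apply/set1gP; rewrite -tixy inE mem_cycle andbT ys.
  by rewrite groupM ?groupV ?mem_cycle.
apply/gsum_eq; apply/eqP; rewrite -ox -eq_expg_mod_order.
by rewrite eq_sym eq_mulgV1 -ys ys1.
Qed.

Let b_inj i j : b (y ^+ i)%g = b (y ^+ j)%g -> gsum A i = gsum A j.
Proof.
move=> E; have [_ _ oy tixy _] := isoG.
have : dtail ((y ^+ i)%g d0) == dtail ((y ^+ j)%g d0).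
  by rewrite !gd0 ?groupX // /dtail /= E.
rewrite (embedding_tail _ _ eR) => /porbitP[s].
rewrite -(map_iso_iter s d0 (iG (groupX i yG))) -(@aut_rot_iter _ R _ d0 s xi xE) -permM => Es.
have /(canRL (mulgK _)) xs : (x ^+ s * y ^+ i)%g = (y ^+ j)%g.
  by apply: (@aut_eq _ _ eR _ _ d0) => //; apply: iG; rewrite ?groupM ?groupX.
have xs1 : (x ^+ s)%g = 1%g.
  apply/set1gP; rewrite -tixy inE mem_cycle /= xs.
  by rewrite groupM ?groupV ?mem_cycle.
apply/gsum_eq; apply/eqP; rewrite -oy -eq_expg_mod_order.
by rewrite eq_sym eq_mulgV1 -xs xs1.
Qed.

Let orderE_x k l : k = l %[mod n] -> (x ^+ k)%g = (x ^+ l)%g.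
Proof.
by move=> E; have [_ ox _ _ _] := isoG; apply/eqP; rewrite eq_expg_mod_order ox E.
Qed.

Let orderE_y k l : k = l %[mod n] -> (y ^+ k)%g = (y ^+ l)%g.
Proof.
by move=> E; have [_ _ oy _ _] := isoG; apply/eqP; rewrite eq_expg_mod_order oy E.
Qed.

(** White vertices correspond to cosets of [<y>] and black ones to cosets of [<x>]; labelling both
    by [gsum] gives the isomorphism. *)
Lemma regular_iso_affine_rot : isomorphic (affine_rot c uA) R.
Proof.
have [kz kzE] : exists kz : 'I_n -> nat, forall z, gsum A (kz z) = z.
  exact: (@fin_all_exists 'I_n (fun=> nat) (fun z k => gsum A k = z)).
pose wl z := w (x ^+ kz z)%g; pose bl z := b (y ^+ kz z)%g.
have wlE k : w (x ^+ k)%g = wl (gsum A k).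
  by congr w; apply: orderE_x; apply/gsum_eq; rewrite kzE.
have blE k : b (y ^+ k)%g = bl (gsum A k).
  by congr b; apply: orderE_y; apply/gsum_eq; rewrite kzE.
have wl_inj : injective wl by move=> z z' /w_inj; rewrite !kzE.
have bl_inj : injective bl by move=> z z' /b_inj; rewrite !kzE.
(* In labels, g acts affinely on each colour class: i and j are the images of the black and the
   white 0, and the factors are what makes P stable under x and y by [c_mul] and [c_succ]. *)
pose P g := exists i j,
  (forall k, w (x ^+ k * g)%g = wl ((c i + (A - 1) * j) * gsum A k + j)) /\
  (forall k, b (y ^+ k * g)%g = bl ((c j + (A - 1) * i) * gsum A k + i)).
have cD i : c (D * i) = A * c i + 1 - A by rewrite -c_mul addrK.
have Px g : g \in G -> P g -> P (g * x)%g.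
  move=> gG [i [j [Hw Hb]]]; exists (D * i), (A * j + 1); split=> k; rewrite mulgA.
    rewrite (@w_cong _ (x ^+ kz ((c i + (A - 1) * j) * gsum A k + j))%g) ?groupM ?groupX //.
    by rewrite -expgSr wlE gsumS kzE cD; congr wl; ring.
  rewrite (@b_cong _ (y ^+ kz ((c j + (A - 1) * i) * gsum A k + i))%g) ?groupM ?groupX //.
  have [l [k' [-> Ek']]] := act' (kz ((c j + (A - 1) * i) * gsum A k + i)).
  by rewrite b_x ?groupX // blE Ek' kzE c_succ; congr bl; ring.
have Py g : g \in G -> P g -> P (g * y)%g.
  move=> gG [i [j [Hw Hb]]]; exists (A * i + 1), (D * j); split=> k; rewrite mulgA; last first.
    rewrite (@b_cong _ (y ^+ kz ((c j + (A - 1) * i) * gsum A k + i))%g) ?groupM ?groupX //.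
    by rewrite -expgSr blE gsumS kzE cD; congr bl; ring.
  rewrite (@w_cong _ (x ^+ kz ((c i + (A - 1) * j) * gsum A k + j))%g) ?groupM ?groupX //.
  have [l [k' [-> Ek']]] := act (kz ((c i + (A - 1) * j) * gsum A k + j)).
  by rewrite w_y ?groupX // wlE Ek' kzE c_succ; congr wl; ring.
have P1 : P 1%g.
  by exists 0, 0; split=> k; rewrite mulg1 ?wlE ?blE c0; congr (_ _); ring.
have PG g : g \in G -> P g.
  move=> /(isob_decomp isoG)[i [j ->]].
  elim: j => [|j IH]; last by rewrite expgSr mulgA; apply: Py; rewrite ?groupM ?groupX.
  rewrite mulg1; elim: i => [|i IH] //.
  by rewrite expgSr; apply: Px; rewrite ?groupX.
pose Phi (e : dart n) : dart n := (bl e.1.1, wl e.1.2, e.2).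
have Phi_inj : injective Phi.
  by move=> [[i j] e] [[i' j'] e'] /dart_eqP[] /= /bl_inj -> /wl_inj -> ->.
apply/existsP; exists (perm Phi_inj); apply/map_isoP.
split=> -[[i j] e]; rewrite !permE //.
have [g gi Eg] := aut_ex rR d0 (bl i, wl j, true).
have gG : g \in G by apply/colour_autsP; rewrite Eg.
have [bg wg] : b g = bl i /\ w g = wl j by have := gd0 gG; rewrite Eg => /dart_eqP[].
have [i0 [j0 [Hw Hb]]] := PG g gG.
have gs0 : gsum A 0 = 0 by rewrite /gsum big_ord0.
have gs1 : gsum A 1 = 1 by rewrite /gsum big_ord1 expr0.
have Ei : i0 = i by apply: bl_inj; rewrite -bg -[g]mul1g -(expg0 y) Hb gs0 mulr0 add0r.
have Ej : j0 = j by apply: wl_inj; rewrite -wg -[g]mul1g -(expg0 x) Hw gs0 mulr0 add0r.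
have gR u : g (R u) = R (g u) by have /map_isoP[_ ->] := gi.
(* R commutes with g, so the dart following g d0 is g (x d0); its white label is (c i + (A - 1) j) +
   j = A j + c i. *)
rewrite /affine_rot_fun /Phi /=; case: e => /=.
  rewrite -Eg -gR -xE -permM gd0 ?groupM // -[x]expg1 b_x // Hw gs1 mulr1 bg Ei Ej.
  by congr (_, wl _, _); ring.
have -> : (bl i, wl j, false) = g d1 by rewrite gd1 // bg wg.
rewrite -gR -yE -permM gd1 ?groupM // -[y]expg1 w_y // Hb gs1 mulr1 wg Ei Ej.
by congr (bl _, _, _); ring.
Qed.
End Classify.

Lemma regular_is_mult_rot m (R : {perm dart m.+2}) : ~~ (8 %| m.+2)%N ->
  R \in reg_embeddings m.+2 ->
  exists2 d : 'I_m.+2, affine_mult m.+2 d & isomorphic (mult_rot d) R.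
Proof.
move=> n8; rewrite inE => /andP[eR rR].
have [x [y [t [[xi yi _ xE yE] [isoG xt yt _]]]]] := regular_isobicyclic eR rR.
have [a [d [d_gt0 dat act _]]] := isob_affine n8 isoG.
have fp := affine_data_full_period dat.
pose d' : 'I_m.+2 := inord (d %% m.+2).
have Ed : d = d' %[mod m.+2] by rewrite inordK ?ltn_pmod // modn_mod.
(* d is prime to n > 1, so its residue is not 0. *)
have d'_gt0 : (0 < d')%N.
  rewrite lt0n; apply/eqP => d'0.
  have := mult_coprime (ltn0Sn _) n8 d_gt0 (affine_data_mult dat).
  by rewrite -coprime_modl Ed d'0 mod0n /coprime gcd0n.
have dP : affine_mult m.+2 d' := affine_mult_mod d_gt0 d'_gt0 Ed (affine_data_mult dat).
have Ea : a%:R = slopeZ d'.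
  apply/eqP; rewrite /slopeZ natZp_eq; apply/eqP.
  apply: (slope_unique (ltn0Sn _) n8 d'_gt0 dP).
  exact: affine_data_mod d_gt0 d'_gt0 Ed dat.
exists d' => //; have [ua ->] := mult_rotE n8 dP.
apply: (@regular_iso_affine_rot _ R eR rR x y t xi yi xE yE isoG xt yt _ d').
- exact: shiftZ0.
- exact: shiftZ_mul.
- exact: shiftZ_succ.
- exact: slopeZ_surj.
- move=> k l; rewrite -Ea !gsum_geo; split=> [/eqP|E].
    by rewrite natZp_eq geo_eq // => /eqP.
  by apply/eqP; rewrite natZp_eq geo_eq //; apply/eqP.
move=> i; have [j [i' [E Eg]]] := act i; exists j, i'; split=> //.
rewrite -Ea !gsum_geo -[d' in RHS]natZp_valE -natrM; apply/eqP; rewrite natZp_eq Eg.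
by apply/eqP/modn_eqM.
Qed.

Lemma nu_affine_mult n : (1 < n)%N -> ~~ (8 %| n)%N ->
  nu n = #|[set d : 'I_n | affine_mult n d]|.
Proof.
case: n => [|[|m]] // _ n8; set DD := [set d | _]; rewrite /nu.
pose cls (R : {perm dart m.+2}) := [set R' in reg_embeddings m.+2 | isomorphic R R'].
have -> : [set cls R | R in reg_embeddings m.+2] = [set cls (mult_rot d) | d in DD].
  apply/setP=> C; apply/imsetP/imsetP => -[].
    move=> R Rreg ->; have [d dP iso] := regular_is_mult_rot n8 Rreg.
    exists d; first by rewrite inE.
    apply/setP=> R'; rewrite !inE; congr (_ && _); apply/idP/idP.
      exact: isomorphic_trans iso.
    exact: isomorphic_trans (isomorphic_sym iso).
  by move=> d; rewrite inE => dP ->; exists (mult_rot d) => //; apply: mult_rot_reg.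
apply: card_in_imset => d d'; rewrite !inE => dP dP' E.
apply: (mult_rot_inj n8 dP dP').
have : mult_rot d' \in cls (mult_rot d') by rewrite inE mult_rot_reg // isomorphic_refl.
by rewrite -E inE => /andP[].
Qed.

End Classification.

(** * Counting multipliers *)

(** Q stands for the set of tails of the arcs ending at one terminal vertex; the subtracted 1 is the
    empty set. *)
Lemma prod1D_sub1 (I : finType) (v : I -> nat) :
  \sum_(Q : {set I} | Q != set0) \prod_(q in Q) v q = \prod_q (1 + v q) - 1.
Proof.
have -> : \prod_q (1 + v q) = \sum_(Q : {set I}) \prod_(q in Q) v q.
  under eq_bigr => q _ do rewrite addnC.
  rewrite bigA_distr; apply: eq_big => [Q|Q _]; first by rewrite inE.
  by rewrite [RHS]big_mkcond.
have E0 : \prod_(q in set0) v q = 1 by apply: big_pred0 => q; rewrite inE.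
by rewrite [X in _ = X - 1](bigD1 set0) //= E0 addKn.
Qed.

(** A graph whose set of heads is exactly T amounts to a nonempty set of tails for each p in T. *)
Lemma sum_prod_hitting (I : finType) (T : {set I}) (v : I -> I -> nat) :
  \sum_(G : {set I * I} | [forall a in G, a.2 \in T] && [forall p in T, exists q, (q, p) \in G])
     \prod_(a in G) v a.1 a.2
  = \prod_(p in T) (\prod_q (1 + v q p) - 1).
Proof.
under [RHS]eq_bigr => p _ do rewrite -prod1D_sub1.
rewrite (big_distr_big_dep set0).
pose graph (H : {ffun I -> {set I}}) := [set a : I * I | a.1 \in H a.2].
pose fiber (G : {set I * I}) : {ffun I -> {set I}} := [ffun p => [set q | (q, p) \in G]].
rewrite (reindex_onto graph fiber) /=; last first.
  by move=> G _; apply/setP=> -[q p]; rewrite !inE /= ffunE inE.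
apply: eq_big => [H|H /andP[/andP[/forall_inP sT /forall_inP hit] _]].
  have -> : fiber (graph H) == H by apply/eqP/ffunP=> p; rewrite ffunE; apply/setP=> q; rewrite !inE.
  rewrite andbT; apply/andP/pfamilyP => [[/forall_inP sT /forall_inP hit]|[/subsetP sT hit]].
    split=> [|p pT].
      apply/subsetP=> p; rewrite inE => /set0Pn[q qH].
      by have := sT (q, p); rewrite inE => /(_ qH).
    have /existsP[q] := hit p pT; rewrite inE /= => qH.
    by apply/set0Pn; exists q.
  split; apply/forall_inP.
    by move=> [q p]; rewrite inE /= => qH; apply: sT; rewrite inE; apply/set0Pn; exists q.
  move=> p /hit /set0Pn[q qH]; apply/existsP; exists q.
  by rewrite inE.
rewrite pair_big_dep /= [RHS](reindex_onto (fun a : I * I => (a.2, a.1)) (fun a => (a.2, a.1))) /=; last by case.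
apply: eq_bigl => -[q p]; rewrite inE /= eqxx andbT.
case: (boolP (q \in H p)) => qH; last by rewrite andbF.
by rewrite andbT; apply/esym; apply: (sT (q, p)); rewrite inE.
Qed.

Lemma primes_leq n q : q \in primes n -> q < n.+1.
Proof. by rewrite mem_primes ltnS => /and3P[_ n0 /dvdn_leq]; apply. Qed.

Lemma logn_leq q n : logn q n < n.+1.
Proof.
case: (posnP n) => [->|n0]; first by rewrite logn0.
rewrite ltnS; have [pr_q|npr] := boolP (prime q); last by rewrite lognE (negPf npr).
apply: leq_trans (ltnW (ltn_expl _ (prime_gt1 pr_q))) (dvdn_leq n0 (pfactor_dvdnn q n)).
Qed.

Lemma big_primes_ord (R : Type) (idx : R) (op : Monoid.com_law idx) n (C : pred nat) (h : nat -> R) :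
  \big[op/idx]_(q <- primes n | C q) h q
  = \big[op/idx]_(q : 'I_n.+1 | (val q \in primes n) && C q) h q.
Proof.
have -> : \big[op/idx]_(q : 'I_n.+1 | (val q \in primes n) && C q) h q =
   \big[op/idx]_(q <- [seq val q | q <- enum 'I_n.+1 & val q \in primes n] | C q) h q.
  by rewrite big_map big_filter_cond big_enum_cond.
apply: perm_big; apply: uniq_perm; first exact: primes_uniq.
  by rewrite (map_inj_uniq val_inj) filter_uniq // enum_uniq.
move=> q; apply/idP/mapP => [qn|[k + ->]]; last by rewrite mem_filter => /andP[].
exists (Ordinal (primes_leq qn)) => //.
by rewrite mem_filter /= qn mem_enum.
Qed.

Lemma sum_nat1_ord n e (h : nat -> nat) : e <= n ->
  \sum_(1 <= f < e.+1) h f = \sum_(f : 'I_n.+1 | 0 < f <= e) h f.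
Proof.
move=> en; rewrite (big_nat_widen _ _ n.+1) // (big_nat_widenl _ 0) // big_mkord.
by apply: eq_bigl => f; rewrite andbC.
Qed.

(** * Expansion of the sum over graphs *)

Section Rhs.
Variable n : nat.
Local Notation I := 'I_n.+1.
Implicit Types (F : {ffun I -> I}) (G : {set I * I}).

(* [F q] is the index f chosen at q in the expanded product, with [F q = 0] at terminal vertices. *)
Definition exponent_fun F : bool :=
  [forall q : I, F q <= (if val q \in primes n then logn q n else 0)].

Definition arc_weight F (q p : I) : nat := q ^ (minn (F q) (rqp q p)) - 1.

Definition heads F : {set I} := [set p : I | (val p \in primes n) && (F p == 0 :> nat)].

Definition compatible F G : bool :=
  short_spanning G && [forall q : I, (val q \in primes n) ==> (nonterminal G q == (F q != 0 :> nat))].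

Lemma short_arc G a : short_spanning G -> a \in G ->
  [/\ val a.1 \in primes n, val a.2 \in primes n, val a.1 %| (val a.2).-1,
      nonterminal G a.1 & ~~ nonterminal G a.2].
Proof.
case/andP=> /forall_inP arc /forall_inP sh aG; have /and3P[q p d] := arc a aG; split=> //.
  by apply/forall_inP=> b bG; have /forall_inP := sh b bG; apply.
by apply/forall_inPn; exists a; rewrite ?negbK ?inE.
Qed.

(** The graphs with heads exactly [heads F] that are not compatible contribute 0: a nonzero weight
    forces F to be nonzero at the tail and q to divide p - 1, which makes the graph short and a
    subgraph of Pi_n. *)
Lemma sum_compatible F : exponent_fun F ->
  \sum_(G | compatible F G) \prod_(a in G) arc_weight F a.1 a.2 =
  \prod_(p in heads F) (\prod_(q : I) q ^ (minn (F q) (rqp q p)) - 1).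
Proof.
move=> /forallP expF.
have Fprime q : F q != 0 :> nat -> val q \in primes n.
  by have := expF q; case: ifP => // _; rewrite leqn0 => ->.
have prG (q : I) k : 0 < q ^ minn (F q) k.
  rewrite expn_gt0; case: (posnP (F q)) => [->|Fq]; first by rewrite min0n eqxx orbT.
  by move: (Fprime q); rewrite -lt0n => /(_ Fq); rewrite mem_primes => /andP[/prime_gt0 ->].
have -> : \prod_(p in heads F) (\prod_(q : I) q ^ (minn (F q) (rqp q p)) - 1)
   = \prod_(p in heads F) (\prod_q (1 + arc_weight F q p) - 1).
  by apply: eq_bigr => p _; congr (_ - 1); apply: eq_bigr => q _; rewrite subnKC.
rewrite -(sum_prod_hitting (heads F) (arc_weight F)) big_mkcond [RHS]big_mkcond /=.
apply: eq_bigr => G _; case: ifPn => [/andP[shG /forallP cmp]|ncmp].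
  have cmpP (q : I) : val q \in primes n -> nonterminal G q = (F q != 0 :> nat).
    by move=> qn; exact: (eqP (implyP (cmp q) qn)).
  rewrite ifT //; apply/andP; split; apply/forall_inP.
    move=> a aG; have [_ p2 _ _ nt] := short_arc shG aG.
    by rewrite inE p2 /=; move: nt; rewrite cmpP // negbK.
  move=> p; rewrite inE => /andP[pn F0].
  have : ~~ nonterminal G p by rewrite cmpP // F0.
  case/forall_inPn => -[q p'] qG; rewrite negbK => /eqP/val_inj /= <-.
  by apply/existsP; exists q.
case: ifPn => // /andP[/forall_inP sT /forall_inP hit].
apply/esym/eqP; rewrite prod_nat_seq_eq0.
apply/negPn/negP => nz; case/negP: ncmp.
have wnz a : a \in G -> arc_weight F a.1 a.2 != 0.
  move=> aG; apply: contra nz => w0; apply/hasP; exists a; rewrite ?mem_index_enum //.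
  by rewrite aG.
have arcF a : a \in G -> F a.1 != 0 :> nat /\ val a.1 %| (val a.2).-1.
  move=> aG; have := wnz a aG; rewrite /arc_weight subn_eq0 -ltnNge.
  move=> lt; have : 0 < minn (F a.1) (rqp a.1 a.2).
    by rewrite lt0n; apply: contraTneq lt => ->; rewrite expn0.
  by rewrite leq_min lt0n /rqp logn_gt0 mem_primes => /andP[-> /and3P[]].
apply/andP; split.
  apply/andP; split; apply/forall_inP=> a aG.
    have [Fa dv] := arcF a aG; rewrite /Pi_arc Fprime // dv andbT /=.
    by have := sT a aG; rewrite inE => /andP[].
  apply/forall_inP=> b bG; apply/eqP => /val_inj E.
  have := sT a aG; rewrite inE E => /andP[_].
  by have [/negPf ->] := arcF b bG.
apply/forallP=> q; apply/implyP=> qn; apply/eqP; apply/idP/idP => [/forall_inP nt|Fq].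
  apply/negP => F0; have := hit q; rewrite inE qn F0 => /(_ isT) /existsP[p pG].
  by have := nt _ pG; rewrite eqxx.
apply/forall_inP=> a aG; apply/eqP => /val_inj E; have := sT a aG.
by rewrite inE E (negPf Fq) andbF.
Qed.

Lemma compatible_pfamily F G : short_spanning G ->
  (F \in pfamily (ord0 : I) [pred q : I | (val q \in primes n) && nonterminal G q]
     (fun q : I => [pred f : I | 0 < f <= logn q n]))
  = exponent_fun F && compatible F G.
Proof.
move=> shG; rewrite /compatible shG /=; apply/pfamilyP/andP => [[/subsetP sF HF]|[/forallP expF /forallP cmp]].
  have F0 (q : I) : F q != 0 :> nat -> (val q \in primes n) && nonterminal G q.
    by move=> Fq; have := sF q; rewrite !inE; apply; apply: contra Fq => /eqP ->.
  split; apply/forallP=> q.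
    case: (posnP (F q)) => [-> //|Fq].
    have Pq := F0 q; rewrite -lt0n Fq in Pq; have /andP[qn nt] := Pq isT.
    by have := HF q; rewrite !inE qn nt => /(_ isT) /andP[].
  apply/implyP=> qn; apply/eqP; apply/idP/idP => [nt|/F0/andP[] //].
  by have := HF q; rewrite !inE qn nt lt0n => /(_ isT) /andP[].
have cmpP (q : I) : val q \in primes n -> nonterminal G q = (F q != 0 :> nat).
  by move=> qn; exact: (eqP (implyP (cmp q) qn)).
have Fprime (q : I) : F q != 0 :> nat -> val q \in primes n.
  by have := expF q; case: ifP => // _; rewrite leqn0 => ->.
split=> [|q].
  apply/subsetP=> q; rewrite !inE => Fq.
  have Fq' : F q != 0 :> nat by apply: contra Fq => /eqP E; apply/eqP/val_inj.
  by rewrite Fprime // cmpP ?Fprime.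
rewrite !inE => /andP[qn nt]; have := expF q; rewrite qn => ->.
by rewrite lt0n -cmpP // nt.
Qed.

(** Expanding the product of sums gives pairs (G, F) with F nonzero exactly at the non-terminal
    primes; after exchanging the sums, [sum_compatible] evaluates the inner one. *)
Lemma sum_short_spanning :
  \sum_(G : {set I * I} | short_spanning G)
    \prod_(q <- primes n | nonterminal G q)
      \sum_(1 <= f < (logn q n).+1)
         totient (q ^ (logn q n - f)) *
         \prod_(a in G | val a.1 == q) (q ^ (minn f (rqp q (val a.2))) - 1)
  = \sum_(F : {ffun I -> I} | exponent_fun F)
      (\prod_(q : I | (val q \in primes n) && (F q != 0 :> nat)) totient (q ^ (logn q n - F q))) *
      \prod_(p in heads F) (\prod_(q : I) q ^ (minn (F q) (rqp q p)) - 1).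
Proof.
pose X G (q f : nat) := totient (q ^ (logn q n - f)) *
         \prod_(a in G | val a.1 == q) (q ^ (minn f (rqp q (val a.2))) - 1).
transitivity (\sum_(G : {set I * I} | short_spanning G)
   \sum_(F : {ffun I -> I} | exponent_fun F && compatible F G)
    \prod_(q : I | (val q \in primes n) && nonterminal G q) X G q (F q)).
  apply: eq_bigr => G shG.
  rewrite (@big_primes_ord _ _ _ n (nonterminal G) (fun q => \sum_(1 <= f < (logn q n).+1) X G q f)).
  transitivity (\prod_(q : I | (val q \in primes n) && nonterminal G q)
    \sum_(f : I | 0 < f <= logn q n) X G q f).
    by apply: eq_bigr => q _; rewrite (@sum_nat1_ord n) // -ltnS logn_leq.
  rewrite (big_distr_big_dep (ord0 : I)); apply: eq_bigl => F.
  by rewrite -compatible_pfamily.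
rewrite (exchange_big_dep exponent_fun) /=; last by move=> G F _ /andP[].
apply: eq_bigr => F expF; rewrite -sum_compatible // big_distrr /=.
apply: eq_big => [G|G]; first by rewrite expF /= /compatible; case: (short_spanning G).
case/andP=> shG /andP[_ /andP[_ /forallP cmp]].
have cmpP (q : I) : val q \in primes n -> nonterminal G q = (F q != 0 :> nat).
  by move=> qn; exact: (eqP (implyP (cmp q) qn)).
have eqP' (q : I) : (val q \in primes n) && nonterminal G q = (val q \in primes n) && (F q != 0 :> nat).
  by case: (boolP (val q \in primes n)) => //= /cmpP.
rewrite (eq_bigl _ _ eqP') big_split /=; congr (_ * _).
rewrite (partition_big (fun a : I * I => a.1) (fun q : I => (val q \in primes n) && (F q != 0 :> nat))) /=.
  apply: eq_bigr => q _; apply: eq_big => [a|a]; first by rewrite val_eqE.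
  by case/andP=> _ /eqP/val_inj <-.
by move=> a aG; have [q1 _ _ nt _] := short_arc shG aG; rewrite q1 -(cmpP _ q1).
Qed.
End Rhs.

(** * Counting residues prime by prime *)

Lemma sum_crt A B (f g : nat -> nat) : coprime A B -> 0 < A -> 0 < B ->
  \sum_(d < A * B) f (d %% A) * g (d %% B) = (\sum_(a < A) f a) * (\sum_(b < B) g b).
Proof.
move=> co A0 B0; have AB0 : 0 < A * B by rewrite muln_gt0 A0.
rewrite big_distrlr pair_big /=.
pose h (d : 'I_(A * B)) : 'I_A * 'I_B := (Ordinal (ltn_pmod d A0), Ordinal (ltn_pmod d B0)).
pose h' (u : 'I_A * 'I_B) : 'I_(A * B) := Ordinal (ltn_pmod (chinese A B u.1 u.2) AB0).
rewrite (reindex_onto h h') /=; last first.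
  move=> [a b] _; congr (_, _); apply: val_inj => /=.
    by rewrite modn_dvdm ?dvdn_mulr // chinese_modl // modn_small.
  by rewrite modn_dvdm ?dvdn_mull // chinese_modr // modn_small.
apply: eq_bigl => d; apply/esym/eqP/val_inj => /=.
by rewrite -chinese_mod // modn_small.
Qed.

Lemma prod_primes_logn n g : 0 < n -> g %| n -> \prod_(q <- primes n) q ^ logn q g = g.
Proof.
move=> n0 gn; have g0 := dvdn_gt0 n0 gn.
transitivity (g`_\pi(n)); last first.
  by apply: part_pnat_id; apply: pnat_dvd gn _; apply: pnat_pi.
rewrite (widen_partn _ (dvdn_leq n0 gn)) big_mkord.
rewrite (@big_primes_ord _ _ _ n xpredT (fun q => q ^ logn q g)).
by apply: eq_bigl => q; rewrite andbT.
Qed.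

Lemma sum_crt_primes (s : seq nat) (e : nat -> nat) (Q : nat -> nat -> nat) :
  all prime s -> uniq s ->
  \sum_(d < \prod_(p <- s) p ^ e p) \prod_(p <- s) Q p (d %% p ^ e p)
  = \prod_(p <- s) \sum_(z < p ^ e p) Q p z.
Proof.
elim: s => [|p s IH] /=.
  by rewrite !big_nil big_ord_recl big_ord0 big_nil.
case/andP=> pr_p prs /andP[ps us]; rewrite [RHS]big_cons -IH // big_cons.
set N := \prod_(j <- s) _.
have N0 : 0 < N.
  rewrite /N; elim: s {ps us IH N} prs => [|q s IH] /=; first by rewrite big_nil.
  by case/andP=> pr_q prs; rewrite big_cons muln_gt0 expn_gt0 prime_gt0 // IH.
have co : coprime (p ^ e p) N.
  rewrite /N; elim: s ps {us IH N N0} prs => [|q s IH] /=; first by rewrite big_nil coprimen1.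
  rewrite inE negb_or => /andP[pq ps] /andP[pr_q prs]; rewrite big_cons coprimeMr IH // andbT.
  by rewrite coprimeXl // coprimeXr // prime_coprime // dvdn_prime2.
rewrite -(@sum_crt _ _ (Q p) (fun d => \prod_(j <- s) Q j (d %% j ^ e j))) //; last first.
  by rewrite expn_gt0 prime_gt0.
apply: eq_bigr => d _; rewrite big_cons; congr (_ * _).
rewrite [LHS]big_seq [RHS]big_seq; apply: eq_bigr => q qs; rewrite modn_dvdm //.
by rewrite /N (big_rem q) //= dvdn_mulr.
Qed.

Lemma all_prod (T : Type) (s : seq T) (a : pred T) : (all a s : nat) = \prod_(x <- s) (a x : nat).
Proof.
elim: s => [|x s IH]; first by rewrite big_nil.
by rewrite big_cons -IH /=; case: (a x); rewrite ?mul1n.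
Qed.

Lemma card_crt_primes n (Q : nat -> pred nat) : 0 < n ->
  #|[set d : 'I_n | all (fun p => Q p (d %% p ^ logn p n)) (primes n)]|
  = \prod_(p <- primes n) #|[set z : 'I_(p ^ logn p n) | Q p z]|.
Proof.
move=> n0.
have cardE N (P : pred nat) : #|[set d : 'I_N | P d]| = \sum_(d < N) (P d : nat).
  by rewrite -sum1_card big_mkcond; apply: eq_bigr => d _; rewrite inE; case: (P d).
under [RHS]eq_bigr => p _ do rewrite (cardE _ (Q p)).
rewrite -(@sum_crt_primes _ (fun p => logn p n) (fun p z => Q p z)) ?primes_uniq //; last first.
  by apply/allP=> p; rewrite mem_primes => /andP[].
rewrite prod_primes_logn // (cardE _ (fun d => all (fun p => Q p (d %% p ^ logn p n)) (primes n))).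
by apply: eq_bigr => d _; rewrite all_prod.
Qed.

(** z - 1 = p^f v with v running through the units modulo p^(e - f). The gcd caps the valuation, so
    f = e counts z = 1 alone. *)
Lemma card_logn_gcd p e f : prime p -> 0 < f <= e ->
  #|[set z : 'I_(p ^ e) | logn p (gcdn (z + (p ^ e).-1) (p ^ e)) == f]| = totient (p ^ (e - f)).
Proof.
move=> pr_p /andP[f0 fe]; have p0 := prime_gt0 pr_p.
have N0 : 0 < p ^ e by rewrite expn_gt0 p0.
have -> : [set z : 'I_(p ^ e) | logn p (gcdn (z + (p ^ e).-1) (p ^ e)) == f]
   = (@ord_pred _) @^-1: [set u : 'I_(p ^ e) | logn p (gcdn u (p ^ e)) == f].
  apply/setP=> z; rewrite !inE /= gcdn_modl; congr (logn p (gcdn _ _) == f).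
  by rewrite -subn1 addnBA // subn1.
rewrite card_preimset; last exact: ord_pred_inj.
pose B := p ^ (e - f); have B0 : 0 < B by rewrite expn_gt0 p0.
have EN : p ^ e = p ^ f * B by rewrite -expnD subnKC.
have lt (v : 'I_B) : p ^ f * v < p ^ e by rewrite EN ltn_pmul2l // expn_gt0 p0.
pose h (v : 'I_B) : 'I_(p ^ e) := Ordinal (lt v).
have h_inj : injective h.
  by move=> v v' /(congr1 val) /= /eqP; rewrite eqn_pmul2l ?expn_gt0 ?p0 // => /eqP/val_inj.
have lgE v : (logn p (gcdn (p ^ f * v) (p ^ e)) == f) = coprime B v.
  rewrite EN -muln_gcdr lognM ?expn_gt0 ?p0 ?gcdn_gt0 ?B0 ?orbT // pfactorK //.
  rewrite -[X in _ == X]addn0 eqn_add2l [RHS]coprime_sym /coprime.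
  have /(dvdn_pfactor _ _ pr_p)[k _ ->] : gcdn v B %| p ^ (e - f) by apply: dvdn_gcdr.
  by rewrite pfactorK // -(expn0 p) eqn_exp2l // prime_gt1.
have -> : [set u : 'I_(p ^ e) | logn p (gcdn u (p ^ e)) == f] = h @: [set v : 'I_B | coprime B v].
  apply/setP=> u; rewrite inE; apply/idP/imsetP => [/eqP uf|[v + ->]]; last first.
    by rewrite inE -lgE.
  have /dvdnP[v Ev] : p ^ f %| u.
    apply: dvdn_trans (dvdn_gcdl u (p ^ e)).
    by rewrite pfactor_dvdn ?gcdn_gt0 ?N0 ?orbT // uf.
  have vB : v < B by have := ltn_ord u; rewrite Ev EN mulnC ltn_pmul2l // expn_gt0 p0.
  have hE : u = h (Ordinal vB) by apply: val_inj; rewrite /= Ev mulnC.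
  by exists (Ordinal vB) => //; rewrite inE -lgE /= mulnC -Ev uf.
rewrite card_imset // totient_count_coprime big_mkord -sum1_card big_mkcond /=.
by apply: eq_bigr => v _; rewrite inE; case: coprime.
Qed.

Lemma card_cyclic_expg (gT : finGroupType) (C : {group gT}) g : cyclic C ->
  #|[set x in C | (x ^+ g)%g == 1%g]| = gcdn g #|C|.
Proof.
move=> cycC; have [a Ca] := cyclicP cycC; set N := #|C|; set k := gcdn g N.
have kN : k %| N by apply: dvdn_gcdr.
have oa : #[a]%g = N by rewrite orderE -Ca.
have ok : #[(a ^+ (N %/ k))%g]%g = k.
  by rewrite orderXdiv oa ?dvdn_div // divnA // mulKn // cardG_gt0.
rewrite -ok orderE; apply: eq_card => x; rewrite inE.
have sK : <[a ^+ (N %/ k)]>%g \subset C by rewrite Ca cycleX.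
apply/andP/idP => [[xC xg]|xK].
  have sxC : <[x]>%g \subset C by rewrite cycle_subG.
  rewrite -cycle_subG -(cardSg_cyclic cycC sxC sK) -!orderE ok.
  by rewrite dvdn_gcd order_dvdn xg order_dvdG.
split; first exact: (subsetP sK).
rewrite -order_dvdn; apply: dvdn_trans (dvdn_gcdl g N).
by rewrite -/k -ok; apply: order_dvdG.
Qed.

Lemma card_Fp_roots p g : prime p -> 0 < g ->
  #|[set z : 'I_p | z ^ g == 1 %[mod p]]| = gcdn g p.-1.
Proof.
move=> pr_p g0; have p0 := prime_gt0 pr_p.
pose h (u : {unit 'F_p}) : 'I_p := Ordinal (ltn_pmod (val (FinRing.uval u)) p0).
have valF (z : 'F_p) : val z < p by apply: leq_trans (ltn_ord z) _; rewrite Fp_cast.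
have natF a b : ((a%:R : 'F_p) == b%:R)%R = (a == b %[mod p]).
  by rewrite -val_eqE /= !val_Fp_nat.
have valR (z : 'F_p) : ((val z)%:R)%R = z.
  by apply: val_inj; rewrite /= val_Fp_nat // modn_small // valF.
have h_inj : injective h.
  move=> u v /(congr1 val) /=; rewrite !modn_small ?valF // => E.
  by apply/val_inj/val_inj.
have -> : [set z : 'I_p | z ^ g == 1 %[mod p]] = h @: [set u in [set: {unit 'F_p}] | (u ^+ g)%g == 1%g].
  apply/setP=> z; rewrite inE; apply/idP/imsetP => [zg|[u + ->]]; last first.
    rewrite !inE -val_eqE /= FinRing.val_unitX -[X in (X ^+ _)%R]valR -GRing.natrX => E.
    rewrite -natF; by rewrite /= modn_small ?valF.
  have zu : ((z%:R : 'F_p) \is a GRing.unit)%R.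
    have : ((z%:R : 'F_p) ^+ g \is a GRing.unit)%R.
      by rewrite -GRing.natrX (eqP (etrans (natF _ 1) zg)) GRing.unitr1.
    by rewrite GRing.unitrX_pos.
  exists (FinRing.unit 'F_p zu).
    rewrite !inE -val_eqE /= FinRing.val_unitX /= -GRing.natrX.
    by rewrite (eqP (etrans (natF _ 1) zg)).
  by apply: val_inj; rewrite /= val_Fp_nat // modn_mod modn_small.
rewrite card_imset // card_cyclic_expg ?field_unit_group_cyclic //.
by rewrite card_finField_unit card_Fp.
Qed.

Lemma expn_pexp_mod1 p u k : prime p -> 0 < u -> u = 1 %[mod p] ->
  u ^ (p ^ k) = 1 %[mod p ^ k.+1].
Proof.
move=> pr_p u0 u1; elim: k => [|k IH] //; rewrite expnSr expnM.
set w := u ^ _ in IH *; have w0 : 0 < w by rewrite expn_gt0 u0.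
have w1 : w = 1 %[mod p] by apply: modn_dvd_eq IH; rewrite expnS dvdn_mulr.
rewrite expn_geo //; apply/eqP; rewrite eqn_mod_dvd ?leq_addl // addnK expnSr.
apply: dvdn_mul; first by rewrite -eqn_mod_dvd // IH.
by rewrite /dvdn (geo_mod1 p w1) modnn.
Qed.

(** u^g - 1 = (u - 1) [geo u g], and [geo u g] = g mod p is prime to p. *)
Lemma expn_coprime_mod1 p e u g : prime p -> coprime g p -> 0 < u ->
  u = 1 %[mod p] -> u ^ g = 1 %[mod p ^ e] -> u = 1 %[mod p ^ e].
Proof.
move=> pr_p co u0 u1; rewrite expn_geo // => /eqP.
rewrite eqn_mod_dvd ?leq_addl // addnK Gauss_dvdl; last first.
  rewrite coprimeXl // prime_coprime // /dvdn (geo_mod1 g u1) -/(dvdn _ _).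
  by rewrite -prime_coprime // coprime_sym.
by move=> d; apply/eqP; rewrite eqn_mod_dvd.
Qed.

(** Roots modulo p^e and modulo p are equinumerous: reduction is injective on g-th roots of unity,
    and z |-> z^(p^(e - 1)), the Teichmueller lift, injects in the other direction. *)
Lemma card_pexp_roots p e g : prime p -> 0 < e -> 0 < g -> coprime g p ->
  #|[set z : 'I_(p ^ e) | z ^ g == 1 %[mod p ^ e]]| = gcdn g p.-1.
Proof.
move=> pr_p e0 g0 co; rewrite -(card_Fp_roots pr_p g0).
have p0 := prime_gt0 pr_p; have N0 : 0 < p ^ e by rewrite expn_gt0 p0.
have pN : p %| p ^ e by rewrite dvdn_exp.
have unit0 z : z ^ g = 1 %[mod p] -> 0 < z.
  by case: z => //; rewrite exp0n // mod0n modn_small ?prime_gt1.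
apply/eqP; rewrite eqn_leq; apply/andP; split.
  pose r (z : 'I_(p ^ e)) : 'I_p := Ordinal (ltn_pmod z p0).
  rewrite -(card_in_imset (f := r)); last first.
    move=> z w; rewrite !inE => /eqP zg /eqP wg /(congr1 val) /= zw.
    have z0 : 0 < z by apply: unit0; apply: modn_dvd_eq zg.
    have w0 : 0 < w by apply: unit0; apply: modn_dvd_eq wg.
    (* As w^g = 1, z w^(g - 1) plays the role of z / w: it is 1 mod p and a g-th root of unity. *)
    have E1 : z * w ^ g.-1 = 1 %[mod p ^ e].
      apply: (@expn_coprime_mod1 p e _ g) => //; first by rewrite muln_gt0 expn_gt0 z0 w0.
        rewrite (modn_eqM (N := p) zw (erefl _)) -expnS prednK //.
        exact: modn_dvd_eq wg.
      by rewrite expnMn -expnM (mulnC g.-1) expnM (modn_eqM zg (modn_eqX g.-1 wg)) exp1n.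
    have E2 : z * w ^ g = w * 1 %[mod p ^ e].
      by rewrite -{1}(prednK g0) expnS mulnCA; apply: modn_eqM.
    apply: ord_inj; rewrite -(modn_small (ltn_ord z)) -(modn_small (ltn_ord w)).
    by rewrite -[in LHS](muln1 z) -[in RHS](muln1 w) -E2; apply/modn_eqM.
  apply: subset_leq_card; apply/subsetP=> _ /imsetP[z zg ->]; rewrite inE in zg.
  by rewrite inE /= modnXm; apply/eqP; apply: modn_dvd_eq (eqP zg).
pose l (z : 'I_p) : 'I_(p ^ e) := Ordinal (ltn_pmod (z ^ (p ^ e.-1)) N0).
have frob (z k : nat) : z ^ (p ^ k) = z %[mod p].
  by elim: k => [|k IH]; rewrite ?expn0 ?expn1 // expnSr expnM fermat_little.
rewrite -(card_imset (f := l)); last first.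
  move=> z w /(congr1 val) /= E; apply: ord_inj.
  rewrite -(modn_small (ltn_ord z)) -(modn_small (ltn_ord w)).
  by rewrite -(frob z e.-1) -(frob w e.-1); apply: modn_dvd_eq E.
apply: subset_leq_card; apply/subsetP=> _ /imsetP[z zg ->]; rewrite inE in zg.
rewrite inE /= modnXm -expnM mulnC expnM; apply/eqP.
have := @expn_pexp_mod1 p (z ^ g) e.-1 pr_p; rewrite prednK //; apply; last exact/eqP.
by rewrite expn_gt0 unit0 //; apply/eqP.
Qed.

Lemma gcdn_prod_primes n (f : nat -> nat) k : 0 < k ->
  gcdn (\prod_(q <- primes n) q ^ f q) k = \prod_(q <- primes n) q ^ minn (f q) (logn q k).
Proof.
move=> k0.
have : all prime (primes n) by apply/allP=> q; rewrite mem_primes => /andP[].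
have := primes_uniq n; elim: (primes n) => [|q s IH] /=; first by rewrite !big_nil gcd1n.
case/andP=> qs us /andP[pr_q prs]; rewrite !big_cons -IH // gcdnC gcdn_mul_coprime; last first.
  elim: s qs prs {us IH} => [|q' s IH] /=; first by rewrite big_nil coprimen1.
  rewrite inE negb_or => /andP[qq' qs] /andP[pr_q' prs]; rewrite big_cons coprimeMr IH // andbT.
  by rewrite coprimeXl // coprimeXr // prime_coprime // dvdn_prime2.
congr (_ * _); last by rewrite gcdnC.
have [m co ->] := pfactor_coprime pr_q k0.
have m0 : 0 < m.
  by case: m co => //; rewrite /coprime gcdn0 => /eqP E; move: pr_q; rewrite E.
have q0 := prime_gt0 pr_q.
have lm : logn q m = 0.
  by apply/eqP; rewrite -leqn0 leqNgt logn_gt0 mem_primes pr_q m0 -prime_coprime // co.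
rewrite gcdnC Gauss_gcdr ?coprimeXl //; move: (logn q k) => l.
have -> : logn q (m * q ^ l) = l.
  by rewrite lognM // ?expn_gt0 ?q0 // lm pfactorK.
case: (leqP (f q) l) => le.
  by apply/gcdn_idPl/dvdn_exp2l.
by apply/gcdn_idPr/dvdn_exp2l/ltnW.
Qed.

(* Since subtraction is truncated, d - 1 is represented modulo N = p^e_p by z + (N - 1). *)
Definition local_cond (n : nat) (f : nat -> nat) (p z : nat) : bool :=
  if f p == 0 then
    (z != 1 %[mod p]) && (z ^ (\prod_(q <- primes n) q ^ f q) == 1 %[mod p ^ logn p n])
  else logn p (gcdn (z + (p ^ logn p n).-1) (p ^ logn p n)) == f p.

(** If f p = 0, the exponent g is prime to p. Then 1 is the only g-th root of unity that is 1 mod p,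
    so exactly one root is discarded. *)
Lemma card_local_cond n f p : p \in primes n -> f p <= logn p n ->
  #|[set z : 'I_(p ^ logn p n) | local_cond n f p z]| =
  if f p == 0 then \prod_(q <- primes n) q ^ minn (f q) (rqp q p) - 1
  else totient (p ^ (logn p n - f p)).
Proof.
move=> pn fp; have pr_p : prime p by move: pn; rewrite mem_primes => /andP[].
have e0 : 0 < logn p n by rewrite logn_gt0.
case: (posnP (f p)) => [f0|f0]; last first.
  rewrite -(@card_logn_gcd p (logn p n)) ?f0 //.
  by apply: eq_card => z; rewrite !inE /local_cond -[f p == 0]negbK -lt0n f0.
set g := \prod_(q <- primes n) q ^ f q.
have co : coprime g p.
  rewrite coprime_sym /g big_seq; apply: (big_ind (fun k => coprime p k)) => [|k l|q]; first exact: coprimen1.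
    by move=> ck cl; rewrite coprimeMr ck.
  rewrite mem_primes => /andP[pr_q _].
  have [->|pq] := eqVneq q p; first by rewrite f0 expn0 coprimen1.
  by rewrite coprimeXr // prime_coprime // dvdn_prime2 // eq_sym.
have g0 : 0 < g.
  by case: (posnP g) co => // ->; rewrite /coprime gcd0n => /eqP p1; move: pr_p; rewrite p1.
have p10 : 0 < p.-1 by rewrite -subn1 subn_gt0 prime_gt1.
rewrite -gcdn_prod_primes // -/g -(card_pexp_roots pr_p e0 g0 co).
have N1 : 1 < p ^ logn p n by rewrite -(expn0 p) ltn_exp2l // prime_gt1.
pose one : 'I_(p ^ logn p n) := Ordinal N1.
rewrite [X in _ = X - 1](cardsD1 one) inE /= exp1n eqxx addKn.
apply: eq_card => z; rewrite !inE /local_cond f0 eqxx -/g; apply: andb_id2r => zg.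
congr (~~ _); apply/eqP/eqP => [z1|->] //.
apply: ord_inj; rewrite -(modn_small (ltn_ord z)) -[RHS](modn_small N1).
apply: (@expn_coprime_mod1 p _ _ g) => //; last exact/eqP.
by case: (val z) z1 => // /eqP; rewrite mod0n modn_small // prime_gt1.
Qed.

Lemma logn_gcd_pfactor p k n : prime p -> 0 < n ->
  logn p (gcdn k n) = logn p (gcdn k (p ^ logn p n)).
Proof.
move=> pr_p n0; have [m co En] := pfactor_coprime pr_p n0.
have m0 : 0 < m by case: m co En n0 => // _ ->.
rewrite [in LHS]En gcdn_mul_coprime; last by rewrite coprimeXr // coprime_sym.
rewrite lognM ?gcdn_gt0 ?m0 ?expn_gt0 ?(prime_gt0 pr_p) ?orbT //.
rewrite (_ : logn p (gcdn k m) = 0) //; apply/eqP.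
rewrite -leqn0 leqNgt logn_gt0 mem_primes pr_p gcdn_gt0 m0 orbT /=.
by apply: contraL co => /dvdn_trans/(_ (dvdn_gcdr _ _)); rewrite prime_coprime // negbK.
Qed.

(** Once f prescribes every valuation, gcd(d - 1, n) is the constant product of the q^(f q), and the
    condition splits into one condition on each residue of d. *)
Lemma affine_mult_local n f d : 1 < n ->
  affine_mult n d && all (fun p => logn p (gcdn (d - 1) n) == f p) (primes n)
  = all (fun p => local_cond n f p (d %% p ^ logn p n)) (primes n).
Proof.
move=> n1; have n0 := ltnW n1.
have pr p : p \in primes n -> prime p by rewrite mem_primes => /andP[].
have ppl p : p \in primes n -> p %| p ^ logn p n by move=> pn; rewrite dvdn_exp // logn_gt0.
have loc p : p \in primes n -> local_cond n f p (d %% p ^ logn p n) =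
   if f p == 0 then (d != 1 %[mod p]) && (d ^ (\prod_(q <- primes n) q ^ f q) == 1 %[mod p ^ logn p n])
   else logn p (gcdn (d + (p ^ logn p n).-1) (p ^ logn p n)) == f p.
  move=> pn; rewrite /local_cond; case: ifP => _.
    by rewrite modn_dvdm ?ppl // modnXm.
  by rewrite -gcdn_modl modnDml gcdn_modl.
(* For d = 0 the truncated d - 1 is not the true difference; both sides are then false. *)
have [d0|d0] := posnP d.
  have pn : pdiv n \in primes n by rewrite mem_primes pdiv_prime // n0 pdiv_dvd.
  have -> : affine_mult n d = false.
    by apply/negP => /(affine_mult_gt0 n1); rewrite d0.
  apply/esym/negP => /allP/(_ _ pn); rewrite loc // d0; set p := pdiv n in pn *.
  have N1 : 1 < p ^ logn p n by rewrite -(expn0 p) ltn_exp2l ?prime_gt1 ?logn_gt0 // pr.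
  case: ifPn => [_|fp].
    have g0 : 0 < \prod_(q <- primes n) q ^ f q.
      by rewrite big_seq; apply: prodn_cond_gt0 => q qn; rewrite expn_gt0 prime_gt0 ?pr.
    by rewrite exp0n // (modn_small N1) !mod0n => /andP[].
  have -> : gcdn (0 + (p ^ logn p n).-1) (p ^ logn p n) = 1.
    by apply/eqP; rewrite add0n -[X in gcdn _ X](prednK (ltnW N1)); apply: coprimenS.
  by rewrite logn1 eq_sym (negPf fp).
have lgE p : p \in primes n ->
    logn p (gcdn (d - 1) n) = logn p (gcdn (d + (p ^ logn p n).-1) (p ^ logn p n)).
  move=> pn; have N0 : 0 < p ^ logn p n by rewrite expn_gt0 prime_gt0 ?pr.
  rewrite (_ : d + (p ^ logn p n).-1 = d - 1 + p ^ logn p n) ; last by move: (p ^ logn p n) N0 => N N0; lia.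
  by rewrite -[in RHS]gcdn_modl modnDr gcdn_modl (logn_gcd_pfactor _ (pr p pn) n0).
have lg0 p : p \in primes n -> (logn p (gcdn (d - 1) n) == 0) = (d != 1 %[mod p]).
  move=> pn; rewrite -leqn0 leqNgt logn_gt0 mem_primes pr // gcdn_gt0 n0 orbT /=.
  rewrite dvdn_gcd -eqn_mod_dvd // andbC; congr (~~ _).
  by move: pn; rewrite mem_primes => /and3P[_ _ ->].
have gE : all (fun p => logn p (gcdn (d - 1) n) == f p) (primes n) ->
    \prod_(q <- primes n) q ^ f q = gcdn (d - 1) n.
  move=> /allP H; rewrite -[RHS](@prod_primes_logn n) ?dvdn_gcdr //.
  by rewrite big_seq [RHS]big_seq; apply: eq_bigr => q /H /eqP ->.
apply/andP/allP => [[/allP mult L] p pn|H].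
  rewrite loc // (gE L); case: ifPn => [/eqP f0|_]; last by rewrite -lgE // (allP L).
  have np1 : d != 1 %[mod p] by rewrite -lg0 // (eqP (allP L p pn)) f0.
  by rewrite np1; have := mult p pn; rewrite (negPf np1).
have L : all (fun p => logn p (gcdn (d - 1) n) == f p) (primes n).
  apply/allP=> p pn; have := H p pn; rewrite loc //; case: ifPn => [/eqP ->|_]; last by rewrite lgE.
  by rewrite lg0 // => /andP[].
split=> //; apply/allP=> p pn; have := H p pn; rewrite loc // (gE L).
case: ifPn => [_ /andP[_ ->]|f0 _]; first by rewrite orbT.
by rewrite -(eqP (allP L p pn)) lg0 // negbK in f0; rewrite f0.
Qed.

Lemma card_affine_mult n : 1 < n ->
  #|[set d : 'I_n | affine_mult n d]| =
  \sum_(F : {ffun 'I_n.+1 -> 'I_n.+1} | exponent_fun F)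
    (\prod_(q : 'I_n.+1 | (val q \in primes n) && (F q != 0 :> nat)) totient (q ^ (logn q n - F q))) *
    \prod_(p in heads F) (\prod_(q : 'I_n.+1) q ^ (minn (F q) (rqp q p)) - 1).
Proof.
move=> n1; have n0 := ltnW n1.
pose Fd (d : 'I_n) : {ffun 'I_n.+1 -> 'I_n.+1} :=
  [ffun q : 'I_n.+1 => if val q \in primes n then inord (logn q (gcdn (d - 1) n)) else ord0].
have lg_lt (d : 'I_n) q : logn q (gcdn (d - 1) n) < n.+1.
  apply: leq_ltn_trans (logn_leq q n); apply: dvdn_leq_log => //; exact: dvdn_gcdr.
rewrite -sum1_card (partition_big Fd (@exponent_fun n)) /=; last first.
  move=> d _; apply/forallP=> q; rewrite ffunE; case: ifP => // _.
  by rewrite inordK // dvdn_leq_log // dvdn_gcdr.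
apply: eq_bigr => F /forallP expF; pose f p : nat := F (inord p).
have fE (q : 'I_n.+1) : f q = F q by rewrite /f inord_val.
rewrite sum1dep_card.
transitivity #|[set d : 'I_n | all (fun p => local_cond n f p (d %% p ^ logn p n)) (primes n)]|.
  apply: eq_card => d; rewrite !inE -affine_mult_local //; congr (_ && _).
  apply/eqP/allP => [E p pn|H].
    have vp : (inord p : 'I_n.+1) = p :> nat by rewrite inordK ?primes_leq.
    by rewrite /f -E ffunE /= vp pn inordK.
  apply/ffunP=> q; rewrite ffunE; apply: val_inj; have := expF q.
  case: ifP => [qn _|_]; last by rewrite leqn0 /= => /eqP ->.
  by rewrite /= inordK // (eqP (H _ qn)) fE.
rewrite card_crt_primes //.
transitivity (\prod_(p <- primes n) (if f p == 0 then \prod_(q <- primes n) q ^ minn (f q) (rqp q p) - 1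
  else totient (p ^ (logn p n - f p)))).
  rewrite big_seq [RHS]big_seq; apply: eq_bigr => p pn; apply: card_local_cond => //.
  have vp : (inord p : 'I_n.+1) = p :> nat by rewrite inordK ?primes_leq.
  by have := expF (inord p); rewrite /= vp pn.
rewrite (@big_primes_ord _ _ _ n xpredT (fun p => if f p == 0 then _ else _)).
rewrite (bigID (fun p : 'I_n.+1 => F p != 0 :> nat)) /=; congr (_ * _).
  apply: eq_big => [p|p]; first by rewrite andbT.
  by case/andP=> _ Fp; rewrite fE (negPf Fp).
apply: eq_big => [p|p]; first by rewrite inE andbT negbK.
case/andP=> _; rewrite negbK fE => ->; congr (_ - 1).
rewrite (@big_primes_ord _ _ _ n xpredT (fun q => q ^ minn (f q) (rqp q p))).
rewrite [LHS]big_mkcond; apply: eq_bigr => q _; rewrite andbT fE.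
case: ifP => // qn; have := expF q; rewrite qn leqn0 => /eqP ->.
by rewrite min0n expn0.
Qed.

Unset Implicit Arguments.

Theorem theorem12p1 (n : nat) (hn : logn 2 n = 1 \/ logn 2 n = 2) :
  nu n =
  \sum_(G : {set 'I_n.+1 * 'I_n.+1} | short_spanning G)
    \prod_(q <- primes n | nonterminal G q)
      \sum_(1 <= f < (logn q n).+1)
         totient (q ^ (logn q n - f)) *
         \prod_(a in G | val a.1 == q) (q ^ (minn f (rqp q (val a.2))) - 1).
Proof.
have n0 : 0 < n by case: n hn => //; rewrite logn0 => -[].
have l2 : 0 < logn 2 n by case: hn => ->.
have n1 : 1 < n by apply: dvdn_leq => //; move: l2; rewrite logn_gt0 mem_primes => /and3P[].
have n8 : ~~ (8 %| n).
  by rewrite -[8]/(2 ^ 3) pfactor_dvdn //; case: hn => ->.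
by rewrite nu_affine_mult // card_affine_mult // sum_short_spanning.
Qed.
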